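(* An $8$-dimensional (real dimension) nilmanifold endowed with an invariant complex structure $X=(M,J)$ admits an invariant astheno-Kähler metric if and only if there exists an invariant $(1,0)$-coframe $\{\omega^k\}_{k=1}^4$ on $X$ satisfying $$d\omega^1=d\omega^2=d\omega^3=0,\qquad d\omega^4=\sum_{1\leq j<k\leq3}A_{jk}\,\omega^{jk}+\sum_{1\leq j,k\leq3}B_{jk}\,\omega^{j\bar k},$$ for some $A_{jk},B_{jk}\in\mathbb C$ with $\mathcal T=0$, where $$\mathcal T=\sum_{1\leq j<k\leq3}|A_{jk}|^2+\sum_{1\leq j,k\leq3}|B_{jk}|^2-\Big|\sum_{1\leq j\leq3}B_{jj}\Big|^2.$$
   Context: A nilmanifold $M=\Gamma\backslash G$ is a compact quotient of a connected, simply connected real nilpotent Lie group $G$ by a lattice $\Gamma$. Invariant complex structures, forms, coframes and metrics on $M$ are those induced by left-invariant ones on $G$, i.e. defined on its Lie algebra. A Hermitian metric (identified with its fundamental form $F$) on a complex manifold of complex dimension $n$ is astheno-Kähler if $\partial\bar\partial F^{n-2}=0$. Notation: $\omega^{jk}=\omega^j\wedge\omega^k$, $\omega^{j\bar k}=\omega^j\wedge\overline{\omega^k}$. *)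

(* Defs.v *)
From HB Require Import structures.
From mathcomp Require Import all_boot all_order all_algebra all_fingroup.
From mathcomp Require Import all_classical all_reals all_analysis.
From mathcomp Require Import complex.

Set Implicit Arguments.
Unset Strict Implicit.
Unset Printing Implicit Defensive.

Import Order.TTheory GRing.Theory Num.Theory.
Import numFieldNormedType.Exports.

Local Open Scope classical_set_scope.
Local Open Scope ring_scope.
Local Open Scope complex_scope.

Record is_lie_bracket (R : realType) (m : nat)
    (br : 'rV[R]_m -> 'rV[R]_m -> 'rV[R]_m) : Prop := IsLieBracket {
  lie_linearl : forall (a : R) x y z, br (a *: x + y) z = a *: br x z + br y z;
  lie_linearr : forall (a : R) x y z, br z (a *: x + y) = a *: br z x + br z y;
  lie_alternating : forall x, br x x = 0;
  lie_jacobi : forall x y z, br x (br y z) + br y (br z x) + br z (br x y) = 0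
}.

(* [lower_central br k.+1] is the span of the brackets [br x y] with [x] in
   [lower_central br k], as the intersection of the subspaces containing
   them. *)
Fixpoint lower_central (R : realType) (m : nat)
    (br : 'rV[R]_m -> 'rV[R]_m -> 'rV[R]_m) (k : nat) : set 'rV[R]_m :=
  if k is k'.+1 then
    [set z | forall U : {vspace 'rV[R]_m},
       (forall x y, lower_central br k' x -> br x y \in U) -> z \in U]
  else setT.

Definition is_nilpotent (R : realType) (m : nat)
    (br : 'rV[R]_m -> 'rV[R]_m -> 'rV[R]_m) : Prop :=
  exists k : nat, lower_central br k `<=` [set 0].

(* For a nilpotent Lie algebra, exp identifies the connected, simply connected
   Lie group with the Lie algebra itself, with neutral element 0, inverse -x
   and the Baker-Campbell-Hausdorff product. *)

(* [nested_bracket br [:: x1; ...; xk] = [x1, [x2, ... [x(k-1), xk]]]] *)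
Fixpoint nested_bracket (R : realType) (m : nat)
    (br : 'rV[R]_m -> 'rV[R]_m -> 'rV[R]_m) (w : seq 'rV[R]_m) : 'rV[R]_m :=
  match w with
  | [::] => 0
  | [:: x] => x
  | x :: w' => br x (nested_bracket br w')
  end.

(* Dynkin's formula for log (exp x exp y):
     sum_n (-1)^(n-1)/n sum_(r_i + s_i > 0)
       [x^r_1 y^s_1 ... x^r_n y^s_n] / ((sum_i r_i + s_i) prod_i r_i! s_i!).
   A nilpotent Lie algebra of dimension m has no nonzero nested bracket of
   more than m elements, so letting n, r_i, s_i <= m loses no term. *)
Definition bch (R : realType) (m : nat)
    (br : 'rV[R]_m -> 'rV[R]_m -> 'rV[R]_m) (x y : 'rV[R]_m) : 'rV[R]_m :=
  \sum_(1 <= n < m.+1)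
   \sum_(r : {ffun 'I_n -> 'I_m.+1})
    \sum_(s : {ffun 'I_n -> 'I_m.+1} | [forall i, (0 < r i + s i)%N])
      ((-1) ^+ n.-1 / n%:R / (\sum_i (r i + s i))%N%:R
         / (\prod_i ((r i)`! * (s i)`!))%N%:R) *:
      nested_bracket br
        (flatten [seq nseq (r i) x ++ nseq (s i) y | i <- enum 'I_n]).

(* [lattice_cocompact] is compactness of Gamma\G for the quotient topology,
   whose open sets are the open sets of G stable by left translation by
   Gamma. *)
Record is_lattice (R : realType) (m : nat)
    (br : 'rV[R]_m -> 'rV[R]_m -> 'rV[R]_m) (Gamma : set 'rV[R]_m) : Prop :=
  IsLattice {
  lattice_one : Gamma 0;
  lattice_mul : forall x y, Gamma x -> Gamma y -> Gamma (bch br x y);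
  lattice_inv : forall x, Gamma x -> Gamma (- x);
  lattice_discrete : forall x, Gamma x -> \forall y \near x, Gamma y -> y = x;
  lattice_cocompact :
    forall (I : choiceType) (D : set I) (f : I -> set 'rV[R]_m),
      (forall i, D i -> open (f i)) ->
      (forall i, D i -> forall g x, Gamma g -> f i x -> f i (bch br g x)) ->
      setT `<=` cover D f -> finite_subset_cover D f setT
}.

(* [J] acts on row vectors by [x |-> x *m J]. *)
Definition nijenhuis (R : realType) (m : nat)
    (br : 'rV[R]_m -> 'rV[R]_m -> 'rV[R]_m) (J : 'M[R]_m) (x y : 'rV[R]_m) :=
  br x y + br (x *m J) y *m J + br x (y *m J) *m J - br (x *m J) (y *m J).

Definition is_complex_structure (R : realType) (m : nat)
    (br : 'rV[R]_m -> 'rV[R]_m -> 'rV[R]_m) (J : 'M[R]_m) : Prop :=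
  J *m J = - 1%:M /\ forall x y, nijenhuis br J x y = 0.

(* Invariant complex-valued k-forms are the alternating C-multilinear maps on k arguments in
   the complexified Lie algebra C^m. *)

Definition inv_form (R : realType) (m k : nat) : Type :=
  ('I_k -> 'rV[R[i]]_m) -> R[i].

Definition is_form (R : realType) (m k : nat) (f : inv_form R m k) : Prop :=
  (forall (X : 'I_k -> 'rV[R[i]]_m) (j : 'I_k) (a : R[i]) (u v : 'rV[R[i]]_m),
     f [eta X with j |-> a *: u + v] =
       a * f [eta X with j |-> u] + f [eta X with j |-> v]) /\
  (forall (X : 'I_k -> 'rV[R[i]]_m) (j l : 'I_k),
     j != l -> X j = X l -> f X = 0).

Definition cplx_mx (R : realType) (m n : nat) (A : 'M[R]_(m, n)) :
    'M[R[i]]_(m, n) := map_mx (fun x : R => x%:C) A.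

Definition cplx_bracket (R : realType) (m : nat)
    (br : 'rV[R]_m -> 'rV[R]_m -> 'rV[R]_m) (z w : 'rV[R[i]]_m) :
    'rV[R[i]]_m :=
  let re := map_mx (@complex.Re R) in let im := map_mx (@complex.Im R) in
  cplx_mx (br (re z) (re w) - br (im z) (im w)) +
  'i *: cplx_mx (br (re z) (im w) + br (im z) (re w)).

Definition conj_form (R : realType) (m k : nat) (f : inv_form R m k) :
    inv_form R m k :=
  fun X => conjc (f (fun j => map_mx conjc (X j))).

Definition wedge (R : realType) (m p q : nat)
    (f : inv_form R m p) (g : inv_form R m q) : inv_form R m (p + q) :=
  fun X => ((p`! * q`!)%N%:R)^-1 *
    \sum_(s : 'S_(p + q)) (-1) ^+ s *
      (f (fun j => X (s (lshift q j))) * g (fun j => X (s (rshift p j)))).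

Fixpoint form_pow (R : realType) (m : nat) (F : inv_form R m 2) (k : nat) :
    inv_form R m k.*2 :=
  if k is k'.+1 then wedge F (@form_pow R m F k') else fun _ => 1.
Arguments form_pow {R m} F k X : rename.

(* The differential of left-invariant forms,
     (df)(X_0, ..., X_k) =
       sum_(i < j) (-1)^(i+j) f([X_i, X_j], X_0, ..^i..^j.., X_k),
   with [X_i, X_j] moved to the place of X_i, which turns the sign into
   (-1)^j. *)
Definition ext_d (R : realType) (m k : nat)
    (br : 'rV[R]_m -> 'rV[R]_m -> 'rV[R]_m) (f : inv_form R m k) :
    inv_form R m k.+1 :=
  fun X => \sum_(j < k.+1) \sum_(i < k.+1 | (i < j)%N) (-1) ^+ j *
    f (fun l => [eta X with i |-> cplx_bracket br (X i) (X j)] (lift j l)).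

Definition proj10 (R : realType) (m : nat) (J : 'M[R]_m) (z : 'rV[R[i]]_m) :
    'rV[R[i]]_m := 2^-1 *: (z - 'i *: (z *m cplx_mx J)).

Definition proj01 (R : realType) (m : nat) (J : 'M[R]_m) (z : 'rV[R[i]]_m) :
    'rV[R[i]]_m := 2^-1 *: (z + 'i *: (z *m cplx_mx J)).

(* The component of bidegree (p, k - p) of a k-form (0 if p > k). *)
Definition bidegree_part (R : realType) (m k : nat) (J : 'M[R]_m) (p : nat)
    (f : inv_form R m k) : inv_form R m k :=
  fun X => \sum_(S : {set 'I_k} | #|S| == p)
    f (fun j => if j \in S then proj10 J (X j) else proj01 J (X j)).

Definition del (R : realType) (m k : nat)
    (br : 'rV[R]_m -> 'rV[R]_m -> 'rV[R]_m) (J : 'M[R]_m) (f : inv_form R m k) :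
    inv_form R m k.+1 :=
  fun X => \sum_(p < k.+1)
    bidegree_part J p.+1 (ext_d br (bidegree_part J p f)) X.

Definition delbar (R : realType) (m k : nat)
    (br : 'rV[R]_m -> 'rV[R]_m -> 'rV[R]_m) (J : 'M[R]_m) (f : inv_form R m k) :
    inv_form R m k.+1 :=
  fun X => \sum_(p < k.+1)
    bidegree_part J p (ext_d br (bidegree_part J p f)) X.

Definition is_form10 (R : realType) (m : nat) (J : 'M[R]_m)
    (f : inv_form R m 1) : Prop :=
  is_form f /\ forall X, bidegree_part J 1 f X = f X.

(* A coframe is a basis of the space of invariant (1,0)-forms. *)
Definition is_coframe10 (R : realType) (m n : nat) (J : 'M[R]_m)
    (w : 'I_n -> inv_form R m 1) : Prop :=
  (forall k, is_form10 J (w k)) /\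
  (forall f : inv_form R m 1, is_form10 J f ->
     exists! c : 'rV[R[i]]_n, forall X, f X = \sum_(k < n) c 0 k * w k X).

(* [h] is the Gram matrix of the metric. *)
Definition is_hermitian_metric (R : realType) (m : nat) (J h : 'M[R]_m) :
    Prop :=
  [/\ h^T = h,
      forall x : 'rV[R]_m, x != 0 -> 0 < (x *m h *m x^T) 0 0
    & forall x y : 'rV[R]_m,
        ((x *m J) *m h *m (y *m J)^T) 0 0 = (x *m h *m y^T) 0 0].

(* F(x, y) = h(Jx, y), extended C-bilinearly *)
Definition fundamental_form (R : realType) (m : nat) (J h : 'M[R]_m) :
    inv_form R m 2 :=
  fun X => (X 0 *m cplx_mx J *m cplx_mx h *m (X 1)^T) 0 0.

(* The complex dimension n is m./2. *)
Definition is_astheno_kahler (R : realType) (m : nat)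
    (br : 'rV[R]_m -> 'rV[R]_m -> 'rV[R]_m) (J h : 'M[R]_m) : Prop :=
  is_hermitian_metric J h /\
  forall X, del br J (delbar br J
    (form_pow (fundamental_form J h) (m./2 - 2))) X = 0.

(* Main.v *)
Require Import Defs.
From HB Require Import structures.
From mathcomp Require Import all_boot all_order all_algebra all_fingroup.
From mathcomp Require Import all_classical all_reals all_analysis.
From mathcomp Require Import complex sesquilinear spectral.
From mathcomp Require Import ring lra zify.

Set Implicit Arguments.
Unset Strict Implicit.
Unset Printing Implicit Defensive.

Import Order.TTheory GRing.Theory Num.Theory.
Import numFieldNormedType.Exports.

Local Open Scope ring_scope.

(* Let F be astheno-Kaehler.  Pairing [del delbar F^2] with two invariant
   (1,0)-forms and using that a nilpotent Lie algebra is unimodular gives a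
   Hermitian identity [Q(alpha, beta) = 0] in a unitary coframe, where
     Q(alpha, beta) = <d alpha, d beta> - tr(d alpha) conj(tr(d beta))
                      + <s alpha, beta> + conj <s beta, alpha>,
   [tr] contracts the (1,1)-part and [s] is a contraction of [delbar del].
   On the space L of forms with [delbar del alpha = 0] this reads
   |d alpha|^2 = |tr(d alpha)|^2, so the forms of L with zero trace are closed.
   Engel's theorem provides, for every proper subspace U, a form outside U all
   of whose [delbar]-coefficients lie in U; applied to the closed forms and to
   L, it shows together with the Cauchy-Schwarz inequality that L contains
   every (1,0)-form.  The closed forms are then the kernel of the linear form
   [tr], of codimension at most 1, and T = 0 is the identity above for the last
   form of an adapted unitary coframe.  Conversely, for the metric making the
   given coframe unitary, [Q] vanishes identically, hence so does
   [del delbar F^2], by the same identity. *)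

(** * Structure tables of an astheno-Kaehler metric *)

(** The contraction terms of [Q] are the obstacle: they have no sign, so no norm estimate is
    available outside L. What remains usable there is the pairing with a closed form, where every
    term of [Q] but one contraction drops out: the contraction of [delbar del alpha] is orthogonal
    to the closed forms. To exploit this, [delbar del alpha] must be built from closed forms alone,
    and the coefficients supplied by Engel's theorem make that possible. If L were proper, dimension
    four would leave at most two dimensions for the space W of closed forms; then W^W is at most a
    line, and a (2,1)-form in W^W^conj(W) whose contraction is orthogonal to W must vanish. The
    identity behind [Q] is Stokes' theorem. It is proved as an identity of polynomials in the
    structure constants and their conjugates, taken as independent variables subject only to linear
    relations (skew-symmetry and zero traces). Since [del] and [delbar] are defined by projection to
    bidegrees, they are first replaced, on arguments of pure type, by the differentials of two
    truncated brackets; the Leibniz rule is then a finite expansion. *)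

Section LinearForms.
Variable C : numClosedFieldType.
Implicit Types (c : 'I_4 -> C) (z y : 'rV[C]_4).

Definition ev c z : C := \sum_k z 0 k * c k.

Lemma evP c x z y : ev c (x *: z + y) = x * ev c z + ev c y.
Proof.
rewrite /ev mulr_sumr -big_split /=; apply: eq_bigr => k _.
by rewrite !mxE mulrDl mulrA.
Qed.

Lemma ev0 c : ev c 0 = 0.
Proof. by rewrite /ev big1 // => k _; rewrite mxE mul0r. Qed.

Lemma evD c z y : ev c (z + y) = ev c z + ev c y.
Proof. by have := evP c 1 z y; rewrite scale1r mul1r. Qed.

Lemma evZ c x z : ev c (x *: z) = x * ev c z.
Proof. by rewrite -[x *: z]addr0 evP ev0 addr0. Qed.

Lemma ev_sum c (I : finType) (F : I -> 'rV[C]_4) :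
  ev c (\sum_i F i) = \sum_i ev c (F i).
Proof. by apply: (big_morph _ (evD c) (ev0 c)). Qed.

Lemma ev_delta c k : ev c (delta_mx 0 k) = c k.
Proof.
rewrite /ev (bigD1 k) //= mxE !eqxx mul1r big1 ?addr0 // => i /negbTE ik.
by rewrite mxE ik mul0r.
Qed.

Lemma conjM (x y : C) : (x * y)^* = x^* * y^*. Proof. exact: rmorphM. Qed.
Lemma conjD (x y : C) : (x + y)^* = x^* + y^*. Proof. exact: rmorphD. Qed.
Lemma conjB (x y : C) : (x - y)^* = x^* - y^*. Proof. exact: rmorphB. Qed.
Lemma conjV (x : C) : (x^-1)^* = (x^*)^-1. Proof. exact: fmorphV. Qed.
Lemma conj_sum (I : finType) (F : I -> C) : (\sum_i F i)^* = \sum_i (F i)^*.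
Proof. exact: rmorph_sum. Qed.

Lemma sum_normsq_eq0 (I : finType) (F : I -> C) :
  \sum_i F i * (F i)^* = 0 -> forall i, F i = 0.
Proof.
move=> h i; apply/eqP; rewrite -normr_eq0 -sqrf_eq0 normCK; apply/eqP.
by move: h => /psumr_eq0P -> // k _; rewrite -normCK exprn_ge0.
Qed.

Lemma sum_normsq_ge0 (I : finType) (F : I -> C) : 0 <= \sum_i F i * (F i)^*.
Proof. by apply: sumr_ge0 => k _; rewrite -normCK exprn_ge0. Qed.

(** Twice the difference of the two sides is Lagrange's sum of the
    [|m i conj(n j) - m j conj(n i)|^2]. *)
Lemma cauchy_schwarz4 (m n : 'I_4 -> C) :
  (\sum_i m i * n i) * (\sum_i m i * n i)^* <=
  \sum_i \sum_j (m i * n j) * (m i * n j)^*.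
Proof.
rewrite -subr_ge0 -(pmulr_rge0 _ (ltr0n C 2)).
have : 0 <= \sum_i \sum_j (m i * (n j)^* - m j * (n i)^*) *
    (m i * (n j)^* - m j * (n i)^*)^*.
  by apply: sumr_ge0 => i _; apply: sum_normsq_ge0.
congr (0 <= _).
by rewrite !big_ord_recl !big_ord0 /= !(rmorphD, rmorphM, rmorphB, rmorphN, rmorph0) /= !conjCK; ring.
Qed.

End LinearForms.

Section Tables.
Variable C : numClosedFieldType.
Variables a b : 'I_4 -> 'I_4 -> 'I_4 -> C.
Implicit Types z y : 'rV[C]_4.

(* [dw^k = 1/2 sum_ij (a k i j) w^i w^j + sum_ij (b k i j) w^i conj(w^j)] in a
   unitary coframe [w]; the row [z] stands for the (1,0)-form [sum_k z_k w^k],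
   and [dbd z], [ddb z] are the (2,1)-forms [delbar del z], [del delbar z]. *)
Definition da z i j := ev (fun k => a k i j) z.
Definition db z i j := ev (fun k => b k i j) z.
Definition trb z := ev (fun k => \sum_i b k i i) z.
Definition dclosed z := (forall i j, da z i j = 0) /\ (forall i j, db z i j = 0).
(** [colb] and [crowb] read [delbar z] with (1,0)-coefficients in two ways: [delbar z = sum_l (colb
    z l) ^ conj(w^l) = sum_i w^i ^ conj(crowb z i)]. In the same way
    [del z = 1/2 sum_i w^i ^ (rowa z i)]. *)
Definition colb z l : 'rV[C]_4 := \row_i db z i l.
Definition crowb z i : 'rV[C]_4 := \row_j (db z i j)^*.
Definition rowa z i : 'rV[C]_4 := \row_j da z i j.
Definition dbd z l i k := db (rowa z k) i l - db (rowa z i) k l.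
Definition ddb z l i k :=
  da (colb z l) i k + (db (crowb z i) l k)^* - (db (crowb z k) l i)^*.
Definition contr z m := \sum_l dbd z l l m.
Definition Lform z := forall l i k, dbd z l i k = 0.
Definition Q z y :=
  2^-1 * \sum_i \sum_j da z i j * (da y i j)^*
  + \sum_i \sum_j db z i j * (db y i j)^* - trb z * (trb y)^*
  + \sum_m contr z m * (y 0 m)^* + (\sum_m contr y m * (z 0 m)^*)^*.

(** [dbar2] and [dbd_ddb] are the (1,2)- and (2,1)-components of [d^2 = 0]. In [engel] the predicate
    need not define a subspace: the proof only iterates [colb] until it reaches the zero form. *)
Record tableP : Prop := TableP {
  a_skew : forall k i j, a k i j = - a k j i;
  dbar2 : forall z i l j,
    (da (crowb z i) l j)^* = db (colb z j) i l - db (colb z l) i j;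
  dbd_ddb : forall z l i k, dbd z l i k = - ddb z l i k;
  engel : forall U : 'rV[C]_4 -> Prop, U 0 -> (exists z, ~ U z) ->
    exists2 z, ~ U z & forall l, U (colb z l);
  Q_eq0 : forall z y, Q z y = 0 }.

Hypothesis H : tableP.

Lemma trbE z : trb z = \sum_i db z i i.
Proof. by rewrite /trb /db /ev exchange_big; apply: eq_bigr => k _; rewrite mulr_sumr. Qed.

Lemma closed0 : dclosed 0. Proof. by split=> i j; rewrite /da /db ev0. Qed.

Lemma closedP x z y : dclosed z -> dclosed y -> dclosed (x *: z + y).
Proof.
move=> [az bz] [ay by_]; split=> i j; rewrite /da /db evP.
  by rewrite [ev _ z]az [ev _ y]ay mulr0 addr0.
by rewrite [ev _ z]bz [ev _ y]by_ mulr0 addr0.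
Qed.

Lemma closedZ x z : dclosed z -> dclosed (x *: z).
Proof. by move=> h; rewrite -[x *: z]addr0; apply: closedP => //; exact: closed0. Qed.

Lemma closed_sum (I : finType) (F : I -> 'rV[C]_4) :
  (forall i, dclosed (F i)) -> dclosed (\sum_i F i).
Proof.
move=> h; apply: big_ind => [|u v hu hv|i _]; [exact: closed0| |exact: h].
by have := closedP 1 hu hv; rewrite scale1r.
Qed.

Lemma da_row_lin x z y i : rowa (x *: z + y) i = x *: rowa z i + rowa y i.
Proof. by apply/rowP=> j; rewrite !mxE /da evP. Qed.

Lemma dbdP x z y l i k : dbd (x *: z + y) l i k = x * dbd z l i k + dbd y l i k.
Proof. by rewrite /dbd !da_row_lin /db !evP; ring. Qed.

Lemma dbd_da0 z : (forall i j, da z i j = 0) -> Lform z.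
Proof.
move=> h l i k; have r0 m : rowa z m = 0 by apply/rowP=> j; rewrite !mxE h.
by rewrite /dbd !r0 /db !ev0 subr0.
Qed.

Lemma closed_L z : dclosed z -> Lform z. Proof. by case=> h _; exact: dbd_da0. Qed.

Lemma LP x z y : Lform z -> Lform y -> Lform (x *: z + y).
Proof. by move=> hz hy l i k; rewrite dbdP hz hy mulr0 addr0. Qed.

Lemma L_sum (I : finType) (F : I -> 'rV[C]_4) :
  (forall i, Lform (F i)) -> Lform (\sum_i F i).
Proof.
move=> h; apply: big_ind => [|u v hu hv|i _]; [exact/closed_L/closed0| |exact: h].
by have := LP 1 hu hv; rewrite scale1r.
Qed.

Lemma contr_L z m : Lform z -> contr z m = 0.
Proof. by move=> h; rewrite /contr big1. Qed.

Lemma closed_trb z : dclosed z -> trb z = 0.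
Proof. by case=> _ h; rewrite trbE big1. Qed.

Lemma L_norm z : Lform z ->
  2^-1 * \sum_i \sum_j da z i j * (da z i j)^*
  + \sum_i \sum_j db z i j * (db z i j)^* = trb z * (trb z)^*.
Proof.
move=> h; have := Q_eq0 H z z; rewrite /Q.
have -> : \sum_m contr z m * (z 0 m)^* = 0.
  by rewrite big1 // => m _; rewrite contr_L ?mul0r.
by rewrite rmorph0 !addr0 => /eqP; rewrite subr_eq0 => /eqP.
Qed.

Lemma double_normsq_eq0 (F : 'I_4 -> 'I_4 -> C) :
  \sum_i \sum_j F i j * (F i j)^* = 0 -> forall i j, F i j = 0.
Proof.
move=> h i j; move: h; rewrite pair_bigA /=.
by move/(sum_normsq_eq0 (F := fun p => F p.1 p.2))/(_ (i, j)).
Qed.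

Lemma double_normsq_ge0 (F : 'I_4 -> 'I_4 -> C) :
  0 <= \sum_i \sum_j F i j * (F i j)^*.
Proof. by apply: sumr_ge0 => i _; exact: sum_normsq_ge0. Qed.

Lemma L_trb0_closed z : Lform z -> trb z = 0 -> dclosed z.
Proof.
move=> hL t0; have := L_norm hL; rewrite t0 mul0r => /eqP.
rewrite paddr_eq0 ?mulr_ge0 ?invr_ge0 ?ler0n ?double_normsq_ge0 //.
rewrite mulf_eq0 invr_eq0 pnatr_eq0 /= => /andP[/eqP ha /eqP hb].
by split=> i j; [exact: (double_normsq_eq0 ha)|exact: (double_normsq_eq0 hb)].
Qed.

(** For a coefficient matrix of rank one, Cauchy-Schwarz gives [|tr|^2 <= |delbar z|^2], and
    [L_norm] then leaves nothing for [|del z|^2]. *)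
Lemma L_rank1_da0 z (m n : 'I_4 -> C) : Lform z ->
  (forall i j, db z i j = m i * n j) -> forall i j, da z i j = 0.
Proof.
move=> hL hb; apply: double_normsq_eq0; apply/eqP.
have h2 : (2^-1 : C) != 0 by rewrite invr_eq0 pnatr_eq0.
rewrite -(mulrI_eq0 _ (mulfI h2)).
rewrite eq_le mulr_ge0 ?invr_ge0 ?ler0n ?double_normsq_ge0 // andbT.
have -> := canRL (addrK _) (L_norm hL); rewrite subr_le0.
have -> : trb z = \sum_i m i * n i by rewrite trbE; apply: eq_bigr => i _.
have -> : \sum_i \sum_j db z i j * (db z i j)^* =
          \sum_i \sum_j (m i * n j) * (m i * n j)^*.
  by apply: eq_bigr => i _; apply: eq_bigr => j _; rewrite hb.
exact: cauchy_schwarz4.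
Qed.

(** The trace is injective on L modulo closed forms, so that quotient is at most a line and any two
    forms of L have proportional differentials. *)
Lemma L_prop z y : Lform z -> Lform y -> trb z != 0 ->
  dclosed (- (trb y / trb z) *: z + y).
Proof.
move=> hz hy t0; apply: L_trb0_closed; first exact: LP.
by rewrite /trb evP -/(trb z) -/(trb y) mulNr divfK // addNr.
Qed.

Lemma L_prop_da z y i j : Lform z -> Lform y -> trb z != 0 ->
  da y i j = trb y / trb z * da z i j.
Proof.
move=> hz hy t0; have [/(_ i j)] := L_prop hz hy t0.
by rewrite /da evP mulNr addrC => /eqP; rewrite subr_eq0 => /eqP ->.
Qed.

Lemma L_prop_db z y i j : Lform z -> Lform y -> trb z != 0 ->
  db y i j = trb y / trb z * db z i j.
Proof.
move=> hz hy t0; have [_ /(_ i j)] := L_prop hz hy t0.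
by rewrite /db evP mulNr addrC => /eqP; rewrite subr_eq0 => /eqP ->.
Qed.

(** Off the diagonal [Q] is used only here: against a closed [y] the norms, the trace and [contr y]
    all vanish, and a single contraction survives. *)
Lemma contr_closed z y : dclosed y -> \sum_m contr z m * (y 0 m)^* = 0.
Proof.
move=> cy; have := Q_eq0 H z y; rewrite /Q (closed_trb cy).
have [ay by_] := cy.
rewrite big1 => [|i _]; last by rewrite big1 // => j _; rewrite ay rmorph0 mulr0.
rewrite big1 => [|i _]; last by rewrite big1 // => j _; rewrite by_ rmorph0 mulr0.
rewrite rmorph0 !mulr0 addr0 subr0 add0r.
rewrite [X in _ + X^*]big1 => [|m _]; last by rewrite contr_L ?mul0r //; exact: closed_L.
by rewrite rmorph0 addr0.
Qed.

Lemma contr_ddb z m : contr z m = - \sum_l ddb z l l m.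
Proof. by rewrite /contr -sumrN; apply: eq_bigr => l _; rewrite (dbd_ddb H). Qed.

Lemma closed_crowb_ddb z l i k : (forall l, dclosed (colb z l)) ->
  ddb z l i k = (db (crowb z i) l k)^* - (db (crowb z k) l i)^*.
Proof. by move=> /(_ l)[h _]; rewrite /ddb h add0r. Qed.

Lemma ddb_L z : (forall l i k, ddb z l i k = 0) -> Lform z.
Proof. by move=> h l i k; rewrite (dbd_ddb H) h oppr0. Qed.

(** By [dbar2] the forms [crowb z i] lie in L, so they are closed as soon as their traces vanish. If
    some trace did not, an equality case of Cauchy-Schwarz would make [crowb z i0] a multiple of the
    closed form [al], against its nonzero trace. *)
Lemma colb_closed_crowb z : (forall l, dclosed (colb z l)) ->
  (forall i, dclosed (crowb z i)) /\ Lform z.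
Proof.
move=> hc.
have Lr i : Lform (crowb z i).
  apply: dbd_da0 => l j; apply/eqP; rewrite -conjC_eq0 (dbar2 H).
  by have [_ ->] := hc j; have [_ ->] := hc l; rewrite subrr.
(* Tracing in the other order writes the same vector as a combination of the [colb z l], which is
   why it is closed. *)
pose al : 'rV[C]_4 := \row_i (trb (crowb z i))^*.
have al_closed : dclosed al.
  have -> : al = \sum_l (\sum_i b l i i)^* *: colb z l.
    apply/rowP=> i; rewrite mxE /trb /ev conj_sum summxE.
    by apply: eq_bigr => l _; rewrite !mxE conjM /= conjCK mulrC.
  by apply: closed_sum => l; exact: closedZ.
have [al0|/existsNP[i0]] := pselect (forall i, trb (crowb z i) = 0).
  have cr i : dclosed (crowb z i) by apply: L_trb0_closed.
  split=> //; apply: ddb_L => l i k; rewrite closed_crowb_ddb //.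
  by have [_ ->] := cr i; have [_ ->] := cr k; rewrite subrr.
move/eqP=> t0; exfalso.
set g := crowb z i0 in t0 *; set B := fun i j => db g i j / trb g.
have dbB i l k : db (crowb z i) l k = (al 0 i)^* * B l k.
  by rewrite (L_prop_db _ _ (Lr i0) (Lr i) t0) mxE conjCK /B; field.
have trB : \sum_l B l l = 1 by rewrite /B -mulr_suml -trbE divff.
pose P l m := al 0 l * (al 0 m)^*.
pose n := \sum_m al 0 m * (al 0 m)^*.
have ddbE l i k : ddb z l i k = al 0 i * (B l k)^* - al 0 k * (B l i)^*.
  by rewrite closed_crowb_ddb // !dbB !conjM !conjCK.
(* The contraction of [z] is paired with [al] itself; together with [BB] and [PP] below this gives
   [<P, B> = n], [|B| = 1] and [|P| = n]. *)
have PB : \sum_l \sum_m P l m * (B l m)^* = n.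
  have := contr_closed z al_closed.
  under eq_bigr => m _ do rewrite contr_ddb.
  under eq_bigr => m _ do under eq_bigr => l _ do rewrite ddbE.
  move=> h; apply/eqP; rewrite -subr_eq0 -oppr_eq0; apply/eqP; rewrite -[RHS]h.
  rewrite /n /P exchange_big -sumrB -sumrN; apply: eq_bigr => m _.
  rewrite sumrB -mulr_sumr -conj_sum trB rmorph1 mulr1.
  rewrite mulNr mulrBl; congr (- (_ - _)).
  by rewrite mulr_suml; apply: eq_bigr => l _; ring.
have BB : \sum_l \sum_m B l m * (B l m)^* = 1.
  have := L_norm (Lr i0); rewrite -/g big1; last first.
    move=> l _; rewrite big1 // => j _.
    have -> : da g l j = 0; last by rewrite mul0r.
    apply/eqP; rewrite -conjC_eq0 (dbar2 H).
    by have [_ ->] := hc j; have [_ ->] := hc l; rewrite subrr.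
  rewrite mulr0 add0r => h.
  have tt0 : trb g * (trb g)^* != 0 by rewrite mulf_neq0 ?conjC_eq0.
  apply: (mulIf tt0); rewrite mul1r -[RHS]h mulr_suml; apply: eq_bigr => l _.
  rewrite mulr_suml; apply: eq_bigr => m _; rewrite /B conjM conjV.
  by field; rewrite conjC_eq0 t0.
have nJ : n^* = n.
  by rewrite /n conj_sum; apply: eq_bigr => m _; rewrite conjM conjCK mulrC.
have PP : \sum_l \sum_m P l m * (P l m)^* = n * n.
  rewrite {1}/n mulr_suml; apply: eq_bigr => l _; rewrite /n mulr_sumr.
  by apply: eq_bigr => m _; rewrite /P conjM conjCK; ring.
have BP : \sum_l \sum_m B l m * (P l m)^* = n.
  rewrite -nJ -PB conj_sum; apply: eq_bigr => l _; rewrite conj_sum.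
  by apply: eq_bigr => m _; rewrite [RHS]conjM conjCK mulrC.
(* Equality in Cauchy-Schwarz: [|n B - P|^2 = n^2 - 2 n^2 + n^2 = 0], so [B] has rank one in the
   direction of [al]. *)
have nB l m : n * B l m = P l m.
  apply/eqP; rewrite -subr_eq0; apply/eqP; move: l m.
  apply: double_normsq_eq0.
  have expand (c : C) : c^* = c ->
      \sum_l \sum_m (c * B l m - P l m) * (c * B l m - P l m)^* =
      c * c * \sum_l \sum_m B l m * (B l m)^*
    - c * \sum_l \sum_m B l m * (P l m)^*
    - c * \sum_l \sum_m P l m * (B l m)^* + \sum_l \sum_m P l m * (P l m)^*.
    move=> cJ; rewrite !mulr_sumr -!sumrB -big_split; apply: eq_bigr => l _.
    rewrite !mulr_sumr -!sumrB -big_split; apply: eq_bigr => m _ /=.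
    by rewrite conjB conjM cJ; ring.
  by rewrite expand // BB BP PB PP; ring.
have al_i0 : al 0 i0 != 0 by rewrite mxE conjC_eq0.
have n0 : n != 0.
  by apply/eqP=> h; move: al_i0; rewrite (sum_normsq_eq0 h i0) eqxx.
have Lz : Lform z.
  apply: ddb_L => l i k; rewrite ddbE; apply: (mulfI n0); rewrite mulr0.
  have -> : n * (al 0 i * (B l k)^* - al 0 k * (B l i)^*) =
    al 0 i * (n * B l k)^* - al 0 k * (n * B l i)^* by rewrite !conjM nJ; ring.
  by rewrite !nB /P !conjM !conjCK; ring.
(* Now that [z] is in L, [delbar z] is proportional to [delbar g], hence to [P], all of whose
   conjugated rows are multiples of [al]. *)
have gal : g = ((trb z)^* * (al 0 i0)^* / n) *: al.
  apply/rowP=> j; rewrite [LHS]mxE (L_prop_db _ _ (Lr i0) Lz t0) mxE.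
  have -> : trb z / trb (crowb z i0) * db (crowb z i0) i0 j = trb z / n * (n * B i0 j).
    by rewrite /B -/g; field; rewrite t0 n0.
  by rewrite nB /P !conjM conjV nJ conjCK; field.
by move: t0; rewrite gal closed_trb ?eqxx //; exact: closedZ.
Qed.


Section TwoDim.
Variables u v : 'rV[C]_4.
Hypotheses (cu : dclosed u) (cv : dclosed v).
Hypothesis span_uv : forall w, dclosed w -> exists x y : C, w = x *: u + y *: v.

Definition wed (p q : 'rV[C]_4) i k := p 0 i * q 0 k - p 0 k * q 0 i.

Lemma wed_closed p q : dclosed p -> dclosed q ->
  exists c, forall i k, wed p q i k = c * wed u v i k.
Proof.
move=> /span_uv[x [y ->]] /span_uv[x' [y' ->]]; exists (x * y' - y * x') => i k.
by rewrite /wed !mxE; ring.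
Qed.

(* A form in [W^W^conj W], [dim W <= 2], whose contractions with [conj W]
   vanish is zero. *)
Lemma contr_wed_eq0 (om : 'I_4 -> 'I_4 -> 'I_4 -> C) :
  (forall l, exists c, forall i k, om l i k = c * wed u v i k) ->
  (forall i k, dclosed (\row_l (om l i k)^*)) ->
  (forall w, dclosed w -> \sum_m (\sum_l om l l m) * (w 0 m)^* = 0) ->
  forall l i k, om l i k = 0.
Proof.
move=> h1 h2 h3.
have [uv0|] := pselect (forall i k, wed u v i k = 0).
  by move=> l i k; have [c ->] := h1 l; rewrite uv0 mulr0.
move/existsNP=> [i0 /existsNP[k0 /eqP w0]].
pose c l := om l i0 k0 / wed u v i0 k0.
have omE l i k : om l i k = c l * wed u v i k.
  by rewrite /c; have [c' hc'] := h1 l; rewrite !hc'; field.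
pose ka : 'rV[C]_4 := \row_l (c l)^*.
have cka : dclosed ka.
  have -> : ka = ((wed u v i0 k0)^-1)^* *: \row_l (om l i0 k0)^*.
    by apply/rowP=> l; rewrite !mxE /c conjM mulrC.
  exact: closedZ.
pose su := \sum_l u 0 l * c l; pose sv := \sum_l v 0 l * c l.
(* [sg] is the contraction of [om]. It is itself closed, so the orthogonality hypothesis applies to
   it and makes its norm zero. *)
pose sg : 'rV[C]_4 := su *: v + (- sv) *: u.
have csg : dclosed sg by apply: closedP => //; exact: closedZ.
have sgE m : \sum_l om l l m = sg 0 m.
  rewrite !mxE mulNr !mulr_suml -sumrB; apply: eq_bigr => l _.
  by rewrite omE /wed; ring.
have sg0 m : sg 0 m = 0.
  apply: (sum_normsq_eq0 (F := fun m => sg 0 m)).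
  by rewrite -[RHS](h3 _ csg); apply: eq_bigr => i _; rewrite sgE.
have e m : su * v 0 m = sv * u 0 m.
  by have := sg0 m; rewrite !mxE mulNr => /eqP; rewrite subr_eq0 => /eqP.
have su0 : su = 0.
  apply: (mulIf w0); rewrite mul0r /wed.
  have -> : su * (u 0 i0 * v 0 k0 - u 0 k0 * v 0 i0) =
    u 0 i0 * (su * v 0 k0) - u 0 k0 * (su * v 0 i0) by ring.
  by rewrite !e; ring.
have sv0 : sv = 0.
  apply: (mulIf w0); rewrite mul0r /wed.
  have -> : sv * (u 0 i0 * v 0 k0 - u 0 k0 * v 0 i0) =
    v 0 k0 * (sv * u 0 i0) - v 0 i0 * (sv * u 0 k0) by ring.
  by rewrite -!e; ring.
(* [su = sv = 0] says that [ka] is orthogonal to [u] and to [v], while it lies in their span. *)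
have [x [y ekl]] := span_uv cka.
have ka0 m : ka 0 m = 0.
  apply: (sum_normsq_eq0 (F := fun m => ka 0 m)).
  transitivity (x * su + y * sv); last by rewrite su0 sv0 !mulr0 addr0.
  rewrite /su /sv !mulr_sumr -big_split; apply: eq_bigr => l _ /=.
  have -> : (ka 0 l)^* = c l by rewrite mxE conjCK.
  by rewrite ekl !mxE; ring.
move=> l i k; rewrite omE; have /eqP := ka0 l.
by rewrite mxE conjC_eq0 => /eqP ->; rewrite mul0r.
Qed.

End TwoDim.

(** By contradiction, with two Engel forms: [ze] is not closed but its coefficients are, and [xi] is
    outside L with coefficients in L. Modulo closed forms everything in L is a multiple of [ze], so
    [d xi] is governed by the factors [g l] of its coefficients, gathered in the form [ga]. *)
Lemma all_Lform : forall z, Lform z.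
Proof.
have [all_closed z|] := pselect (forall z, dclosed z); first exact: closed_L.
move/existsNP=> [z0 nz0].
have [ze nze hze] := engel H closed0 (ex_intro _ z0 nz0).
have [crze Lze] := colb_closed_crowb hze.
have t0 : trb ze != 0 by apply/eqP => t0; apply: nze; exact: L_trb0_closed.
apply: contrapT => /existsNP nL.
have [xi nxi hxi] := engel H (closed_L closed0) nL.
have [u [v [cu cv uv]]] : exists u v, [/\ dclosed u, dclosed v &
    forall w, dclosed w -> exists x y : C, w = x *: u + y *: v].
  have [W0|/existsNP[u /not_implyP[cu nu]]] := pselect (forall w, dclosed w -> w = 0).
    exists 0, 0; split; [exact: closed0|exact: closed0|].
    by move=> w /W0 ->; exists 0, 0; rewrite !scaler0 addr0.
  have [W1|] := pselect (forall w, dclosed w -> exists x, w = x *: u).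
    exists u, 0; split=> //; first exact: closed0.
    by move=> w /W1[x ->]; exists x, 0; rewrite scaler0 addr0.
  move/existsNP=> [v /not_implyP[cv nv]].
  exists u, v; split=> // w cw; apply: contrapT => nw.
  (* Five vectors of a 4-dimensional space are dependent. In a relation [xi] has coefficient 0
     because the others are in L, then [ze] because it alone has a trace; so three closed forms are
     always dependent. *)
  pose M : 'M[C]_(5, 4) := \matrix_(i < 5) nth 0 [:: u; v; w; ze; xi] i.
  have /rowV0Pn[x /sub_kermxP xM x0] : kermx M != 0.
    rewrite -mxrank_eq0 mxrank_ker -lt0n subn_gt0.
    by rewrite (leq_ltn_trans (rank_leq_col _)).
  have e : x 0 (inord 0) *: u + x 0 (inord 1) *: v + x 0 (inord 2) *: w
    + x 0 (inord 3) *: ze + x 0 (inord 4) *: xi = 0.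
    rewrite -xM mulmx_sum_row !big_ord_recl big_ord0 !rowK /= addr0 !addrA.
    by repeat (congr (_ + _)); congr (x 0 _ *: _); apply: val_inj; rewrite /= inordK.
  have x4 : x 0 (inord 4) = 0.
    apply/eqP; apply/negP => /negP n4; apply: nxi.
    have -> : xi = (- (x 0 (inord 4))^-1) *: (x 0 (inord 0) *: u +
      x 0 (inord 1) *: v + x 0 (inord 2) *: w + x 0 (inord 3) *: ze) + 0.
      apply: (scalerI n4); rewrite addr0 scalerA mulrN divff // scaleN1r.
      by apply/eqP; rewrite -addr_eq0 addrC e.
    apply: LP; last exact/closed_L/closed0.
    rewrite addrC; apply: LP => //; apply: closed_L.
    by rewrite addrC; apply: closedP => //; apply: closedP => //; exact: closedZ.
  move: e; rewrite x4 scale0r addr0 => e.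
  have x3 : x 0 (inord 3) = 0.
    apply/eqP; have /(congr1 trb) := e; rewrite /trb !evD !evZ ev0.
    rewrite -/(trb u) -/(trb v) -/(trb w) -/(trb ze) (closed_trb cu) (closed_trb cv) (closed_trb cw) !mulr0 !add0r.
    by move/eqP; rewrite mulf_eq0 (negbTE t0) orbF.
  move: e; rewrite x3 scale0r addr0 => e.
  have x2 : x 0 (inord 2) = 0.
    apply/eqP; apply/negP => /negP n2; apply: nw.
    exists (- (x 0 (inord 0) / x 0 (inord 2))), (- (x 0 (inord 1) / x 0 (inord 2))).
    apply: (scalerI n2); rewrite scalerDr !scalerA !mulrN !(mulrC (x 0 (inord 2))).
    rewrite !divfK // !scaleNr -opprD; apply/eqP.
    by rewrite -addr_eq0 addrC e.
  move: e; rewrite x2 scale0r addr0 => e.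
  have x1 : x 0 (inord 1) = 0.
    apply/eqP; apply/negP => /negP n1; apply: nv.
    exists (- (x 0 (inord 0) / x 0 (inord 1))).
    apply: (scalerI n1); rewrite !scalerA !mulrN !(mulrC (x 0 (inord 1))).
    by rewrite divfK // scaleNr; apply/eqP; rewrite -addr_eq0 addrC e.
  move: e; rewrite x1 scale0r addr0 => /eqP; rewrite scaler_eq0.
  move/orP=> [/eqP x00|/eqP //]; move/negP: x0; apply; apply/eqP/rowP=> i.
  rewrite mxE -(inord_val i); case: i => [[|[|[|[|[|]]]]] //= _].
pose g l := trb (colb xi l) / trb ze.
have dag l i j : da (colb xi l) i j = g l * da ze i j by exact: L_prop_da.
have dbg l i j : db (colb xi l) i j = g l * db ze i j by exact: L_prop_db.
(* Up to terms with closed (1,0)-coefficients, [delbar xi] is [ze ^ conj(ga)]. *)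
pose ga : 'rV[C]_4 := \row_l (g l)^*.
pose be := crowb ze; pose r := crowb xi.
(* From [delbar (delbar xi) = 0]: [del (r i) = be i ^ ga]. *)
have dar i l j : da (r i) l j = be i 0 l * ga 0 j - be i 0 j * ga 0 l.
  apply: (can_inj (@conjCK C)); rewrite (dbar2 H) !dbg conjB !conjM !mxE !conjCK.
  by ring.
(* Weighting the [r i] by the conjugate traces of the [dw^i] gives a multiple of [ga]. The same
   weights send the [be i] to the conjugate traces of the closed forms [colb ze m], that is to 0. *)
have daga : forall i j, da ga i j = 0.
  move=> l j; have -> : ga = ((trb ze)^-1)^* *: \sum_i (\sum_m b i m m)^* *: r i.
    apply/rowP=> m; rewrite !mxE summxE /g conjM mulrC; congr (_ * _).
    rewrite /trb /ev conj_sum; apply: eq_bigr => i _.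
    by rewrite !mxE conjM mulrC.
  have tcol m : \sum_i (\sum_m b i m m)^* * be i 0 m = 0.
    transitivity ((trb (colb ze m))^*); last by rewrite closed_trb // rmorph0.
    rewrite /trb /ev conj_sum; apply: eq_bigr => i _.
    by rewrite !mxE conjM mulrC.
  rewrite /da evZ ev_sum; apply/eqP; rewrite mulf_eq0; apply/orP; right; apply/eqP.
  transitivity ((\sum_i (\sum_m b i m m)^* * be i 0 l) * ga 0 j -
                (\sum_i (\sum_m b i m m)^* * be i 0 j) * ga 0 l).
    rewrite !mulr_suml -sumrB; apply: eq_bigr => i _.
    by rewrite evZ -/(da (r i) l j) dar; ring.
  by rewrite !tcol !mul0r subrr.
have Lga := dbd_da0 daga.
have cbe i : dclosed (be i) by exact: crze.
have rar i l : rowa (r i) l = be i 0 l *: ga + (- ga 0 l) *: be i.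
  by apply/rowP=> j; rewrite [LHS]mxE dar !mxE; ring.
have dbrar i l k m : db (rowa (r i) l) k m = be i 0 l * db ga k m.
  by rewrite rar /db evP evZ; have [_ hb] := cbe i; rewrite [ev _ (be i)]hb mulr0 addr0.
have ga0 : exists j, ga 0 j != 0.
  apply: contrapT => /forallNP n; apply: nxi.
  have g0 l : g l = 0.
    have /negP := n l; rewrite negbK => /eqP h; apply/eqP.
    by rewrite -conjC_eq0; move: h; rewrite mxE => ->.
  have [|_ //] := @colb_closed_crowb xi.
  by move=> l; split=> i j; rewrite ?dag ?dbg g0 mul0r.
(* If [ga] is closed, [del delbar xi] is shown to lie in W^W^conj(W), which puts [xi] in L.
   Otherwise [ga] has a nonzero trace and can replace [ze] as the form of comparison. *)
have [cga|nga] := pselect (dclosed ga).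
  have Lr i : Lform (r i).
    by move=> l j k; rewrite /dbd !dbrar; have [_ h] := cga; rewrite !h !mulr0 subrr.
  pose rh i := trb (r i) / trb ze.
  have darz i l j : da (r i) l j = rh i * da ze l j by exact: L_prop_da.
  have dbrz i l j : db (r i) l j = rh i * db ze l j by exact: L_prop_db.
  pose ta : 'rV[C]_4 := \row_i (rh i)^*.
  (* [ta] is a combination of the [colb xi l], hence in L, and its trace is a multiple of
     [conj(trb ga)], which is 0. *)
  have cta : dclosed ta.
    have -> : ta = ((trb ze)^-1)^* *: \sum_l (\sum_m b l m m)^* *: colb xi l.
      apply/rowP=> i; rewrite !mxE summxE /rh conjM mulrC; congr (_ * _).
      rewrite /trb /ev conj_sum; apply: eq_bigr => l _.
      by rewrite !mxE conjM conjCK mulrC.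
    apply: closedZ; apply: L_trb0_closed.
      apply: L_sum => l; rewrite -[_ *: _]addr0; apply: LP => //.
      exact/closed_L/closed0.
    rewrite /trb ev_sum; transitivity (trb ze * (trb ga)^*); last first.
      by rewrite (closed_trb cga) rmorph0 mulr0.
    have -> : (trb ga)^* = \sum_l (ga 0 l)^* * (\sum_m b l m m)^*.
      by rewrite /trb /ev conj_sum; apply: eq_bigr => l _; rewrite conjM.
    rewrite mulr_sumr; apply: eq_bigr => l _.
    by rewrite evZ -/(trb (colb xi l)) mxE conjCK /g; field.
  (* If some [rh i] is nonzero, dividing [dar] by it suffices. If all vanish, the [r i] are closed
     and [be i ^ ga = 0]; the coefficient matrix of [delbar ze] then has rank at most one and
     [del ze = 0]. *)
  have [bb cbb daze] : exists2 bb, dclosed bb & forall i k, da ze i k = wed bb ga i k.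
    have [rh0|/existsNP[i /eqP rhi]] := pselect (forall i, rh i = 0).
      exists 0; first exact: closed0.
      have [j0 gj0] := ga0.
      have rk1 i j : db ze i j = (be i 0 j0 / ga 0 j0)^* * (ga 0 j)^*.
        rewrite -[db ze i j]conjCK -conjM; congr (_^*); apply: (mulIf gj0).
        have := dar i j j0; rewrite darz rh0 mul0r => /esym/eqP.
        rewrite subr_eq0 {1}/be [X in X * _]mxE => /eqP ->.
        by field.
      move=> i k; rewrite (L_rank1_da0 Lze rk1) /wed !mxE; ring.
    exists ((rh i)^-1 *: be i); first exact: closedZ.
    move=> l k; apply: (mulfI rhi); rewrite -darz dar /wed.
    have scE j : ((rh i)^-1 *: be i) 0 j = (rh i)^-1 * be i 0 j by rewrite mxE.
    by rewrite !scE; field.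
  apply: nxi; apply: ddb_L.
  have ddbE l i k : ddb xi l i k = g l * wed bb ga i k + wed ta (be l) i k.
    have taE j : (rh j)^* = ta 0 j by rewrite mxE.
    have beE j : (db ze l j)^* = be l 0 j by rewrite mxE.
    rewrite /ddb dag daze !dbrz (conjM (rh i)) (conjM (rh k)) !taE !beE /wed.
    by ring.
  apply: (contr_wed_eq0 cu cv uv).
  - move=> l; have [c1 e1] := wed_closed uv cbb cga.
    have [c2 e2] := wed_closed uv cta (cbe l).
    by exists (g l * c1 + c2) => i k; rewrite ddbE e1 e2; ring.
  - move=> i k.
    have -> : \row_l (ddb xi l i k)^* = (wed bb ga i k)^* *: ga +
       ((ta 0 i)^* *: colb ze k + (- (ta 0 k)^*) *: colb ze i).
      apply/rowP=> l; rewrite mxE ddbE conjD (conjM (g l)).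
      have gaE : (g l)^* = ga 0 l by rewrite mxE.
      have beE j : (be l 0 j)^* = colb ze j 0 l by rewrite !mxE conjCK.
      have -> : (wed ta (be l) i k)^* =
          (ta 0 i)^* * colb ze k 0 l - (ta 0 k)^* * colb ze i 0 l.
        by rewrite /wed conjB (conjM (ta 0 i)) (conjM (ta 0 k)) !beE.
      rewrite gaE; set wc := (wed bb ga i k)^*.
      have lc (x : C) (p q : 'rV[C]_4) : (x *: p + q) 0 l = x * p 0 l + q 0 l.
        by rewrite !mxE.
      have sc (x : C) (p : 'rV[C]_4) : (x *: p) 0 l = x * p 0 l by rewrite mxE.
      by rewrite !lc sc; ring.
    by apply: closedP => //; apply: closedP => //; exact: closedZ.
  - move=> w cw; rewrite -[RHS]oppr0 -[in RHS](contr_closed xi cw) -sumrN.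
    by apply: eq_bigr => m _; rewrite contr_ddb; ring.
have tga : trb ga != 0 by apply/eqP => h; apply: nga; exact: L_trb0_closed.
have Lr i : Lform (r i).
  (* Since the [be i] are closed, applying [delbar] to [be i ^ ga] only sees [delbar ga], a multiple
     of [delbar ze]; the result is again in W^W^conj(W). *)
  have dbdE l m k : dbd (r i) l m k =
      - (trb ga / trb ze) * wed (be i) (colb ze l) m k.
    rewrite /dbd !dbrar !(L_prop_db _ _ Lze Lga t0) /wed.
    by rewrite [colb _ _ _ k]mxE [colb _ _ _ m]mxE; ring.
  apply: (contr_wed_eq0 cu cv uv).
  - move=> l; have [c e] := wed_closed uv (cbe i) (hze l).
    by exists (- (trb ga / trb ze) * c) => m k; rewrite dbdE e mulrA.
  - move=> m k.
    have -> : \row_l (dbd (r i) l m k)^* =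
      (- (trb ga / trb ze) * be i 0 m)^* *: be k +
      (trb ga / trb ze * be i 0 k)^* *: be m.
      apply/rowP=> l; rewrite mxE dbdE (conjM (- _)) /wed conjB.
      have beE j : (colb ze l 0 j)^* = be j 0 l by rewrite !mxE.
      have lc (x y : C) (p q : 'rV[C]_4) :
        (x *: p + y *: q) 0 l = x * p 0 l + y * q 0 l by rewrite !mxE.
      rewrite (conjM (be i 0 m)) (conjM (be i 0 k)) !beE lc.
      rewrite (conjM _ (be i 0 m)) (conjM _ (be i 0 k)) rmorphN /=.
      by ring.
    by apply: closedP => //; exact: closedZ.
  - by move=> w cw; rewrite -[RHS](contr_closed (r i) cw).
(* [del (r i)] is a multiple of [del ga = 0], so [be i ^ ga = 0]; a nonzero [be i], being closed,
   would make [ga] closed. With all [be i] zero, [ze] loses its trace. *)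
have be0 i l : be i 0 l = 0.
  apply/eqP; apply/negP => /negP n0; apply: nga.
  have -> : ga = (ga 0 l / be i 0 l) *: be i; last exact: closedZ.
  apply/rowP=> j; rewrite [RHS]mxE; apply: (mulfI n0).
  have := dar i l j; rewrite (L_prop_da _ _ Lga (Lr i) tga) daga mulr0.
  by move/esym/eqP; rewrite subr_eq0 => /eqP ->; field.
move/eqP: t0; apply; rewrite trbE big1 // => i _; apply/eqP.
by rewrite -conjC_eq0; have := be0 i i; rewrite /be mxE => ->.
Qed.

End Tables.

(** * Unitary coframes whose first three forms are closed *)

Section Adapted.
Variable C : numClosedFieldType.
Variables a b : 'I_4 -> 'I_4 -> 'I_4 -> C.
Hypothesis H : tableP a b.
Hypothesis cl : forall k : 'I_4, k != ord_max -> dclosed a b (delta_mx 0 k).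

Let w : 'rV[C]_4 := delta_mx 0 ord_max.

Lemma da_adapted z i j : da a z i j = z 0 ord_max * a ord_max i j.
Proof.
rewrite /da /ev (bigD1 ord_max) //= big1 ?addr0 // => k nk.
by have [h _] := cl nk; have := h i j; rewrite /da ev_delta => ->; rewrite mulr0.
Qed.

Lemma db_adapted z i j : db b z i j = z 0 ord_max * b ord_max i j.
Proof.
rewrite /db /ev (bigD1 ord_max) //= big1 ?addr0 // => k nk.
by have [_ h] := cl nk; have := h i j; rewrite /db ev_delta => ->; rewrite mulr0.
Qed.

(** If the last form is not closed, closed forms have no last coordinate, while an Engel form for
    the closed ones has a nonzero one. Its [colb] and [crowb] are closed, so the last row and column
    of [b ord_max] vanish. A nonzero [a ord_max i ord_max] would, through [delbar del = 0], force
    [b ord_max] to have rank one, and then [L_rank1_da0] kills it. *)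
Lemma adapted_zero :
  [/\ forall i, b ord_max i ord_max = 0, forall j, b ord_max ord_max j = 0
    & forall i, a ord_max i ord_max = 0].
Proof.
have wE : (forall i j, da a w i j = a ord_max i j) /\ (forall i j, db b w i j = b ord_max i j).
  by split=> i j; rewrite ?da_adapted ?db_adapted mxE !eqxx mul1r.
have [[aw bw]|nw] := pselect (dclosed a b w).
  by split=> i; rewrite -?wE.1 -?wE.2.
have last0 y : dclosed a b y -> y 0 ord_max = 0.
  move=> [ay by_]; apply/eqP; apply/negP => /negP n0; apply: nw; split=> i j.
    by rewrite wE.1; apply: (mulfI n0); rewrite -da_adapted ay mulr0.
  by rewrite wE.2; apply: (mulfI n0); rewrite -db_adapted by_ mulr0.
have [ze nze hze] := engel H (closed0 a b) (ex_intro _ w nw).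
have [crze _] := colb_closed_crowb H hze.
have z0 : ze 0 ord_max != 0.
  apply/eqP => z0; apply: nze; split=> i j; rewrite ?da_adapted ?db_adapted z0.
    by rewrite mul0r.
  by rewrite mul0r.
have b1 i : b ord_max i ord_max = 0.
  have := last0 _ (crze i); rewrite mxE => /eqP; rewrite conjC_eq0 db_adapted.
  by rewrite mulf_eq0 (negbTE z0) => /eqP.
have b2 j : b ord_max ord_max j = 0.
  have := last0 _ (hze j); rewrite mxE => /eqP; rewrite db_adapted.
  by rewrite mulf_eq0 (negbTE z0) => /eqP.
split=> // i; apply/eqP; apply/negP => /negP a0.
have Lw := all_Lform H w.
have e k l : a ord_max i ord_max * b ord_max k l = a ord_max k ord_max * b ord_max i l.
  have /eqP := Lw l k i; rewrite /dbd !db_adapted !mxE !wE.1 subr_eq0.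
  by move/eqP.
have rk1 k l : db b w k l = a ord_max k ord_max * (b ord_max i l / a ord_max i ord_max).
  by rewrite wE.2; apply: (mulfI a0); rewrite e; field.
by move/eqP: a0; apply; rewrite -wE.1 (L_rank1_da0 H Lw rk1).
Qed.

Lemma adapted_T :
  2^-1 * \sum_i \sum_j a ord_max i j * (a ord_max i j)^*
  + \sum_i \sum_j b ord_max i j * (b ord_max i j)^*
  = (\sum_i b ord_max i i) * (\sum_i b ord_max i i)^*.
Proof.
have := L_norm H (all_Lform H w); rewrite trbE.
under eq_bigr => i _ do under eq_bigr => j _ do rewrite da_adapted mxE !eqxx mul1r.
under [X in _ + X]eq_bigr => i _ do under eq_bigr => j _ do
  rewrite db_adapted mxE !eqxx mul1r.
have -> // : \sum_i db b w i i = \sum_i b ord_max i i.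
by apply: eq_bigr => i _; rewrite db_adapted mxE !eqxx mul1r.
Qed.

End Adapted.

(** * Multilinear forms and their differentials *)

Section Forms.
Variables (C : fieldType) (m : nat).
Local Notation V := 'rV[C]_m.

Definition mform k := ('I_k -> V) -> C.

Definition upd k (X : 'I_k -> V) (i : 'I_k) (v : V) : 'I_k -> V :=
  fun l => if l == i then v else X l.

Definition mlin k (f : mform k) := forall X j a u v,
  f (upd X j (a *: u + v)) = a * f (upd X j u) + f (upd X j v).

Definition alt k (f : mform k) := forall (X : 'I_k -> V) (j l : 'I_k),
  j != l -> X j = X l -> f X = 0.

Lemma upd_id k (X : 'I_k -> V) i : upd X i (X i) = X.
Proof. by apply/funext => l; rewrite /upd; case: eqP => [->|]. Qed.

Lemma upd_upd k (X : 'I_k -> V) i u v : upd (upd X i u) i v = upd X i v.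
Proof. by apply/funext => l; rewrite /upd; case: eqP. Qed.

Lemma updC k (X : 'I_k -> V) i j u v : i != j ->
  upd (upd X i u) j v = upd (upd X j v) i u.
Proof.
by move=> ij; apply/funext => l; rewrite /upd; case: eqP => // ->; rewrite eq_sym (negbTE ij).
Qed.

Lemma upd_eq k (X : 'I_k -> V) i v : upd X i v i = v.
Proof. by rewrite /upd eqxx. Qed.

Lemma upd_neq k (X : 'I_k -> V) i l v : l != i -> upd X i v l = X l.
Proof. by rewrite /upd => /negbTE ->. Qed.

Section MultilinearForm.
Variables (k : nat) (f : mform k).
Hypothesis fl : mlin f.

Lemma mlin_upd0 X j : f (upd X j 0) = 0.
Proof.
have := fl X j 1 0 0; rewrite scale1r addr0 mul1r.
by rewrite -{1}[f _]addr0 => /addrI/esym.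
Qed.

Lemma mlin0 X j : X j = 0 -> f X = 0.
Proof. by move=> h; rewrite -(upd_id X j) h mlin_upd0. Qed.

Lemma mlinD X j u v : f (upd X j (u + v)) = f (upd X j u) + f (upd X j v).
Proof. by have := fl X j 1 u v; rewrite scale1r mul1r. Qed.

Lemma mlinZ X j a u : f (upd X j (a *: u)) = a * f (upd X j u).
Proof. by have := fl X j a u 0; rewrite addr0 mlin_upd0 addr0. Qed.

Lemma mlin_sum X j (I : finType) (F : I -> V) :
  f (upd X j (\sum_i F i)) = \sum_i f (upd X j (F i)).
Proof. exact: (big_morph (fun v => f (upd X j v)) (mlinD X j) (mlin_upd0 X j)). Qed.

(** Polarisation in two slots. The relation [P] restricts the pairs of slots, so that the same
    argument serves adjacent slots and arbitrary ones. *)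
Lemma adjacent_swap (P : 'I_k -> 'I_k -> Prop) :
  (forall X j l, P j l -> j != l -> X j = X l -> f X = 0) ->
  forall X j l, P j l -> j != l -> f (upd (upd X j (X l)) l (X j)) = - f X.
Proof.
move=> h X j l Pjl jl.
have lj : l != j by rewrite eq_sym.
have z u : f (upd (upd X j u) l u) = 0.
  by apply: (h _ j l Pjl jl); rewrite upd_eq upd_neq // upd_eq.
have := z (X j + X l); rewrite updC // mlinD ![upd (upd X l _) j _]updC //.
rewrite !mlinD !z add0r addr0 => /eqP; rewrite addr_eq0 => /eqP e.
rewrite -[in RHS](upd_id X j) -[in RHS](upd_id (upd X j (X j)) l) upd_neq //.
by rewrite e opprK.
Qed.

End MultilinearForm.

Lemma alt_swap k (f : mform k) X j l : mlin f -> alt f -> j != l ->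
  f (upd (upd X j (X l)) l (X j)) = - f X.
Proof.
by move=> fl fa jl; apply: (adjacent_swap fl (P := fun _ _ => True)) => //;
  move=> Y j' l' _; apply: fa.
Qed.

(** Induction on the distance between two equal arguments: the right one is swapped with its left
    neighbour at the cost of a sign. *)
Lemma adjacent_alt k (f : mform k) : mlin f ->
  (forall X (j l : 'I_k), l = j.+1 :> nat -> X j = X l -> f X = 0) -> alt f.
Proof.
move=> fl h.
have main n : forall X (j l : 'I_k), l = (j + n.+1)%N :> nat -> X j = X l -> f X = 0.
  elim: n => [|n IH] X j l jl Xjl; first by apply: (h X j l) => //; lia.
  have lt : (l.-1 < k)%N by have := ltn_ord l; lia.
  pose l' := Ordinal lt.
  have ll' : l' != l by apply/eqP => /(congr1 val) /=; lia.
  have hs := @adjacent_swap k f fl (fun a b => b = a.+1 :> nat)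
    (fun X j l p _ => h X j l p) X l' l.
  have {}hs : f (upd (upd X l' (X l)) l (X l')) = - f X by apply: hs => //=; lia.
  apply/eqP; rewrite -oppr_eq0 -hs; apply/eqP; apply: (IH _ j l'); first by rewrite /=; lia.
  rewrite [RHS]upd_neq // upd_eq !upd_neq //; apply/eqP => /(congr1 val) /=; lia.
move=> X j l jl Xjl.
have /orP[lt|lt] : (j < l)%N || (l < j)%N.
- by rewrite -neq_ltn; apply: contraNneq jl => /val_inj ->.
- by apply: (main (l - j.+1)%N X j l) => //; lia.
- by apply: (main (j - l.+1)%N X l j) => //; lia.
Qed.

Definition bilin (B : V -> V -> V) :=
  (forall a u v w, B (a *: u + v) w = a *: B u w + B v w) /\
  (forall a u v w, B w (a *: u + v) = a *: B w u + B w v).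

(** The bracket is a parameter because the same differential is used for the Lie bracket and for its
    truncations [br1] and [br2]. *)
Definition extd (B : V -> V -> V) k (f : mform k) : mform k.+1 :=
  fun X => \sum_(j < k.+1) \sum_(i < k.+1 | (i < j)%N) (-1) ^+ j *
    f (fun l => upd X i (B (X i) (X j)) (lift j l)).

Lemma upd_lift_same k (X : 'I_k.+1 -> V) j i' v :
  (fun l => upd X (lift j i') v (lift j l)) = upd (fun l => X (lift j l)) i' v.
Proof. by apply/funext => l; rewrite /upd (inj_eq lift_inj). Qed.

Lemma upd_lift_drop k (X : 'I_k.+1 -> V) j v :
  (fun l => upd X j v (lift j l)) = (fun l => X (lift j l)).
Proof. by apply/funext => l; rewrite /upd eq_sym (negbTE (neq_lift _ _)). Qed.

Lemma lt_lift k (i j : 'I_k.+1) : (i < j)%N -> exists i', i = lift j i'.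
Proof.
move=> ij; case: (unliftP j i) => [i' ->|e]; first by exists i'.
by move: ij; rewrite e ltnn.
Qed.

Lemma mlin_sumf k (I : finType) (P : pred I) (F : I -> mform k) :
  (forall i, P i -> mlin (F i)) -> mlin (fun X => \sum_(i | P i) F i X).
Proof.
move=> h X j a u v; rewrite mulr_sumr -big_split; apply: eq_bigr => i Pi /=.
exact: h.
Qed.

Lemma mlin_scale k c (f : mform k) : mlin f -> mlin (fun X => c * f X).
Proof. by move=> h X j a u v; rewrite h mulrDr mulrCA. Qed.

Lemma mlin_extd B k (f : mform k) : bilin B -> mlin f -> mlin (extd B f).
Proof.
move=> [Bl Br] fl; apply: mlin_sumf => j _; apply: mlin_sumf => i ij.
apply: mlin_scale => X s a u v.
have [i' ei] := lt_lift ij.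
have ji : j != i by apply: contraTneq ij => ->; rewrite ltnn.
have red w : (fun l => upd (upd X s w) i (B (upd X s w i) (upd X s w j)) (lift j l)) =
   upd (fun l => upd X s w (lift j l)) i' (B (upd X s w i) (upd X s w j)).
  by rewrite {1}ei upd_lift_same.
rewrite !red.
have [->|sj] := eqVneq s j.
  by rewrite !upd_lift_drop !upd_eq !(upd_neq _ _ (_ : i != j)) 1?eq_sym // Br fl.
have [->|si] := eqVneq s i.
  have red2 w w' : upd (fun l => upd X i w (lift j l)) i' w' = upd (fun l => X (lift j l)) i' w'.
    by rewrite {1}ei upd_lift_same upd_upd.
  by rewrite !red2 !upd_eq !(upd_neq _ _ ji) Bl fl.
have [s' es] : exists s', s = lift j s'.
  by case: (unliftP j s) sj => [s' ->|->]; [exists s'|rewrite eqxx].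
have s'i' : s' != i' by apply: contraNneq si; rewrite es ei => ->.
rewrite es in sj si *.
by rewrite !upd_lift_same !(updC _ _ _ s'i') !(upd_neq _ _ (_ : i != lift j s')) 1?eq_sym //
  !(upd_neq _ _ (_ : j != lift j s')) 1?eq_sym // fl.
Qed.

(** Let the equal arguments be adjacent, at [a] and [a']. Terms avoiding both places keep two equal
    arguments; brackets of [X a] and of [X a'] with a later vector cancel by a swap; brackets of an
    earlier vector with either of them cancel by the sign [(-1)^j]. *)
Lemma alt_extd B k (f : mform k) : bilin B -> (forall u, B u u = 0) ->
  mlin f -> alt f -> alt (extd B f).
Proof.
move=> Bb Ba fl fa; apply: adjacent_alt; first exact: mlin_extd.
move=> X a a' ea Xa.
pose t (i j : 'I_k.+1) := (-1) ^+ j * f (fun l => upd X i (B (X i) (X j)) (lift j l)).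
have aa' : a != a' by apply/eqP => /(congr1 val); rewrite /= ea; lia.
have t_disj (i j : 'I_k.+1) : (i < j)%N -> i != a -> i != a' -> j != a -> j != a' -> t i j = 0.
  move=> ij ia ia' ja ja'; rewrite /t.
  have [s es] : exists s, a = lift j s.
    by case: (unliftP j a) ja => [s ->|->]; [exists s|rewrite eqxx].
  have [s' es'] : exists s, a' = lift j s.
    by case: (unliftP j a') ja' => [s' ->|->]; [exists s'|rewrite eqxx].
  rewrite (fa _ s s') ?mulr0 //.
    by apply: contraNneq aa'; rewrite es es' => ->.
  by rewrite -es -es' !upd_neq // eq_sym.
have t_aa' : t a a' = 0.
  rewrite /t Xa Ba; have [s es] : exists s, a = lift a' s by apply: lt_lift; rewrite ea.
  by rewrite es upd_lift_same mlin_upd0 // mulr0.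
have t_left (j : 'I_k.+1) : (a < j)%N -> (a' < j)%N -> t a j + t a' j = 0.
  move=> aj a'j; rewrite /t -mulrDr.
  have [s es] := lt_lift aj; have [s' es'] := lt_lift a'j.
  have ss' : s != s' by apply: contraNneq aa'; rewrite es es' => ->.
  set Y := fun l => upd X a (B (X a) (X j)) (lift j l).
  have -> : (fun l => upd X a' (B (X a') (X j)) (lift j l)) = upd (upd Y s (Y s')) s' (Y s).
    rewrite /Y -Xa es es' !upd_lift_same -es -es'.
    rewrite upd_eq upd_neq 1?eq_sym // upd_upd.
    congr (upd _ _ _); rewrite -Xa es; exact/esym/(upd_id (fun l => X (lift j l)) s).
  by rewrite alt_swap // addrN mulr0.
have t_right (i : 'I_k.+1) : (i < a)%N -> t i a + t i a' = 0.
  move=> ia; rewrite /t ea exprS -Xa.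
  have -> : (fun l => upd X i (B (X i) (X a)) (lift a' l)) =
            (fun l => upd X i (B (X i) (X a)) (lift a l)).
    apply/funext => l.
    have [e|ne] := eqVneq (l : nat) (a : nat).
      have -> : lift a' l = a by apply: val_inj; rewrite /= /bump ea e; lia.
      have -> : lift a l = a' by apply: val_inj; rewrite /= /bump ea e; lia.
      rewrite !upd_neq ?Xa //; apply/eqP => /(congr1 val) /=; lia.
    congr (upd _ _ _ _); apply: val_inj; rewrite /= /bump ea.
    by rewrite ltn_neqAle eq_sym ne.
  by ring.
pose F (j : 'I_k.+1) := \sum_(i < k.+1 | (i < j)%N) t i j.
have a'a : a' != a by rewrite eq_sym.
have Faa' : F a + F a' = 0.
  have -> : F a' = \sum_(i < k.+1 | (i < a)%N) t i a'.
    rewrite /F (bigD1 a) /= ?ea // t_aa' add0r; apply: eq_bigl => i.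
    by rewrite ltnS ltn_neqAle -val_eqE andbC.
  by rewrite -big_split big1 //= => i ia; exact: t_right.
have F0 j : j != a -> j != a' -> F j = 0.
  move=> ja ja'; have [aj|aj] := ltnP a j; last first.
    rewrite /F big1 // => i ij; apply: (t_disj i j) => //.
      by apply: contraTneq ij => ->; rewrite -leqNgt.
    by apply: contraTneq ij => ->; rewrite -leqNgt ea leqW.
  have a'j : (a' < j)%N by rewrite ltn_neqAle ea aj andbT -ea val_eqE eq_sym.
  rewrite /F (bigD1 a) //= (bigD1 a') ?a'j //= addrA t_left // add0r big1 // => i.
  by move=> /andP[/andP[ij ia] ia']; exact: t_disj.
change (\sum_j F j = 0); rewrite (bigD1 a) //= (bigD1 a') //= addrA Faa' add0r.
by rewrite big1 // => j /andP[ja ja']; exact: F0.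
Qed.

Definition vecs k (s : seq V) : 'I_k -> V := fun i => nth 0 s i.

(** The argument list of one term of [extd]: the bracket sits at place [i] and place [j] is deleted.
    On explicit lists it evaluates by computation. *)
Definition seq_br (B : V -> V -> V) (s : seq V) i j :=
  let s' := set_nth 0 s i (B s`_i s`_j) in take j s' ++ drop j.+1 s'.

Lemma extd_vecs B k (f : mform k) s : size s = k.+1 ->
  extd B f (vecs s) =
  \sum_(j < k.+1) \sum_(i < k.+1)
    if (i < j)%N then (-1) ^+ j * f (vecs (seq_br B s i j)) else 0.
Proof.
move=> ss; under [RHS]eq_bigr => j _ do rewrite -big_mkcond.
apply: eq_bigr => j _; apply: eq_bigr => i ij; congr (_ * f _).
apply/funext => l; rewrite /vecs /seq_br /upd nth_cat size_take size_set_nth ss.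
rewrite (maxn_idPr (ltn_ord i)) ltn_ord -val_eqE /= /bump.
case: ltnP => lj.
  by rewrite nth_take // nth_set_nth.
rewrite nth_drop; have -> : (j.+1 + (l - j) = l.+1)%N by lia.
by rewrite nth_set_nth.
Qed.

End Forms.

(** * Bidegree *)

Section Types.
Variables (C : fieldType) (m : nat) (I : C) (J : 'M[C]_m).
Hypotheses (i2 : I * I = -1) (JJ : J *m J = - 1%:M) (two0 : 2 != 0 :> C).
Local Notation V := 'rV[C]_m.

Definition p10 (z : V) : V := 2^-1 *: (z - I *: (z *m J)).
Definition p01 (z : V) : V := 2^-1 *: (z + I *: (z *m J)).

Let inv2 (z : V) : 2^-1 *: (z + z) = z.
Proof. by rewrite -mulr2n -scaler_nat scalerA mulVf ?scale1r. Qed.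

Lemma proj_sum (z : V) : p10 z + p01 z = z.
Proof. by rewrite /p10 /p01 -scalerDr addrACA addNr addr0 inv2. Qed.

Lemma proj10P a (u v : V) : p10 (a *: u + v) = a *: p10 u + p10 v.
Proof. by apply/rowP=> j; rewrite /p10 mulmxDl -scalemxAl !mxE; ring. Qed.

Lemma proj01P a (u v : V) : p01 (a *: u + v) = a *: p01 u + p01 v.
Proof. by apply/rowP=> j; rewrite /p01 mulmxDl -scalemxAl !mxE; ring. Qed.

Lemma projJ10 z : p10 z *m J = I *: p10 z.
Proof.
rewrite /p10 -scalemxAl mulmxBl -scalemxAl -mulmxA JJ mulmxN mulmx1.
rewrite scalerA mulrC -scalerA; congr (_ *: _).
by rewrite scalerBr scalerA i2 scaleN1r scalerN !opprK addrC.
Qed.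

Lemma projJ01 z : p01 z *m J = - I *: p01 z.
Proof.
rewrite /p01 -scalemxAl mulmxDl -scalemxAl -mulmxA JJ mulmxN mulmx1.
rewrite scalerA mulrC -scalerA; congr (_ *: _).
by rewrite scalerDr scalerA mulNr i2 opprK scale1r scalerN scaleNr addrC.
Qed.

Lemma projJ_id10 z : z *m J = I *: z -> p10 z = z.
Proof.
by move=> e; rewrite /p10 e scalerA i2 scaleN1r opprK inv2.
Qed.

Lemma projJ_id01 z : z *m J = - I *: z -> p01 z = z.
Proof.
by move=> e; rewrite /p01 e scalerA mulrN i2 opprK scale1r inv2.
Qed.

Lemma proj1010 z : p10 (p10 z) = p10 z. Proof. exact/projJ_id10/projJ10. Qed.
Lemma proj0101 z : p01 (p01 z) = p01 z. Proof. exact/projJ_id01/projJ01. Qed.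

Lemma proj0110 z : p01 (p10 z) = 0.
Proof.
by have := proj_sum (p10 z); rewrite proj1010 -{3}[p10 z]addr0 => /addrI.
Qed.

Lemma proj1001 z : p10 (p01 z) = 0.
Proof.
by have := proj_sum (p01 z); rewrite proj0101 -{3}[p01 z]add0r => /addIr.
Qed.

Definition projt (t : bool) := if t then p10 else p01.

Lemma projtP t a u v : projt t (a *: u + v) = a *: projt t u + projt t v.
Proof. by case: t; [exact: proj10P|exact: proj01P]. Qed.

Lemma projt_id t z : projt t (projt t z) = projt t z.
Proof. by case: t; [exact: proj1010|exact: proj0101]. Qed.

Lemma projt_neq t s z : t != s -> projt t (projt s z) = 0.
Proof. by case: t; case: s => // _; [exact: proj1001|exact: proj0110]. Qed.

Lemma projt0 t : projt t 0 = 0.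
Proof.
by case: t; rewrite /projt /p10 /p01 mul0mx scaler0 ?subr0 ?addr0 scaler0.
Qed.

Lemma projtD t u v : projt t (u + v) = projt t u + projt t v.
Proof. by have := projtP t 1 u v; rewrite !scale1r. Qed.

Lemma proj10D u v : p10 (u + v) = p10 u + p10 v. Proof. exact: (projtD true). Qed.
Lemma proj01D u v : p01 (u + v) = p01 u + p01 v. Proof. exact: (projtD false). Qed.

Definition pure k (tp : 'I_k -> bool) (X : 'I_k -> V) :=
  forall j, projt (tp j) (X j) = X j.

Definition bidegree k (p : nat) (f : mform C m k) : mform C m k := fun X =>
  \sum_(S : {set 'I_k} | #|S| == p)
    f (fun j => if j \in S then p10 (X j) else p01 (X j)).

Lemma mlin_bidegree k (p : nat) (f : mform C m k) : mlin f -> mlin (bidegree p f).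
Proof.
move=> fl; apply: mlin_sumf => S _ X j a u v.
have red w : (fun l => if l \in S then p10 (upd X j w l) else p01 (upd X j w l)) =
    upd (fun l => projt (l \in S) (X l)) j (projt (j \in S) w).
  apply/funext => l; rewrite /upd /projt; case: eqP => [->|_]; by case: (_ \in _).
by rewrite !red projtP fl.
Qed.

Lemma bidegree_pure k (p : nat) (f : mform C m k) tp X : mlin f -> pure tp X ->
  bidegree p f X = if (\sum_j tp j == p)%N then f X else 0.
Proof.
move=> fl pX; pose S0 := [set j | tp j].
have cS0 : #|S0| = (\sum_j tp j)%N.
  by rewrite -sum1_card big_mkcond; apply: eq_bigr => j _; rewrite inE; case: (tp j).
have red S : (fun l => if l \in S then p10 (X l) else p01 (X l)) =
   (fun l => projt (l \in S) (X l)) by apply/funext => l; case: (l \in S).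
have other S : S != S0 -> f (fun j => if j \in S then p10 (X j) else p01 (X j)) = 0.
  move=> nS; rewrite red.
  have [j nj] : exists j, (j \in S) != tp j.
    apply/existsP; apply: contraR nS; rewrite negb_exists => /forallP h.
    by apply/eqP/setP => j; have := h j; rewrite negbK inE => /eqP.
  by apply: (mlin0 fl (j := j)); rewrite -(pX j) projt_neq.
rewrite /bidegree -cS0; case: eqP => [e|ne].
  rewrite (bigD1 S0) ?e //= big1 ?addr0 => [|S /andP[_ nS]]; last exact: other.
  by rewrite red; congr f; apply/funext => j; rewrite inE pX.
rewrite big1 // => S /eqP cS; apply: other; apply: contra_notN ne => /eqP <-.
by rewrite cS.
Qed.

(** In a term of the differential only the bracket fails to have a pure type; its two components
    contribute to two consecutive bidegrees. *)
Lemma bidegree_almost k (p : nat) (f : mform C m k) tp X i z : mlin f ->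
  (forall j, j != i -> projt (tp j) (X j) = X j) ->
  bidegree p f (upd X i z) =
  (if ((\sum_(j | j != i) tp j).+1 == p)%N then f (upd X i (p10 z)) else 0) +
  (if (\sum_(j | j != i) tp j == p)%N then f (upd X i (p01 z)) else 0).
Proof.
move=> fl pX; rewrite -{1}(proj_sum z) mlinD; last exact: mlin_bidegree.
have pt t : bidegree p f (upd X i (projt t z)) =
   if (t + \sum_(j | j != i) tp j == p)%N then f (upd X i (projt t z)) else 0.
  rewrite (@bidegree_pure _ _ _ (fun j => if j == i then t else tp j)) //.
    rewrite (bigD1 i) //= eqxx; congr (if (_ + _ == _)%N then _ else _).
    by apply: eq_bigr => j /negbTE ->.
  by move=> j; rewrite /upd; case: eqP => [_|/eqP]; [exact: projt_id|exact: pX].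
by rewrite -/(projt true z) -/(projt false z) !pt add1n add0n.
Qed.

Variable B : V -> V -> V.
Hypothesis Bb : bilin B.
Hypothesis Ba : forall u, B u u = 0.

(* The brackets whose Chevalley-Eilenberg differentials are [del] and
   [delbar]. *)
Definition br1 u v := p10 (B (p10 u) (p10 v)) + p01 (B (p10 u) (p01 v) + B (p01 u) (p10 v)).
Definition br2 u v := p01 (B (p01 u) (p01 v)) + p10 (B (p10 u) (p01 v) + B (p01 u) (p10 v)).

Let B0l v : B 0 v = 0.
Proof. by have := Bb.1 (-1) 0 0 v; rewrite scaler0 addr0 scaleN1r addNr. Qed.
Let B0r v : B v 0 = 0.
Proof. by have := Bb.2 (-1) 0 0 v; rewrite scaler0 addr0 scaleN1r addNr. Qed.

Let lin3 t s a (x y z x' y' z' : V) :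
  projt t (a *: x + x') + projt s ((a *: y + y') + (a *: z + z')) =
  a *: (projt t x + projt s (y + z)) + (projt t x' + projt s (y' + z')).
Proof.
have -> : (a *: y + y') + (a *: z + z') = a *: (y + z) + (y' + z').
  by rewrite scalerDr addrACA.
by rewrite !projtP scalerDr addrACA.
Qed.

Lemma bilin_br1 : bilin br1.
Proof.
by split=> a u v w; rewrite /br1 !(proj10P, proj01P) !(Bb.1, Bb.2);
  exact: (lin3 true false).
Qed.

Lemma bilin_br2 : bilin br2.
Proof.
by split=> a u v w; rewrite /br2 !(proj10P, proj01P) !(Bb.1, Bb.2);
  exact: (lin3 false true).
Qed.

Let Bskew u v : B u v + B v u = 0.
Proof.
have := Ba (u + v); have D1 x y z : B (x + y) z = B x z + B y z.
  by have := Bb.1 1 x y z; rewrite !scale1r.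
have D2 x y z : B z (x + y) = B z x + B z y.
  by have := Bb.2 1 x y z; rewrite !scale1r.
by rewrite D1 !D2 !Ba add0r addr0.
Qed.

Lemma br1_alt u : br1 u u = 0.
Proof. by rewrite /br1 Ba Bskew -/(projt true 0) -/(projt false 0) !projt0 addr0. Qed.

Lemma br2_alt u : br2 u u = 0.
Proof. by rewrite /br2 Ba Bskew -/(projt true 0) -/(projt false 0) !projt0 addr0. Qed.

Lemma br1_pure t s u v : projt t u = u -> projt s v = v ->
  br1 u v = if t && s then p10 (B u v) else if t || s then p01 (B u v) else 0.
Proof.
move=> <- <-; rewrite /br1; case: t; case: s => /=;
  rewrite ?(proj1010, proj0101, proj1001, proj0110, B0l, B0r, addr0, add0r);
  by rewrite -/(projt true 0) -/(projt false 0) ?projt0 ?addr0 ?add0r.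
Qed.

Lemma br2_pure t s u v : projt t u = u -> projt s v = v ->
  br2 u v = if t && s then 0 else if t || s then p10 (B u v) else p01 (B u v).
Proof.
move=> <- <-; rewrite /br2; case: t; case: s => /=;
  rewrite ?(proj1010, proj0101, proj1001, proj0110, B0l, B0r, addr0, add0r);
  by rewrite -/(projt true 0) -/(projt false 0) ?projt0 ?addr0 ?add0r.
Qed.

Let count_lift k (tp : 'I_k.+1 -> bool) j i' :
  (\sum_x tp x = tp j + tp (lift j i') + \sum_(l | l != i') tp (lift j l))%N.
Proof. by rewrite (bigD1_ord j) //= (bigD1 i') //= addnA. Qed.

Lemma bidegree_bracket k (p : nat) (f : mform C m k) tp X (i j : 'I_k.+1) :
  mlin f -> pure tp X -> (i < j)%N ->
  exists i', exists2 n, (\sum_x tp x = tp j + tp i + n)%N &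
  i = lift j i' /\
  bidegree p f (fun l => upd X i (B (X i) (X j)) (lift j l)) =
  (if (n.+1 == p)%N then f (upd (fun l => X (lift j l)) i' (p10 (B (X i) (X j)))) else 0) +
  (if (n == p)%N then f (upd (fun l => X (lift j l)) i' (p01 (B (X i) (X j)))) else 0).
Proof.
move=> fl pX ij; have [i' ei] := lt_lift ij.
exists i', (\sum_(l | l != i') tp (lift j l))%N; first by rewrite ei -count_lift.
split=> //; rewrite {1}ei upd_lift_same.
by rewrite (@bidegree_almost _ _ _ (fun l => tp (lift j l))) // => l _; exact: pX.
Qed.

Definition fdel k (f : mform C m k) : mform C m k.+1 := fun X =>
  \sum_(p < k.+1) bidegree p.+1 (extd B (bidegree p f)) X.

Definition fdelbar k (f : mform C m k) : mform C m k.+1 := fun X =>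
  \sum_(p < k.+1) bidegree p (extd B (bidegree p f)) X.

Lemma mlin_ext_d k (f : mform C m k) : mlin f -> mlin (extd B f).
Proof. exact: mlin_extd. Qed.

Lemma del_pureE k (f : mform C m k) tp X : mlin f -> pure tp X ->
  fdel f X = if (\sum_x tp x)%N is c.+1 then extd B (bidegree c f) X else 0.
Proof.
move=> fl pX; rewrite /fdel.
have eb (p q : nat) := bidegree_pure p (mlin_ext_d (mlin_bidegree q fl)) pX.
rewrite (eq_bigr _ (fun (p : 'I_k.+1) _ => eb p.+1 p)).
have : (\sum_x tp x <= k.+1)%N.
  by rewrite -[k.+1 in leqRHS]card_ord -sum1_card leq_sum // => x _; case: (tp x).
case: (\sum_x tp x)%N => [|c] ck; first by rewrite big1.
rewrite (bigD1 (Ordinal ck)) //= eqxx big1 ?addr0 // => p np.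
by case: eqP => // -[e]; case/eqP: np; apply: val_inj.
Qed.

Lemma delbar_pureE k (f : mform C m k) tp X : mlin f -> pure tp X ->
  fdelbar f X = if (\sum_x tp x <= k)%N then extd B (bidegree (\sum_x tp x) f) X else 0.
Proof.
move=> fl pX; rewrite /fdelbar.
have eb (p q : nat) := bidegree_pure p (mlin_ext_d (mlin_bidegree q fl)) pX.
rewrite (eq_bigr _ (fun (p : 'I_k.+1) _ => eb p p)).
move: (\sum_x tp x)%N => c; case: leqP => ck; last by rewrite big1 // => p _; case: eqP => // e; have := ltn_ord p; lia.
rewrite (bigD1 (Ordinal (ck : (_ < k.+1)%N))) //= eqxx big1 ?addr0 // => p np.
by case: eqP => // e; case/eqP: np; apply: val_inj; rewrite /= e.
Qed.

(** The number of (1,0)-arguments must drop by exactly one inside [f]. Two (1,0)-vectors thus keep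
    the (1,0)-part of their bracket, a mixed pair the (0,1)-part, and two (0,1)-vectors nothing:
    this is [br1]. *)
Lemma del_pure k (f : mform C m k) tp X : mlin f -> pure tp X ->
  fdel f X = extd br1 f X.
Proof.
move=> fl pX; rewrite (del_pureE fl pX).
have key i j i' : i = lift j i' ->
   f (fun l => upd X i (br1 (X i) (X j)) (lift j l)) =
   f (upd (fun l => X (lift j l)) i' (br1 (X i) (X j))).
  by move=> ei; rewrite {1}ei upd_lift_same.
case c : (\sum_x tp x)%N => [|c'].
  apply/esym; rewrite /extd big1 // => j _; rewrite big1 // => i ij.
  have [i' [n en [ei _]]] := bidegree_bracket 0 fl pX ij.
  have [ti tj] : tp i = false /\ tp j = false by move: en; rewrite c; case: (tp i); case: (tp j).
  rewrite (key _ _ _ ei) (br1_pure (pX i) (pX j)) ti tj /=.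
  by rewrite (mlin_upd0 fl) mulr0.
apply: eq_bigr => j _; apply: eq_bigr => i ij; congr (_ * _).
have [i' [n en [ei ->]]] := bidegree_bracket c' fl pX ij.
rewrite (key _ _ _ ei) (br1_pure (pX i) (pX j)).
move: en; rewrite c; case: (tp i); case: (tp j) => /= en.
- have -> : c' = n.+1 by lia.
  by rewrite eqxx ifN ?addr0 //; apply/eqP; lia.
- have -> : c' = n by lia.
  by rewrite eqxx ifN ?add0r //; apply/eqP; lia.
- have -> : c' = n by lia.
  by rewrite eqxx ifN ?add0r //; apply/eqP; lia.
- rewrite (mlin_upd0 fl) !ifN ?addr0 //; apply/eqP; lia.
Qed.

Lemma delbar_pure k (f : mform C m k) tp X : mlin f -> pure tp X ->
  fdelbar f X = extd br2 f X.
Proof.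
move=> fl pX; rewrite (delbar_pureE fl pX).
have key i j i' : i = lift j i' ->
   f (fun l => upd X i (br2 (X i) (X j)) (lift j l)) =
   f (upd (fun l => X (lift j l)) i' (br2 (X i) (X j))).
  by move=> ei; rewrite {1}ei upd_lift_same.
case: leqP => ck; last first.
  have tpT j : tp j.
    apply: contraLR ck => /negbTE tj; rewrite -leqNgt (bigD1_ord j) //= tj add0n.
    by rewrite -[k in leqRHS]card_ord -sum1_card leq_sum // => x _; case: (tp _).
  apply/esym; rewrite /extd big1 // => j _; rewrite big1 // => i ij.
  have [i' ei] := lt_lift ij.
  rewrite (key _ _ _ ei) (br2_pure (pX i) (pX j)) !tpT /=.
  by rewrite (mlin_upd0 fl) mulr0.
apply: eq_bigr => j _; apply: eq_bigr => i ij; congr (_ * _).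
have [i' [n en [ei ->]]] := bidegree_bracket (\sum_x tp x)%N fl pX ij.
rewrite (key _ _ _ ei) (br2_pure (pX i) (pX j)).
move: en; set c := (\sum_x _)%N; case: (tp i); case: (tp j) => /= en.
- rewrite (mlin_upd0 fl) !ifN ?addr0 //; apply/eqP; lia.
- have -> : c = n.+1 by lia.
  by rewrite eqxx ifN ?addr0 //; apply/eqP; lia.
- have -> : c = n.+1 by lia.
  by rewrite eqxx ifN ?addr0 //; apply/eqP; lia.
- have -> : c = n by lia.
  by rewrite eqxx ifN ?add0r //; apply/eqP; lia.
Qed.

Lemma mlin_delbar k (f : mform C m k) : mlin f -> mlin (fdelbar f).
Proof.
by move=> fl; apply: mlin_sumf => p _; apply/mlin_bidegree/mlin_ext_d/mlin_bidegree.
Qed.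

(** This is what lets the two differentials be composed: after [br1] the arguments still have pure
    types, so [delbar_pure] applies to the inner one. *)
Lemma pure_bracket1 k (tp : 'I_k.+1 -> bool) X (i j : 'I_k.+1) : pure tp X ->
  exists tp', pure tp' (fun l => upd X i (br1 (X i) (X j)) (lift j l)).
Proof.
move=> pX; exists (fun l => if lift j l == i then tp i && tp j else tp (lift j l)) => l.
rewrite /upd; case: eqP => [_|_]; last exact: pX.
rewrite (br1_pure (pX i) (pX j)); case: (tp i); case: (tp j) => /=.
- exact: proj1010.
- exact: proj0101.
- exact: proj0101.
- exact: (projt0 false).
Qed.

Lemma deldelbar_pure k (f : mform C m k) tp X : mlin f -> pure tp X ->
  fdel (fdelbar f) X = extd br1 (extd br2 f) X.
Proof.
move=> fl pX; rewrite (del_pure (mlin_delbar fl) pX).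
apply: eq_bigr => j _; apply: eq_bigr => i ij; congr (_ * _).
by have [tp' pY] := pure_bracket1 i j pX; rewrite (delbar_pure fl pY).
Qed.

Lemma del_eq0 k (f : mform C m k) : mlin f ->
  (forall tp X, pure tp X -> fdel f X = 0) -> forall X, fdel f X = 0.
Proof.
move=> fl h X; rewrite /fdel big1 // => p _; rewrite /bidegree big1 // => S /eqP cS.
set Y := (fun j => if _ then _ else _).
have pY : pure (fun j => j \in S) Y.
  move=> j; rewrite /Y; case: (j \in S); [exact: proj1010|exact: proj0101].
have := del_pureE fl pY; rewrite (h _ _ pY).
have -> : (\sum_x (x \in S) = p.+1)%N; last by move=> <-.
rewrite -cS -[RHS]sum1_card [RHS]big_mkcond; apply: eq_bigr => x _.
by case: (x \in S).
Qed.

End Types.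

(** * The square of a 2-form *)

Section Square.
Variables (C : fieldType) (m : nat).
Local Notation V := 'rV[C]_m.
Variable F : V -> V -> C.

Definition form2 : mform C m 2 := fun X => F (X 0) (X 1).

(* [F ^ F] for a skew-symmetric [F] *)
Definition sqform : mform C m 4 := fun X =>
  let F' i j := F (X (inord i)) (X (inord j)) in
  2 * (F' 0%N 1%N * F' 2%N 3%N - F' 0%N 2%N * F' 1%N 3%N + F' 0%N 3%N * F' 1%N 2%N).

Variables B1 B2 : V -> V -> V.

Lemma form2E u v : form2 (vecs [:: u; v]) = F u v.
Proof. by []. Qed.

Lemma sqformE u v w x : sqform (vecs [:: u; v; w; x]) =
  2 * (F u v * F w x - F u w * F v x + F u x * F v w).
Proof. by rewrite /sqform /vecs !inordK. Qed.

Lemma bump0 n : bump 0 n = n.+1. Proof. by []. Qed.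

Lemma extd3 B (f : mform C m 2) v0 v1 v2 :
  extd B f (vecs [:: v0; v1; v2]) =
  - f (vecs [:: B v0 v1; v2]) + f (vecs [:: B v0 v2; v1]) + f (vecs [:: v0; B v1 v2]).
Proof. by rewrite extd_vecs // !(big_ord_recl, big_ord0) /seq_br /= !bump0; ring. Qed.

Lemma extd4 B (f : mform C m 3) v0 v1 v2 v3 :
  extd B f (vecs [:: v0; v1; v2; v3]) =
  - f (vecs [:: B v0 v1; v2; v3]) + f (vecs [:: B v0 v2; v1; v3]) + f (vecs [:: v0; B v1 v2; v3])
  - f (vecs [:: B v0 v3; v1; v2]) - f (vecs [:: v0; B v1 v3; v2]) - f (vecs [:: v0; v1; B v2 v3]).
Proof. by rewrite extd_vecs // !(big_ord_recl, big_ord0) /seq_br /= !bump0; ring. Qed.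

Lemma extd5 B (f : mform C m 4) v0 v1 v2 v3 v4 :
  extd B f (vecs [:: v0; v1; v2; v3; v4]) =
  - f (vecs [:: B v0 v1; v2; v3; v4]) + f (vecs [:: B v0 v2; v1; v3; v4]) + f (vecs [:: v0; B v1 v2; v3; v4])
  - f (vecs [:: B v0 v3; v1; v2; v4]) - f (vecs [:: v0; B v1 v3; v2; v4]) - f (vecs [:: v0; v1; B v2 v3; v4])
  + f (vecs [:: B v0 v4; v1; v2; v3]) + f (vecs [:: v0; B v1 v4; v2; v3]) + f (vecs [:: v0; v1; B v2 v4; v3])
  + f (vecs [:: v0; v1; v2; B v3 v4]).
Proof. by rewrite extd_vecs // !(big_ord_recl, big_ord0) /seq_br /= !bump0; ring. Qed.

Lemma extd6 B (f : mform C m 5) v0 v1 v2 v3 v4 v5 :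
  extd B f (vecs [:: v0; v1; v2; v3; v4; v5]) =
  - f (vecs [:: B v0 v1; v2; v3; v4; v5]) + f (vecs [:: B v0 v2; v1; v3; v4; v5]) + f (vecs [:: v0; B v1 v2; v3; v4; v5])
  - f (vecs [:: B v0 v3; v1; v2; v4; v5]) - f (vecs [:: v0; B v1 v3; v2; v4; v5]) - f (vecs [:: v0; v1; B v2 v3; v4; v5])
  + f (vecs [:: B v0 v4; v1; v2; v3; v5]) + f (vecs [:: v0; B v1 v4; v2; v3; v5]) + f (vecs [:: v0; v1; B v2 v4; v3; v5])
  + f (vecs [:: v0; v1; v2; B v3 v4; v5]) - f (vecs [:: B v0 v5; v1; v2; v3; v4]) - f (vecs [:: v0; B v1 v5; v2; v3; v4])
  - f (vecs [:: v0; v1; B v2 v5; v3; v4]) - f (vecs [:: v0; v1; v2; B v3 v5; v4]) - f (vecs [:: v0; v1; v2; v3; B v4 v5]).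
Proof. by rewrite extd_vecs // !(big_ord_recl, big_ord0) /seq_br /= !bump0; ring. Qed.

(* The Leibniz rule [d1 d2 (F^F) = 2 (d1 d2 F ^ F - d2 F ^ d1 F)], over all shuffles. *)
Lemma leibniz_sq v0 v1 v2 v3 v4 v5 :
  let K a b c d := extd B1 (extd B2 form2) (vecs [:: a; b; c; d]) in
  let f a b c := extd B2 form2 (vecs [:: a; b; c]) in
  let g a b c := extd B1 form2 (vecs [:: a; b; c]) in
  extd B1 (extd B2 sqform) (vecs [:: v0; v1; v2; v3; v4; v5]) =
  2 * (K v0 v1 v2 v3 * F v4 v5 - K v0 v1 v2 v4 * F v3 v5 + K v0 v1 v2 v5 * F v3 v4 + K v0 v1 v3 v4 * F v2 v5
    - K v0 v1 v3 v5 * F v2 v4 + K v0 v1 v4 v5 * F v2 v3 - K v0 v2 v3 v4 * F v1 v5 + K v0 v2 v3 v5 * F v1 v4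
    - K v0 v2 v4 v5 * F v1 v3 + K v0 v3 v4 v5 * F v1 v2 + K v1 v2 v3 v4 * F v0 v5 - K v1 v2 v3 v5 * F v0 v4
    + K v1 v2 v4 v5 * F v0 v3 - K v1 v3 v4 v5 * F v0 v2 + K v2 v3 v4 v5 * F v0 v1
    - f v0 v1 v2 * g v3 v4 v5 + f v0 v1 v3 * g v2 v4 v5 - f v0 v1 v4 * g v2 v3 v5 + f v0 v1 v5 * g v2 v3 v4
    - f v0 v2 v3 * g v1 v4 v5 + f v0 v2 v4 * g v1 v3 v5 - f v0 v2 v5 * g v1 v3 v4 - f v0 v3 v4 * g v1 v2 v5
    + f v0 v3 v5 * g v1 v2 v4 - f v0 v4 v5 * g v1 v2 v3 + f v1 v2 v3 * g v0 v4 v5 - f v1 v2 v4 * g v0 v3 v5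
    + f v1 v2 v5 * g v0 v3 v4 + f v1 v3 v4 * g v0 v2 v5 - f v1 v3 v5 * g v0 v2 v4 + f v1 v4 v5 * g v0 v2 v3
    - f v2 v3 v4 * g v0 v1 v5 + f v2 v3 v5 * g v0 v1 v4 - f v2 v4 v5 * g v0 v1 v3 + f v3 v4 v5 * g v0 v1 v2).
Proof.
move=> K f g.
by rewrite /K /f /g extd6 !extd5 !extd4 !extd3 !sqformE !form2E; ring.
Qed.

End Square.

(** * Integration by parts as a polynomial identity *)

Section Polynomial.
Variable K : comNzRingType.
(* [ac] and [bc] play the role of the conjugates of [a] and [b]. *)
Variables a ac b bc : 'I_4 -> 'I_4 -> 'I_4 -> K.

Definition o0 : 'I_4 := @Ordinal 4 0 isT.
Definition o1 : 'I_4 := @Ordinal 4 1 isT.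
Definition o2 : 'I_4 := @Ordinal 4 2 isT.
Definition o3 : 'I_4 := @Ordinal 4 3 isT.

Lemma sum4 (R : nmodType) (F : 'I_4 -> R) : \sum_i F i = F o0 + F o1 + F o2 + F o3.
Proof.
rewrite !big_ord_recl big_ord0 /= addr0 !addrA.
by congr (F _ + F _ + F _ + F _); apply: val_inj.
Qed.

Lemma ord4P (P : 'I_4 -> Prop) : P o0 -> P o1 -> P o2 -> P o3 -> forall i, P i.
Proof.
move=> p0 p1 p2 p3 [[|[|[|[|//]]]] lti].
- by rewrite (_ : Ordinal lti = o0) //; apply: val_inj.
- by rewrite (_ : Ordinal lti = o1) //; apply: val_inj.
- by rewrite (_ : Ordinal lti = o2) //; apply: val_inj.
- by rewrite (_ : Ordinal lti = o3) //; apply: val_inj.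
Qed.

Definition dl (i j : 'I_4) : K := (i == j)%:R.

(* The components of [delbar F], [del F] and [del delbar F] in a unitary frame. *)
Definition tf i l m := b m i l - b l i m - ac i l m.
Definition tg j k n := a n j k - bc k n j + bc j n k.
Definition tK j k l m := \sum_p (a p j k * tf p l m - bc p l j * tf k p m
  + bc p l k * tf j p m + bc p m j * tf k p l - bc p m k * tf j p l).

(* The components of [del delbar (F^F)], by the Leibniz rule. *)
Definition tE x0 x1 x2 y0 y1 y2 :=
  tK x1 x2 y1 y2 * dl x0 y0 - tK x1 x2 y0 y2 * dl x0 y1
  + tK x1 x2 y0 y1 * dl x0 y2 - tK x0 x2 y1 y2 * dl x1 y0
  + tK x0 x2 y0 y2 * dl x1 y1 - tK x0 x2 y0 y1 * dl x1 y2
  + tK x0 x1 y1 y2 * dl x2 y0 - tK x0 x1 y0 y2 * dl x2 y1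
  + tK x0 x1 y0 y1 * dl x2 y2
  - tf x0 y1 y2 * tg x1 x2 y0 + tf x0 y0 y2 * tg x1 x2 y1
  - tf x0 y0 y1 * tg x1 x2 y2 + tf x1 y1 y2 * tg x0 x2 y0
  - tf x1 y0 y2 * tg x0 x2 y1 + tf x1 y0 y1 * tg x0 x2 y2
  - tf x2 y1 y2 * tg x0 x1 y0 + tf x2 y0 y2 * tg x0 x1 y1
  - tf x2 y0 y1 * tg x0 x1 y2.

Definition t0 : 'I_3 := @Ordinal 3 0 isT.
Definition t1 : 'I_3 := @Ordinal 3 1 isT.
Definition t2 : 'I_3 := @Ordinal 3 2 isT.

(** A (3,3)-form in dimension four is indexed by its two missing indices; up to sign this is the
    coefficient obtained by wedging with [w^d ^ conj(w^e)]. *)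
Definition tEc (d e : 'I_4) :=
  tE (lift d t0) (lift d t1) (lift d t2) (lift e t0) (lift e t1) (lift e t2).

(** Twice [Q] on basis forms. One contraction comes from [delbar del] and the other, in the last
    line, from [del delbar]; written this way the identity below relies on linear relations only,
    and [d^2 = 0] enters later, in [Q_delta]. *)
Definition tQ d e :=
  \sum_i \sum_j a d i j * ac e i j + 2 * \sum_i \sum_j b d i j * bc e i j
  - 2 * ((\sum_i b d i i) * (\sum_i bc e i i))
  + 2 * (\sum_l \sum_j (a d e j * b j l l - a d l j * b j e l))
  - 2 * (\sum_l \sum_j (bc e j l * ac j l d + bc e l j * b j l d - bc e d j * b j l l)).

Hypothesis a_skew : forall k i j, a k i j = - a k j i.
Hypothesis a_diag : forall k i, a k i i = 0.
Hypothesis ac_skew : forall k i j, ac k i j = - ac k j i.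
Hypothesis ac_diag : forall k i, ac k i i = 0.
(* The trace conditions express that the Lie algebra is unimodular. *)
Hypothesis a_tr : forall i, \sum_k a k i k = 0.
Hypothesis ac_tr : forall i, \sum_k ac k i k = 0.
Hypothesis b_tr : forall j, \sum_k b k k j = 0.
Hypothesis bc_tr : forall j, \sum_k bc k k j = 0.

(** Stokes' theorem for invariant forms: on a unimodular algebra exact forms of top degree vanish,
    so both derivatives can be moved from [F^F] to [w^d ^ conj(w^e)]. The proof eliminates the
    dependent structure constants and compares polynomials for the sixteen pairs of indices. *)
Lemma integration_by_parts (d e : 'I_4) : 2 * ((-1) ^+ (d + e) * tEc d e) = - tQ d e.
Proof.
have lower (c : 'I_4 -> 'I_4 -> 'I_4 -> K) : (forall k i j, c k i j = - c k j i) ->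
    (forall k,
  ((c k o1 o0 = - c k o0 o1) * (c k o2 o0 = - c k o0 o2) * (c k o3 o0 = - c k o0 o3) *
  (c k o2 o1 = - c k o1 o2) * (c k o3 o1 = - c k o1 o3) * (c k o3 o2 = - c k o2 o3))%type).
  by move=> h k; rewrite -!h.
(* Each trace condition is solved for one unknown, chosen so that no solved unknown reappears on a
   right-hand side; the rewriting therefore ends in independent variables. *)
have tr_solve (c : 'I_4 -> 'I_4 -> 'I_4 -> K) : (forall k i j, c k i j = - c k j i) ->
    (forall k i, c k i i = 0) -> (forall i, \sum_k c k i k = 0) ->
  (c o1 o0 o1 = - c o2 o0 o2 - c o3 o0 o3) * (c o2 o1 o2 = c o0 o0 o1 - c o3 o1 o3) *
  (c o3 o2 o3 = c o0 o0 o2 + c o1 o1 o2) * (c o0 o0 o3 = - c o1 o1 o3 - c o2 o2 o3).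
  move=> sk dg tr; have low := lower c sk.
  have e0 := tr o0; have e1 := tr o1; have e2 := tr o2; have e3 := tr o3.
  move: e0 e1 e2 e3; rewrite !sum4 !dg !low => e0 e1 e2 e3.
  split; first split; first split; apply/eqP; rewrite -subr_eq0 -oppr_eq0.
  - by rewrite -oppr_eq0 -e0; apply/eqP; ring.
  - by rewrite -oppr_eq0 -e1; apply/eqP; ring.
  - by rewrite -oppr_eq0 -e2; apply/eqP; ring.
  - by rewrite -e3; apply/eqP; ring.
have b_solve (c : 'I_4 -> 'I_4 -> 'I_4 -> K) : (forall j, \sum_k c k k j = 0) ->
    forall j, c o0 o0 j = - c o1 o1 j - c o2 o2 j - c o3 o3 j.
  move=> tr j; have := tr j; rewrite sum4 => h; apply/eqP; rewrite -subr_eq0 -[X in _ == X]h.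
  by apply/eqP; ring.
have lowa := lower a a_skew; have lowac := lower ac ac_skew.
have sola := tr_solve a a_skew a_diag a_tr.
have solac := tr_solve ac ac_skew ac_diag ac_tr.
have solb := b_solve b b_tr; have solbc := b_solve bc bc_tr.
have l00 : lift o0 t0 = o1 by apply: val_inj.
have l01 : lift o0 t1 = o2 by apply: val_inj.
have l02 : lift o0 t2 = o3 by apply: val_inj.
have l10 : lift o1 t0 = o0 by apply: val_inj.
have l11 : lift o1 t1 = o2 by apply: val_inj.
have l12 : lift o1 t2 = o3 by apply: val_inj.
have l20 : lift o2 t0 = o0 by apply: val_inj.
have l21 : lift o2 t1 = o1 by apply: val_inj.
have l22 : lift o2 t2 = o3 by apply: val_inj.
have l30 : lift o3 t0 = o0 by apply: val_inj.
have l31 : lift o3 t1 = o1 by apply: val_inj.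
have l32 : lift o3 t2 = o2 by apply: val_inj.
move: d e; apply: ord4P; apply: ord4P;
  rewrite /tEc ?(l00, l01, l02, l10, l11, l12, l20, l21, l22, l30, l31, l32) /tE /dl /=;
  rewrite exprD ?mulr1 ?mulr0 ?addr0 ?subr0 ?sub0r ?add0r;
  rewrite /tQ /tK !sum4 /tf /tg !(a_diag, ac_diag) !(lowa, lowac, sola, solac, solb, solbc);
  ring.
Qed.

End Polynomial.

(** * Forms in a frame *)

Section Alternating.
Variables (C : fieldType) (m : nat).
Local Notation V := 'rV[C]_m.

(** Induction on a product of transpositions; only vanishing is transported, so no sign has to be
    tracked. *)
Lemma alt_perm_eq0 k (f : mform C m k) X (s : 'S_k) : mlin f -> alt f ->
  f (fun j => X (s j)) = 0 -> f X = 0.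
Proof.
move=> fl fa; have [ts -> _] := prod_tpermP s.
elim: ts X => [|t ts IH] X.
  by rewrite big_nil; under [X in f X]funext do rewrite perm1.
rewrite big_cons => h; apply: IH; set Y := fun j => X _.
have e : (fun j => X ((tperm t.1 t.2 * \prod_(t <- ts) tperm t.1 t.2)%g j)) =
         (fun j => Y (tperm t.1 t.2 j)).
  by apply/funext => j; rewrite permM.
move: h; rewrite e; have [->|nt] := eqVneq t.1 t.2.
  by rewrite tperm1; under [X in f X]funext do rewrite perm1.
have -> : (fun j => Y (tperm t.1 t.2 j)) = upd (upd Y t.1 (Y t.2)) t.2 (Y t.1).
  apply/funext => j; rewrite /upd; case: tpermP => [->|->|/eqP n1 /eqP n2].
  - by rewrite (negbTE nt) eqxx.
  - by rewrite eqxx.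
  - by rewrite (negbTE n1) (negbTE n2).
by rewrite alt_swap // => /eqP; rewrite oppr_eq0 => /eqP.
Qed.

Lemma mlin_basis_eq0 k n (f : mform C m k) (bas : 'I_k -> 'I_n -> V) X : mlin f ->
  (forall c : 'I_k -> 'I_n, f (fun j => bas j (c j)) = 0) ->
  (forall j, exists co : 'I_n -> C, X j = \sum_i co i *: bas j i) -> f X = 0.
Proof.
move=> fl h0.
(* Only the first [q] arguments are still arbitrary; each step expands one of them in its basis. *)
have main q : forall X, (forall j : 'I_k, (q <= j)%N -> exists c, X j = bas j c) ->
    (forall j, exists co : 'I_n -> C, X j = \sum_i co i *: bas j i) -> f X = 0.
  elim: q => [|q IH] Y hY hs.
    have /choice[c hc] : forall j : 'I_k, exists c, Y j = bas j c by move=> j; exact: hY.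
    by have -> : Y = fun j => bas j (c j) by apply/funext.
  have [qk|qk] := ltnP q k; last first.
    by apply: IH => // j; have := ltn_ord j; lia.
  pose jq := Ordinal qk; have [co eco] := hs jq.
  rewrite -(upd_id Y jq) eco mlin_sum // big1 // => i _.
  rewrite mlinZ // IH ?mulr0 // => j.
    rewrite leq_eqVlt => /orP[/eqP e|lt].
      by exists i; rewrite (_ : j = jq) ?upd_eq //; exact/val_inj.
    rewrite upd_neq; last by apply/eqP => /(congr1 val) /=; lia.
    exact: hY.
  rewrite /upd; case: eqP => // ->.
  exists (fun i' => (i' == i)%:R); rewrite (bigD1 i) //= eqxx scale1r big1 ?addr0 //.
  by move=> i' /negbTE ->; rewrite scale0r.
by move=> hX; apply: (main k) => // j; have := ltn_ord j; lia.
Qed.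

Variables e eb : 'I_4 -> V.

Definition vec6 x0 x1 x2 y0 y1 y2 : 'I_6 -> V :=
  vecs [:: e x0; e x1; e x2; eb y0; eb y1; eb y2].

Let bas (t : bool) := if t then e else eb.

(** On basis vectors a repetition within a type gives 0. Otherwise the three indices of each type
    miss exactly one of four, and a permutation sorts the six vectors into the list [psi]. *)
Lemma alt33_eq0 (f : mform C m 6) (tp : 'I_6 -> bool) X : mlin f -> alt f ->
  (forall d d' : 'I_4, f (vec6 (lift d t0) (lift d t1) (lift d t2)
                       (lift d' t0) (lift d' t1) (lift d' t2)) = 0) ->
  (\sum_j tp j = 3)%N ->
  (forall j, exists co : 'I_4 -> C, X j = \sum_i co i *: bas (tp j) i) -> f X = 0.
Proof.
move=> fl fa h0 c3; apply: mlin_basis_eq0 => // c.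
have [[j [l [jl tjl cjl]]]|inj] := pselect (exists j l, [/\ j != l, tp j = tp l & c j = c l]).
  by apply: (fa _ j l jl); rewrite tjl cjl.
pose phi j := (tp j, c j).
have phi_inj : injective phi.
  move=> j l [etp ec]; apply/eqP; apply: contrapT => /negP jl; apply: inj.
  by exists j, l.
have miss t : exists d, forall i, i != d -> exists j, phi j = (t, i).
  pose T := [set j | tp j == t]; pose A := [set c j | j in T].
  have cT : #|T| = 3%N.
    have cT1 : #|[set j | tp j]| = 3%N.
      apply: etrans c3; rewrite -sum1_card big_mkcond; apply: eq_bigr => j _.
      by rewrite inE; case: (tp j).
    case: t @T @A => [|]; rewrite /=.
      by apply: etrans cT1; apply: eq_card => j; rewrite !inE eqb_id.
    have := cardsC [set j | tp j]; rewrite cT1 card_ord => e3.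
    transitivity #|~: [set j | tp j]|; last by lia.
    by apply: eq_card => j; rewrite !inE; case: (tp j).
  have cA : #|A| = 3%N.
    rewrite card_in_imset // => j l; rewrite !inE => /eqP tj /eqP tl ec.
    by apply: phi_inj; rewrite /phi tj tl ec.
  have : #|~: A| = 1%N.
    by apply/eqP; rewrite -(eqn_add2l #|A|) cardsC cA card_ord.
  move/eqP/cards1P => [d ed]; exists d => i id.
  have : i \in A.
    apply/negPn/negP => iA; move/negP: id; apply.
    by have : i \in ~: A; [rewrite finset.in_setC|rewrite ed finset.in_set1].
  by move/imsetP=> [j]; rewrite inE => /eqP tj ->; exists j; rewrite /phi tj.
have [d hd] := miss true; have [d' hd'] := miss false.
pose psi (q : 'I_6) : bool * 'I_4 := nth (true, o0)
  [:: (true, lift d t0); (true, lift d t1); (true, lift d t2);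
      (false, lift d' t0); (false, lift d' t1); (false, lift d' t2)] q.
have /choice[s hs] : forall q, exists j, phi j = psi q.
  by case=> [[|[|[|[|[|[|//]]]]]] ltq]; rewrite /psi /=;
    [apply: hd|apply: hd|apply: hd|apply: hd'|apply: hd'|apply: hd'];
    rewrite eq_sym neq_lift.
have psi_inj : injective psi.
  have li (x : 'I_4) (p q : 'I_3) : (lift x p == lift x q) = (p == q).
    exact: (inj_eq lift_inj).
  have u : uniq [:: (true, lift d t0); (true, lift d t1); (true, lift d t2);
      (false, lift d' t0); (false, lift d' t1); (false, lift d' t2)].
    by rewrite /= !inE !xpair_eqE /= !li.
  move=> q q' /eqP; rewrite /psi nth_uniq ?ltn_ord // => /eqP qq'.
  exact: val_inj.
have s_inj : injective s by move=> q q' e1; apply: psi_inj; rewrite -!hs e1.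
apply: (alt_perm_eq0 (s := perm s_inj)) => //.
rewrite -[RHS](h0 d d'); congr f; apply/funext => q; rewrite permE.
have -> : tp (s q) = (psi q).1 by rewrite -hs.
have -> : c (s q) = (psi q).2 by rewrite -hs.
rewrite /psi /vec6 /vecs.
by case: q => [[|[|[|[|[|[|//]]]]]] ltq].
Qed.

End Alternating.

Section FrameTables.
Variables (C : numClosedFieldType) (m : nat).
Local Notation V := 'rV[C]_m.
Variable F : V -> V -> C.
Hypothesis Fl : forall a u v w, F (a *: u + v) w = a * F u w + F v w.
Hypothesis Fskew : forall u v, F u v = - F v u.
Variables B1 B2 : V -> V -> V.
Hypotheses (b2l : bilin B2) (alt2 : forall u, B2 u u = 0).
Variables (e eb : 'I_4 -> V) (a b : 'I_4 -> 'I_4 -> 'I_4 -> C) (ka : C).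
Hypotheses (Fee : forall i j, F (e i) (e j) = 0) (Fbb : forall i j, F (eb i) (eb j) = 0).
Hypothesis Feb : forall i j, F (e i) (eb j) = ka * (i == j)%:R.
Hypothesis B1ee : forall i j, B1 (e i) (e j) = \sum_k - a k i j *: e k.
Hypothesis B1eb : forall i j, B1 (e i) (eb j) = \sum_k (b k j i)^* *: eb k.
Hypothesis B1bb : forall i j, B1 (eb i) (eb j) = 0.
Hypothesis B2ee : forall i j, B2 (e i) (e j) = 0.
Hypothesis B2eb : forall i j, B2 (e i) (eb j) = \sum_k - b k i j *: e k.
Hypothesis B2bb : forall i j, B2 (eb i) (eb j) = \sum_k - (a k i j)^* *: eb k.

Let Fr x u v w : F w (x *: u + v) = x * F w u + F w v.
Proof. by rewrite Fskew Fl [F w u]Fskew [F w v]Fskew; ring. Qed.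

Let lin_sumC (g : V -> C) (c : 'I_4 -> C) (x : 'I_4 -> V) :
  (forall x u v, g (x *: u + v) = x * g u + g v) ->
  g (\sum_k c k *: x k) = \sum_k c k * g (x k).
Proof.
move=> gl; have g0 : g 0 = 0.
  by have := gl (-1) 0 0; rewrite scaler0 addr0 mulN1r addNr.
rewrite (big_morph g (id1 := 0) (op1 := +%R)) // => [|u v].
  by apply: eq_bigr => k _; have := gl (c k) (x k) 0; rewrite addr0 g0 addr0.
by have := gl 1 u v; rewrite !scale1r mul1r.
Qed.

Let B2be i j : B2 (eb j) (e i) = \sum_k b k i j *: e k.
Proof.
have D1 x y z : B2 (x + y) z = B2 x z + B2 y z.
  by have := b2l.1 1 x y z; rewrite !scale1r.
have D2 x y z : B2 z (x + y) = B2 z x + B2 z y.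
  by have := b2l.2 1 x y z; rewrite !scale1r.
have := alt2 (eb j + e i); rewrite D1 !D2 !alt2 add0r addr0 => /eqP.
rewrite addr_eq0 => /eqP ->; rewrite B2eb -sumrN; apply: eq_bigr => k _.
by rewrite scaleNr opprK.
Qed.

(** [f3] and [g3] are [delbar F] and [del F], of bidegrees (1,2) and (2,1); the vanishing lemmas
    below are the excluded types. *)
Let f3 u v w := - F (B2 u v) w + F (B2 u w) v + F u (B2 v w).
Let g3 u v w := - F (B1 u v) w + F (B1 u w) v + F u (B1 v w).


Let f3l v w x u u' : f3 (x *: u + u') v w = x * f3 u v w + f3 u' v w.
Proof. by rewrite /f3 !b2l.1 !Fl; ring. Qed.
Let f3m v w x u u' : f3 v (x *: u + u') w = x * f3 v u w + f3 v u' w.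
Proof. by rewrite /f3 b2l.1 b2l.2 !Fl !Fr; ring. Qed.

Let sumF1 (c : 'I_4 -> C) (x : 'I_4 -> V) w :
  F (\sum_k c k *: x k) w = \sum_k c k * F (x k) w.
Proof. exact: (@lin_sumC (fun u => F u w)). Qed.
Let sumF2 (c : 'I_4 -> C) (x : 'I_4 -> V) w :
  F w (\sum_k c k *: x k) = \sum_k c k * F w (x k).
Proof. exact: (@lin_sumC (fun u => F w u)). Qed.
Let sumd (c : 'I_4 -> C) j : \sum_k c k * (k == j)%:R = c j.
Proof. by rewrite (bigD1 j) //= eqxx mulr1 big1 ?addr0 // => k /negbTE ->; rewrite mulr0. Qed.
Let sumd' (c : 'I_4 -> C) j : \sum_k c k * (j == k)%:R = c j.
Proof. by rewrite -[RHS]sumd; apply: eq_bigr => k _; rewrite eq_sym. Qed.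

Let Fe1 (c : 'I_4 -> C) j : F (\sum_k c k *: e k) (eb j) = ka * c j.
Proof.
rewrite sumF1 -[c j]sumd mulr_sumr; apply: eq_bigr => k _; rewrite Feb; ring.
Qed.
Let Fe2 (c : 'I_4 -> C) j : F (e j) (\sum_k c k *: eb k) = ka * c j.
Proof.
rewrite sumF2 -[c j]sumd' mulr_sumr; apply: eq_bigr => k _; rewrite Feb; ring.
Qed.
Let Fe3 (c : 'I_4 -> C) j : F (\sum_k c k *: eb k) (e j) = - (ka * c j).
Proof. by rewrite Fskew Fe2. Qed.
Let Fe4 (c : 'I_4 -> C) j : F (eb j) (\sum_k c k *: e k) = - (ka * c j).
Proof. by rewrite Fskew Fe1. Qed.
Let Fe5 (c : 'I_4 -> C) j : F (\sum_k c k *: e k) (e j) = 0.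
Proof. by rewrite sumF1 big1 // => k _; rewrite Fee mulr0. Qed.
Let Fe6 (c : 'I_4 -> C) j : F (e j) (\sum_k c k *: e k) = 0.
Proof. by rewrite Fskew Fe5 oppr0. Qed.
Let Fe7 (c : 'I_4 -> C) j : F (\sum_k c k *: eb k) (eb j) = 0.
Proof. by rewrite sumF1 big1 // => k _; rewrite Fbb mulr0. Qed.
Let Fe8 (c : 'I_4 -> C) j : F (eb j) (\sum_k c k *: eb k) = 0.
Proof. by rewrite Fskew Fe7 oppr0. Qed.
Let F0l u : F 0 u = 0.
Proof. by have := Fl (-1) 0 0 u; rewrite scaler0 addr0 mulN1r addNr. Qed.
Let F0r u : F u 0 = 0. Proof. by rewrite Fskew F0l oppr0. Qed.

Local Notation ac := (fun k i j => (a k i j)^*).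
Local Notation bc := (fun k i j => (b k i j)^*).
Local Notation tf := (tf ac b).
Local Notation tg := (tg a bc).
Local Notation tK := (tK a ac b bc).
Local Notation tE := (tE a ac b bc).
Local Notation tEc := (tEc a ac b bc).

Let fE i l n : f3 (e i) (eb l) (eb n) = ka * tf i l n.
Proof. by rewrite /f3 !B2eb B2bb !Fe1 Fe2 /tf; ring. Qed.
Let fE' i l n : f3 (eb l) (e i) (eb n) = - (ka * tf i l n).
Proof. by rewrite /f3 B2be B2bb B2eb Fe1 Fe3 Fe4 /tf; ring. Qed.
Let f0 i j k : f3 (e i) (e j) (e k) = 0.
Proof. by rewrite /f3 !B2ee !F0l F0r; ring. Qed.
Let f1 i j k : f3 (e i) (e j) (eb k) = 0.
Proof. by rewrite /f3 B2ee !B2eb F0l Fe5 Fe6; ring. Qed.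
Let f2 i j k : f3 (eb i) (eb j) (eb k) = 0.
Proof. by rewrite /f3 !B2bb !Fe7 Fe8; ring. Qed.
Let gE j k n : g3 (e j) (e k) (eb n) = ka * tg j k n.
Proof. by rewrite /g3 B1ee !B1eb Fe1 Fe3 Fe2 /tg; ring. Qed.
Let g0 i j k : g3 (eb i) (eb j) (eb k) = 0.
Proof. by rewrite /g3 !B1bb !F0l F0r; ring. Qed.
Let g1 i j k : g3 (e i) (eb j) (eb k) = 0.
Proof. by rewrite /g3 !B1eb B1bb F0r !Fe7; ring. Qed.

Let KE j k l n :
  - f3 (B1 (e j) (e k)) (eb l) (eb n) + f3 (B1 (e j) (eb l)) (e k) (eb n)
  + f3 (e j) (B1 (e k) (eb l)) (eb n) - f3 (B1 (e j) (eb n)) (e k) (eb l)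
  - f3 (e j) (B1 (e k) (eb n)) (eb l) - f3 (e j) (e k) (B1 (eb l) (eb n))
  = ka * tK j k l n.
Proof.
rewrite B1ee !B1eb B1bb.
have -> : f3 (e j) (e k) 0 = 0.
  have B20 u : B2 u 0 = 0.
    by have := b2l.2 (-1) 0 0 u; rewrite scaler0 addr0 scaleN1r addNr.
  by rewrite /f3 B2ee !B20 !F0l !F0r; ring.
have sum1 (c : 'I_4 -> C) (x : 'I_4 -> V) v w :
    f3 (\sum_k c k *: x k) v w = \sum_k c k * f3 (x k) v w.
  exact: (@lin_sumC (fun u => f3 u v w)).
have sum2 (c : 'I_4 -> C) (x : 'I_4 -> V) v w :
    f3 v (\sum_k c k *: x k) w = \sum_k c k * f3 v (x k) w.
  exact: (@lin_sumC (fun u => f3 v u w)).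
rewrite !sum1 !sum2.
rewrite subr0 /tK mulr_sumr -!sumrN -!big_split /=; apply: eq_bigr => p _.
by rewrite !fE !fE'; ring.
Qed.

Lemma table_E x0 x1 x2 y0 y1 y2 :
  extd B1 (extd B2 (sqform F)) (vec6 e eb x0 x1 x2 y0 y1 y2) =
  2 * ka ^+ 2 * tE x0 x1 x2 y0 y1 y2.
Proof.
rewrite /vec6 leibniz_sq !Fee !Fbb !Feb !mulr0.
have fX u v w : extd B2 (form2 F) (vecs [:: u; v; w]) = f3 u v w by rewrite extd3 !form2E.
have gX u v w : extd B1 (form2 F) (vecs [:: u; v; w]) = g3 u v w by rewrite extd3 !form2E.
have KX j k l n : extd B1 (extd B2 (form2 F)) (vecs [:: e j; e k; eb l; eb n]) = ka * tK j k l n.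
  by rewrite extd4 !fX -KE.
rewrite !KX !fX !gX !(f0, f1, f2, g0, g1) !mul0r ?mulr0 !fE !gE /tE /dl.
by ring.
Qed.

End FrameTables.

Section Frame.
Variables (C : numClosedFieldType) (m : nat) (I : C) (J : 'M[C]_m).
Hypotheses (i2 : I * I = -1) (JJ : J *m J = - 1%:M).
Local Notation V := 'rV[C]_m.
Local Notation p10 := (p10 I J).
Local Notation p01 := (p01 I J).
Variable B : V -> V -> V.
Hypotheses (Bb : bilin B) (Ba : forall u, B u u = 0).
Variable F : V -> V -> C.
Hypothesis Fl : forall a u v w, F (a *: u + v) w = a * F u w + F v w.
Hypothesis Fskew : forall u v, F u v = - F v u.

Let two0 : 2 != 0 :> C. Proof. by rewrite pnatr_eq0. Qed.

Let Fr a u v w : F w (a *: u + v) = a * F w u + F w v.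
Proof. by rewrite Fskew Fl [F w u]Fskew [F w v]Fskew; ring. Qed.

Let Fuu u : F u u = 0.
Proof.
have /eqP := Fskew u u; rewrite -addr_eq0 -mulr2n -mulr_natl mulf_eq0.
by rewrite (negbTE two0) => /eqP.
Qed.

Lemma sqform_mlin : mlin (sqform F).
Proof.
move=> X j a u v; rewrite /sqform.
have ne p q : (p < 4)%N -> (q < 4)%N -> (inord p == inord q :> 'I_4) = (p == q).
  by move=> hp hq; rewrite -val_eqE /= !inordK.
have : j = inord 0 \/ j = inord 1 \/ j = inord 2 \/ j = inord 3.
  case: j => [[|[|[|[|//]]]] ltj].
  - by left; apply: val_inj; rewrite /= inordK.
  - by right; left; apply: val_inj; rewrite /= inordK.
  - by do 2 right; left; apply: val_inj; rewrite /= inordK.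
  - by do 3 right; apply: val_inj; rewrite /= inordK.
by case=> [->|[->|[->|->]]]; rewrite /upd !ne //= ?Fl ?Fr; ring.
Qed.

Lemma sqform_alt : alt (sqform F).
Proof.
apply: adjacent_alt; first exact: sqform_mlin.
move=> X j l jl Xjl; rewrite /sqform.
have ji : j = inord j by rewrite inord_val.
have li : l = inord l by rewrite inord_val.
have := Xjl; rewrite ji li jl; have := ltn_ord l; rewrite jl.
case: (j : nat) => [|[|[|//]]] _ e.
- by rewrite e Fuu; ring.
- by rewrite e Fuu; ring.
- by rewrite e Fuu; ring.
Qed.

Hypothesis F10 : forall u v, F (p10 u) (p10 v) = 0.
Hypothesis F01 : forall u v, F (p01 u) (p01 v) = 0.

Local Notation pure := (pure I J).
Local Notation br1 := (br1 I J B).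
Local Notation br2 := (br2 I J B).
Local Notation fdel := (fdel I J B).
Local Notation fdelbar := (fdelbar I J B).

(** Each monomial of [sqform] splits the four arguments into two pairs, and [F] pairs only opposite
    types. *)
Lemma sqform_type tp X : pure tp X -> (\sum_j tp j != 2)%N -> sqform F X = 0.
Proof.
move=> pX c2; pose x i := X (inord i); pose t i := tp (inord i).
have Fz i j : t i = t j -> F (x i) (x j) = 0.
  move=> e; have := pX (inord i); have := pX (inord j); rewrite -/(t i) -/(t j) -e /x.
  by case: (t i) => <- <-; [exact: F10|exact: F01].
have cs : (\sum_j tp j = t 0 + t 1 + t 2 + t 3)%N.
  rewrite !big_ord_recl big_ord0 /= addn0 !addnA /t.
  by congr (nat_of_bool (tp _) + nat_of_bool (tp _) + nat_of_bool (tp _) + nat_of_bool (tp _))%N;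
    apply: val_inj; rewrite /= inordK.
rewrite /sqform -/(x 0) -/(x 1%N) -/(x 2) -/(x 3).
move: c2 (Fz 0 1%N) (Fz 0 2) (Fz 0 3) (Fz 1%N 2) (Fz 1%N 3) (Fz 2 3); rewrite cs.
by case: (t 0); case: (t 1%N); case: (t 2); case: (t 3) => //= _ h1 h2 h3 h4 h5 h6;
  (try rewrite (h1 erefl)); (try rewrite (h2 erefl)); (try rewrite (h3 erefl));
  (try rewrite (h4 erefl)); (try rewrite (h5 erefl)); (try rewrite (h6 erefl)); ring.
Qed.

Lemma bidegree_type k (f : mform C m k) n p X :
  (forall tp Y, pure tp Y -> (\sum_j tp j != n)%N -> f Y = 0) -> p != n ->
  bidegree I J p f X = 0.
Proof.
move=> h pn; rewrite /bidegree big1 // => S /eqP cS.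
apply: (h (fun j => j \in S)).
  by move=> j; case: (j \in S); [exact: proj1010|exact: proj0101].
rewrite (_ : (\sum_j (j \in S))%N = p) // -cS -[RHS]sum1_card [RHS]big_mkcond.
by apply: eq_bigr => x _; case: (x \in S).
Qed.

Lemma extd_eq0 k (f : mform C m k) X : (forall Y, f Y = 0) -> extd B f X = 0.
Proof. by move=> h; rewrite /extd big1 // => j _; rewrite big1 // => i _; rewrite h mulr0. Qed.

Lemma fdelbar_type k (f : mform C m k) n : mlin f ->
  (forall tp Y, pure tp Y -> (\sum_j tp j != n)%N -> f Y = 0) ->
  forall tp Y, pure tp Y -> (\sum_j tp j != n)%N -> fdelbar f Y = 0.
Proof.
move=> fl h tp Y pY cn; rewrite (delbar_pureE _ _ _ _ fl pY) //.
by case: ifP => // _; apply: extd_eq0 => Z; exact: (bidegree_type _ h).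
Qed.

Lemma fdel_type k (f : mform C m k) n : mlin f ->
  (forall tp Y, pure tp Y -> (\sum_j tp j != n)%N -> f Y = 0) ->
  forall tp Y, pure tp Y -> (\sum_j tp j != n.+1)%N -> fdel f Y = 0.
Proof.
move=> fl h tp Y pY; rewrite (del_pureE _ _ _ _ fl pY) //.
case: (\sum_j tp j)%N => // c; rewrite eqSS => cn.
by apply: extd_eq0 => Z; exact: (bidegree_type _ h).
Qed.

Variables (e eb : 'I_4 -> V) (a b : 'I_4 -> 'I_4 -> 'I_4 -> C) (ka : C).
Hypothesis ka0 : ka != 0.
Hypotheses (e10 : forall i, p10 (e i) = e i) (eb01 : forall i, p01 (eb i) = eb i).
Hypothesis e_span : forall z, exists co : 'I_4 -> C, p10 z = \sum_k co k *: e k.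
Hypothesis eb_span : forall z, exists co : 'I_4 -> C, p01 z = \sum_k co k *: eb k.
Hypothesis Feb : forall i j, F (e i) (eb j) = ka * (i == j)%:R.
Hypothesis Bee : forall i j, B (e i) (e j) = \sum_k - a k i j *: e k.
Hypothesis Bbb : forall i j, B (eb i) (eb j) = \sum_k - (a k i j)^* *: eb k.
Hypothesis Beb : forall i j, B (e i) (eb j) =
  \sum_k - b k i j *: e k + \sum_k (b k j i)^* *: eb k.

Let p10P := @proj10P C m I J.
Let p01P := @proj01P C m I J.

Let lin_sum (g : V -> V) (c : 'I_4 -> C) (x : 'I_4 -> V) :
  (forall a u v, g (a *: u + v) = a *: g u + g v) ->
  g (\sum_k c k *: x k) = \sum_k c k *: g (x k).
Proof.
move=> gl; have g0 : g 0 = 0.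
  by have := gl (-1) 0 0; rewrite scaler0 addr0 scaleN1r addNr.
rewrite (big_morph g (id1 := 0) (op1 := +%R)) // => [|u v].
  by apply: eq_bigr => k _; have := gl (c k) (x k) 0; rewrite addr0 g0 addr0.
by have := gl 1 u v; rewrite !scale1r.
Qed.

Let e01 i : p01 (e i) = 0. Proof. by rewrite -(e10 i) proj0110. Qed.
Let eb10 i : p10 (eb i) = 0. Proof. by rewrite -(eb01 i) proj1001. Qed.

Let z0 (c : 'I_4 -> C) : \sum_k c k *: (0 : V) = 0.
Proof. by rewrite big1 // => k _; rewrite scaler0. Qed.

Let p10eb i j : p10 (B (e i) (eb j)) = \sum_k - b k i j *: e k.
Proof.
rewrite Beb proj10D !(@lin_sum p10 _ _ p10P).
under [X in _ + X]eq_bigr => k _ do rewrite eb10.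
by rewrite z0 addr0; apply: eq_bigr => k _; rewrite e10.
Qed.

Let p01eb i j : p01 (B (e i) (eb j)) = \sum_k (b k j i)^* *: eb k.
Proof.
rewrite Beb proj01D !(@lin_sum p01 _ _ p01P).
under eq_bigr => k _ do rewrite e01.
by rewrite z0 add0r; apply: eq_bigr => k _; rewrite eb01.
Qed.

Let B1ee i j : br1 (e i) (e j) = \sum_k - a k i j *: e k.
Proof.
rewrite (br1_pure i2 JJ two0 Bb (t := true) (s := true)) //= Bee (@lin_sum p10 _ _ p10P).
by apply: eq_bigr => k _; rewrite e10.
Qed.
Let B1eb i j : br1 (e i) (eb j) = \sum_k (b k j i)^* *: eb k.
Proof. by rewrite (br1_pure i2 JJ two0 Bb (t := true) (s := false)) //= p01eb. Qed.
Let B1bb i j : br1 (eb i) (eb j) = 0.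
Proof. by rewrite (br1_pure i2 JJ two0 Bb (t := false) (s := false)) //=. Qed.
Let B2ee i j : br2 (e i) (e j) = 0.
Proof. by rewrite (br2_pure i2 JJ two0 Bb (t := true) (s := true)) //=. Qed.
Let B2eb i j : br2 (e i) (eb j) = \sum_k - b k i j *: e k.
Proof. by rewrite (br2_pure i2 JJ two0 Bb (t := true) (s := false)) //= p10eb. Qed.
Let B2bb i j : br2 (eb i) (eb j) = \sum_k - (a k i j)^* *: eb k.
Proof.
rewrite (br2_pure i2 JJ two0 Bb (t := false) (s := false)) //= Bbb (@lin_sum p01 _ _ p01P).
by apply: eq_bigr => k _; rewrite eb01.
Qed.

Local Notation ac := (fun k i j => (a k i j)^*).
Local Notation bc := (fun k i j => (b k i j)^*).
Local Notation tE := (tE a ac b bc).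
Local Notation tEc := (tEc a ac b bc).

Let b1l := bilin_br1 I J Bb.
Let b2l := bilin_br2 I J Bb.

Lemma frame_E x0 x1 x2 y0 y1 y2 :
  extd br1 (extd br2 (sqform F)) (vec6 e eb x0 x1 x2 y0 y1 y2) =
  2 * ka ^+ 2 * tE x0 x1 x2 y0 y1 y2.
Proof.
apply: table_E => //.
- exact: (br2_alt I J Bb Ba).
- by move=> i j; rewrite -(e10 i) -(e10 j) F10.
- by move=> i j; rewrite -(eb01 i) -(eb01 j) F01.
Qed.

(** Only type (3,3) can survive, since [F^F] is of type (2,2); on it the sixteen frame values of
    [alt33_eq0] are decisive. *)
Theorem ddbar_frame :
  (forall X, fdel (fdelbar (sqform F)) X = 0) <-> (forall d d', tEc d d' = 0).
Proof.
split=> [h d d'|h X].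
  have := h (vec6 e eb (lift d t0) (lift d t1) (lift d t2)
                       (lift d' t0) (lift d' t1) (lift d' t2)).
  rewrite (@deldelbar_pure _ _ _ _ i2 JJ two0 B Bb _ _ (fun j => j < 3)%N); last 2 first.
  - exact: sqform_mlin.
  - by case=> [[|[|[|[|[|[|//]]]]]] ltj]; rewrite /vec6 /vecs /projt /= ?e10 ?eb01.
  have k2 : 2 * ka ^+ 2 != 0 by rewrite mulf_neq0 // expf_neq0.
  rewrite frame_E => /eqP; rewrite mulf_eq0 (negbTE k2) /=.
  by move/eqP.
have dlin := mlin_delbar I J Bb sqform_mlin.
apply: (del_eq0 i2 JJ two0 Bb) => //.
move=> tp Y pY; have [c3|c3] := eqVneq (\sum_j tp j)%N 3; last first.
  apply: (@fdel_type _ _ 2 dlin _ tp) => //.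
  exact: (@fdelbar_type _ _ 2 sqform_mlin sqform_type).
rewrite (deldelbar_pure i2 JJ two0 Bb _ pY); last exact: sqform_mlin.
apply: (@alt33_eq0 _ _ e eb _ tp) => //.
- by apply: mlin_extd => //; apply: mlin_extd => //; exact: sqform_mlin.
- apply: alt_extd => //; first exact: (br1_alt I J Bb Ba).
    by apply: mlin_extd => //; exact: sqform_mlin.
  apply: alt_extd => //; first exact: (br2_alt I J Bb Ba).
    exact: sqform_mlin.
  exact: sqform_alt.
- by move=> d d'; rewrite frame_E -/(tEc d d') h mulr0.
- by move=> j; rewrite -(pY j); case: (tp j); [exact: e_span|exact: eb_span].
Qed.

End Frame.

(** * Nilpotent traces and unitary bases *)

Section LinearAlgebra.
Variable C : numClosedFieldType.

Definition cj m n (A : 'M[C]_(m, n)) : 'M[C]_(m, n) := map_mx Num.conj A.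

Lemma cjE m n (A : 'M[C]_(m, n)) i j : cj A i j = (A i j)^*. Proof. by rewrite mxE. Qed.
Lemma cjK m n (A : 'M[C]_(m, n)) : cj (cj A) = A.
Proof. by apply/matrixP=> i j; rewrite !mxE conjCK. Qed.
Lemma cjM m n p (A : 'M[C]_(m, n)) (B : 'M[C]_(n, p)) : cj (A *m B) = cj A *m cj B.
Proof. exact: map_mxM. Qed.
Lemma cjD m n (A B : 'M[C]_(m, n)) : cj (A + B) = cj A + cj B.
Proof. exact: map_mxD. Qed.
Lemma cjN m n (A : 'M[C]_(m, n)) : cj (- A) = - cj A.
Proof. exact: map_mxN. Qed.
Lemma cjZ m n a (A : 'M[C]_(m, n)) : cj (a *: A) = a^* *: cj A.
Proof. exact: map_mxZ. Qed.
Lemma cj0 m n : cj 0 = 0 :> 'M[C]_(m, n). Proof. exact: map_mx0. Qed.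
Lemma cj_sum m n (I : finType) (F : I -> 'M[C]_(m, n)) : cj (\sum_i F i) = \sum_i cj (F i).
Proof. exact: (big_morph _ (@cjD m n) (cj0 m n)). Qed.
Lemma cj_row m n (A : 'M[C]_(m, n)) i : cj (row i A) = row i (cj A).
Proof. exact: map_row. Qed.
Lemma cj_tr m n (A : 'M[C]_(m, n)) : cj A^T = (cj A)^T.
Proof. by apply/matrixP=> i j; rewrite !mxE. Qed.
Lemma cj1 n : cj 1%:M = 1%:M :> 'M[C]_n. Proof. exact: map_mx1. Qed.

(** All eigenvalues are 0, so the characteristic polynomial is a power of X, and its subleading
    coefficient is minus the trace. *)
Lemma nilpotent_trace n (A : 'M[C]_n.+1) N : A ^+ N = 0 -> \tr A = 0.
Proof.
move=> A0; have [r er] := closed_field_poly_normal (char_poly A).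
have mon := char_poly_monic A; rewrite (monicP mon) scale1r in er.
have r0 z : z \in r -> z = 0.
  move=> zr; have : root (char_poly A) z by rewrite er root_prod_XsubC.
  rewrite -eigenvalue_root_char => /eigenvalueP[v vA v0].
  have vN q : v *m A ^+ q = z ^+ q *: v.
    elim: q => [|q IH]; first by rewrite !expr0 scale1r mulmx1.
    by rewrite !exprSr mulmxA IH -scalemxAl vA scalerA.
  have /eqP := vN N; rewrite A0 mulmx0 eq_sym scaler_eq0 (negbTE v0) orbF.
  by rewrite expf_eq0 => /andP[_ /eqP].
have : char_poly A = 'X^(size r).
  rewrite er; elim: (r) r0 => [|z s IH] h; first by rewrite big_nil.
  rewrite big_cons IH => [|y ys]; last by apply: h; rewrite inE ys orbT.
  by rewrite (h z (mem_head _ _)) polyC0 subr0 /= exprS.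
move=> e; have := char_poly_trace A (ltn0Sn n).
have : size (char_poly A) = n.+2 by rewrite size_char_poly.
rewrite e size_polyXn => -[->] /=; rewrite coefXn.
by rewrite ltn_eqF //= => /eqP; rewrite eq_sym oppr_eq0 => /eqP.
Qed.

(** Gram-Schmidt started at the conjugate transpose of [t] makes the other rows annihilate [t]; a
    transposition moves the exceptional row to the last place. *)
Lemma unitary_kernel (t : 'cV[C]_4) : exists2 U : 'M[C]_4, U *m (cj U)^T = 1%:M &
  forall k, k != ord_max -> row k U *m t = 0.
Proof.
have [->|t0] := eqVneq t 0.
  by exists 1%:M => [|k _]; rewrite ?cj1 ?trmx1 ?mulmx1 ?mulmx0.
pose v : 'rV[C]_4 := (cj t)^T.
pose A : 'M[C]_4 := \matrix_(i < 4) v.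
pose S := schmidt A.
have Su : S *m (cj S)^T = 1%:M.
  by have /unitarymxP := @schmidt_unitarymx C 4 4 A (leqnn 4); rewrite -/(cj _) cj_tr.
have : (row 0 A <= row 0 S)%MS.
  have := row_schmidt_sub A 0.
  rewrite (big_pred1 0) ?genmxE // => k /=.
  by rewrite leqn0 -val_eqE.
rewrite rowK => /sub_rVP[c vc].
have c0 : c != 0.
  apply: contraNneq t0 => c0; move: vc; rewrite c0 scale0r => /(congr1 trmx).
  by rewrite /v trmxK trmx0 => /(congr1 (@cj _ _)); rewrite cjK cj0 => ->.
have tE : t = c^* *: (cj (row 0 S))^T.
  have := congr1 (fun u => (cj u)^T) vc; rewrite /v cj_tr cjK trmxK => ->.
  by rewrite cjZ; apply/matrixP=> i j; rewrite !mxE.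
exists (row_perm (tperm 0 ord_max) S).
  apply/matrixP=> i j; have := congr1 (fun M : 'M[C]_4 => M (tperm 0 ord_max i) (tperm 0 ord_max j)) Su.
  rewrite !mxE (inj_eq perm_inj) => <-; apply: eq_bigr => k _.
  by rewrite !mxE.
move=> k nk; rewrite tE -scalemxAr; apply/eqP; rewrite scaler_eq0; apply/orP; right.
have := congr1 (fun M : 'M[C]_4 => M (tperm 0 ord_max k) 0) Su; rewrite !mxE.
have -> : (tperm 0 ord_max k == 0 :> 'I_4) = false.
  by apply: contraNF nk => /eqP /(congr1 (tperm 0 ord_max)); rewrite tpermK tpermL => ->.
move=> e; apply/eqP/matrixP=> i j; rewrite !mxE -[RHS]e; apply: eq_bigr => p _.
by rewrite !mxE.
Qed.

(** Spectral theorem, followed by a rescaling by the inverse square roots of the eigenvalues, which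
    are positive because [G] is. *)
Lemma unitary_diag (G : 'M[C]_4) : (cj G)^T = G ->
  (forall x : 'rV[C]_4, x != 0 -> 0 < (x *m G *m (cj x)^T) 0 0) ->
  exists2 P : 'M[C]_4, P \in unitmx & P *m G *m (cj P)^T = 1%:M.
Proof.
move=> Gh Gp.
have Gn : G \is normalmx.
  by apply/normalmxP; have -> : map_mx Num.conj G^T = G by rewrite -/(cj _) cj_tr.
have /orthomx_spectralP := Gn; set P := spectralmx G; set d := spectral_diag G.
have Pu : P \is unitarymx := spectral_unitarymx G.
rewrite invmx_unitary // => eG.
have PP : P *m (cj P)^T = 1%:M by have /unitarymxP := Pu; rewrite -/(cj _) cj_tr.
have PG : P *m G *m (cj P)^T = diag_mx d.
  rewrite [in LHS]eG -/(cj P^T) cj_tr -!mulmxA PP mulmx1 mulmxA PP mul1mx //.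
have dp i : 0 < d 0 i.
  have r0 : row i P != 0.
    apply/eqP => r0; have := congr1 (row i) PP; rewrite row_mul r0 mul0mx => /rowP/(_ i).
    by rewrite !mxE eqxx => /eqP; rewrite eq_sym oner_eq0.
  have := Gp _ r0; congr (0 < _).
  have := congr1 (fun M : 'M[C]_4 => M i i) PG; rewrite [RHS]mxE eqxx mulr1n => <-.
  by rewrite -row_mul cj_row !mxE; apply: eq_bigr => j _; rewrite !mxE.
pose s : 'rV[C]_4 := \row_i (sqrtC (d 0 i))^-1.
have s0 i : sqrtC (d 0 i) != 0 by rewrite sqrtC_eq0 gt_eqF.
have sJ : cj s = s.
  apply/rowP=> i; rewrite !mxE; apply: CrealP.
  by rewrite rpredV ger0_real // sqrtC_ge0 ltW.
exists (diag_mx s *m P).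
  rewrite unitmx_mul (unitarymx_unit Pu) andbT unitmxE det_diag unitfE.
  by apply/prodf_neq0 => i _; rewrite mxE invr_eq0.
have -> : (cj (diag_mx s *m P))^T = (cj P)^T *m diag_mx s.
  by rewrite cjM /cj map_diag_mx -/(cj s) sJ trmx_mul tr_diag_mx.
rewrite -!mulmxA (mulmxA G) (mulmxA P) (mulmxA P) PG.
rewrite mulmxA mulmx_diag mulmx_diag; apply/matrixP=> i j; rewrite !mxE.
case: eqP => //= _; rewrite mulr1n; have := s0 i; set q := sqrtC _ => q0.
have -> : d 0 i = q * q by rewrite -expr2 sqrtCK.
by field.
Qed.

End LinearAlgebra.

(** * Structure tables of a complexified nilpotent Lie algebra *)

Section Complexified.
Variable C : numClosedFieldType.
Variables (n : nat) (I : C) (J : 'M[C]_n).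
Local Notation V := 'rV[C]_n.
Hypotheses (i2 : I * I = -1) (IJ : I^* = - I) (JJ : J *m J = - 1%:M) (Jr : cj J = J).
Variable B : V -> V -> V.
Hypotheses (Bb : bilin B) (Ba : forall u, B u u = 0).
Hypothesis Bjac : forall x y z, B x (B y z) + B y (B z x) + B z (B x y) = 0.
Hypothesis Bcj : forall u v, B (cj u) (cj v) = cj (B u v).
Local Notation p10 := (p10 I J).
Local Notation p01 := (p01 I J).
Hypothesis Bint : forall u v, p01 (B (p10 u) (p10 v)) = 0.
Hypothesis Bnil : exists N, forall s x, size s = N -> foldr B x s = 0.

Let two0 : 2 != 0 :> C. Proof. by rewrite pnatr_eq0. Qed.

Definition Pi : 'M[C]_n := 2^-1 *: (1%:M - I *: J).

Lemma p10E z : p10 z = z *m Pi.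
Proof. by rewrite /p10 /Pi -scalemxAr mulmxBr mulmx1 -scalemxAr. Qed.

Lemma Pi_idem : Pi *m Pi = Pi.
Proof.
apply/row_matrixP=> i; rewrite row_mul !rowE -!p10E.
exact: (proj1010 i2 JJ two0).
Qed.

Lemma p01_cj z : p01 (cj z) = cj (p10 z).
Proof.
rewrite /p10 /p01 cjZ cjD cjN cjZ cjM Jr IJ scaleNr opprK.
by rewrite conjV conjC_nat.
Qed.

Lemma p10_cj z : p10 (cj z) = cj (p01 z).
Proof. by rewrite -{2}[z]cjK p01_cj cjK. Qed.

Let proj_id := proj_sum I J two0.

Let BDl x y z : B (x + y) z = B x z + B y z.
Proof. by have := Bb.1 1 x y z; rewrite !scale1r. Qed.
Let BDr x y z : B z (x + y) = B z x + B z y.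
Proof. by have := Bb.2 1 x y z; rewrite !scale1r. Qed.
Let B0l z : B 0 z = 0.
Proof. by have := Bb.1 (-1) 0 0 z; rewrite scaler0 addr0 scaleN1r addNr. Qed.
Let B0r z : B z 0 = 0.
Proof. by have := Bb.2 (-1) 0 0 z; rewrite scaler0 addr0 scaleN1r addNr. Qed.
Let BZl a x z : B (a *: x) z = a *: B x z.
Proof. by have := Bb.1 a x 0 z; rewrite !addr0 B0l addr0. Qed.
Let BZr a x z : B z (a *: x) = a *: B z x.
Proof. by have := Bb.2 a x 0 z; rewrite !addr0 B0r addr0. Qed.
Let Bskew x y : B x y = - B y x.
Proof.
by have := Ba (x + y); rewrite BDl !BDr !Ba add0r addr0 => /eqP; rewrite addr_eq0 => /eqP.
Qed.
Let Bsuml (F : 'I_4 -> V) z : B (\sum_k F k) z = \sum_k B (F k) z.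
Proof. exact: (big_morph (fun x => B x z) (fun x y => BDl x y z) (B0l z)). Qed.
Let Bsumr (F : 'I_4 -> V) z : B z (\sum_k F k) = \sum_k B z (F k).
Proof. exact: (big_morph (fun x => B z x) (fun x y => BDr x y z) (B0r z)). Qed.

Lemma B10 u v : p10 (B (p10 u) (p10 v)) = B (p10 u) (p10 v).
Proof. by rewrite -[RHS]proj_id Bint addr0. Qed.

Lemma B01 u v : p10 (B (p01 u) (p01 v)) = 0.
Proof.
have e w : p01 w = cj (p10 (cj w)) by rewrite -p01_cj cjK.
by rewrite !e Bcj p10_cj Bint cj0.
Qed.

Section OneFrame.
Variables (E : 'M[C]_(4, n)) (W : 'M[C]_(n, 4)).
Hypotheses (WE : W *m E = Pi) (EW : E *m W = 1%:M).

Definition fe i : V := row i E.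
Definition feb i : V := cj (row i E).
(** The sign is that of [(dw)(X, Y) = - w([X, Y])]. *)
Definition fa k i j : C := - (B (fe i) (fe j) *m W) 0 k.
Definition fb k i j : C := - (B (fe i) (feb j) *m W) 0 k.

Lemma p10_fe i : p10 (fe i) = fe i.
Proof. by rewrite p10E -WE mulmxA -row_mul EW -row_mul mul1mx. Qed.

Lemma p01_feb i : p01 (feb i) = feb i.
Proof. by rewrite /feb p01_cj p10_fe. Qed.

Lemma p10_W z : p10 z = \sum_k (z *m W) 0 k *: fe k.
Proof. by rewrite p10E -WE mulmxA mulmx_sum_row. Qed.

Lemma p01_W z : p01 z = \sum_k ((cj z *m W) 0 k)^* *: feb k.
Proof.
rewrite -{1}[z]cjK p01_cj p10_W cj_sum; apply: eq_bigr => k _.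
by rewrite cjZ.
Qed.

Lemma W_p10 z : p10 z *m W = z *m W.
Proof. by rewrite p10E -WE -!mulmxA EW mulmx1. Qed.

Lemma W_p01 z : p01 z *m W = 0.
Proof.
by rewrite -[p01 z](addKr (p10 z)) proj_id mulmxDl mulNmx W_p10 addNr.
Qed.

Lemma fBee i j : B (fe i) (fe j) = \sum_k - fa k i j *: fe k.
Proof.
rewrite -(p10_fe i) -(p10_fe j) -B10 p10_W; apply: eq_bigr => k _.
by rewrite /fa !p10_fe opprK.
Qed.

Lemma fBbb i j : B (feb i) (feb j) = \sum_k - (fa k i j)^* *: feb k.
Proof.
rewrite /feb Bcj -/(fe i) -/(fe j) fBee cj_sum; apply: eq_bigr => k _.
by rewrite cjZ rmorphN.
Qed.

Lemma fBeb10 i j : p10 (B (fe i) (feb j)) = \sum_k - fb k i j *: fe k.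
Proof. by rewrite p10_W; apply: eq_bigr => k _; rewrite /fb opprK. Qed.

Lemma fBeb01 i j : p01 (B (fe i) (feb j)) = \sum_k (fb k j i)^* *: feb k.
Proof.
rewrite p01_W; apply: eq_bigr => k _; rewrite -Bcj /feb cjK -/(fe i) -/(fe j) -/(feb i).
by rewrite Bskew mulNmx mxE /fb.
Qed.

Lemma fBeb i j : B (fe i) (feb j) =
  \sum_k - fb k i j *: fe k + \sum_k (fb k j i)^* *: feb k.
Proof. by rewrite -fBeb10 -fBeb01 proj_id. Qed.

Lemma fa_skew k i j : fa k i j = - fa k j i.
Proof. by rewrite /fa Bskew mulNmx mxE opprK. Qed.

Definition fn (z : 'rV[C]_4) (v : V) : C := (v *m W *m z^T) 0 0.

Lemma fnE z v : fn z v = \sum_k z 0 k * (v *m W) 0 k.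
Proof. by rewrite /fn mxE; apply: eq_bigr => k _; rewrite [z^T _ _]mxE mulrC. Qed.

Lemma fnD z u v : fn z (u + v) = fn z u + fn z v.
Proof. by rewrite /fn !mulmxDl mxE. Qed.
Lemma fnN z v : fn z (- v) = - fn z v.
Proof. by rewrite /fn !mulNmx mxE. Qed.
Lemma fnZ z a v : fn z (a *: v) = a * fn z v.
Proof. by rewrite /fn -!scalemxAl mxE. Qed.
Lemma fn0 z : fn z 0 = 0. Proof. by rewrite /fn !mul0mx mxE. Qed.
Lemma fn_sum z (F : 'I_4 -> V) : fn z (\sum_k F k) = \sum_k fn z (F k).
Proof. exact: (big_morph _ (fnD z) (fn0 z)). Qed.
Lemma fn_p10 z v : fn z (p10 v) = fn z v. Proof. by rewrite /fn W_p10. Qed.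

Lemma fn_fe z k : fn z (fe k) = z 0 k.
Proof.
rewrite fnE -row_mul EW (bigD1 k) //= big1 ?addr0 => [|i ik]; rewrite !mxE ?eqxx ?mulr1 //.
by rewrite eq_sym (negbTE ik) mulr0.
Qed.

Lemma da_fn z i j : da fa z i j = - fn z (B (fe i) (fe j)).
Proof. by rewrite fnE -sumrN; apply: eq_bigr => k _; rewrite /fa mulrN. Qed.

Lemma db_fn z i j : db fb z i j = - fn z (B (fe i) (feb j)).
Proof. by rewrite fnE -sumrN; apply: eq_bigr => k _; rewrite /fb mulrN. Qed.

Lemma fjac x y z : B (B x y) z = B x (B y z) - B y (B x z).
Proof.
have := Bjac x y z; rewrite (Bskew z x) (Bskew z (B x y)).
have -> : B y (- B x z) = - B y (B x z) by rewrite -scaleN1r BZr scaleN1r.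
by move/eqP; rewrite subr_eq0 => /eqP ->.
Qed.

(** The Jacobi identity for [e_i, conj(e_l), conj(e_j)], tested on a (1,0)-form. Brackets of two
    (0,1)-vectors have no (1,0)-part, so (0,1)-components of inner brackets drop out. *)
Lemma table_dbar2 z i l j :
  (da fa (crowb fb z i) l j)^* = db fb (colb fb z j) i l - db fb (colb fb z l) i j.
Proof.
have key p q : db fb (colb fb z q) i p = fn z (B (B (fe i) (feb p)) (feb q)).
  rewrite -{1}[B (fe i) (feb p)]proj_id BDl fnD -(fn_p10 _ (B (p01 _) _)) -(p01_feb q) B01.
  rewrite fn0 addr0 fBeb10 Bsuml fn_sum /db /ev; apply: eq_bigr => k _.
  by rewrite mxE BZl fnZ db_fn p01_feb; ring.
rewrite !key -fnN -fnD.
have -> : (da fa (crowb fb z i) l j)^* = fn z (B (fe i) (B (feb l) (feb j))).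
  rewrite fBbb Bsumr fn_sum /da /ev conj_sum; apply: eq_bigr => k _.
  by rewrite conjM mxE conjCK db_fn BZr fnZ; ring.
congr fn; rewrite [B (B (fe i) (feb l)) (feb j)]fjac.
by rewrite (Bskew (B (fe i) (feb j))) opprK -addrA addNr addr0.
Qed.

(** The Jacobi identity for [e_i, e_k, conj(e_l)]: the inner brackets with [conj(e_l)] split into a
    (1,0)-part, giving [dbd], and a (0,1)-part, giving two terms of [ddb]. *)
Lemma table_dbd_ddb z l i k : dbd fa fb z l i k = - ddb fa fb z l i k.
Proof.
have k1 p q : db fb (rowa fa z p) q l = fn z (B (fe p) (p10 (B (fe q) (feb l)))).
  rewrite fBeb10 Bsumr fn_sum /db /ev; apply: eq_bigr => r _.
  by rewrite mxE BZr fnZ da_fn; ring.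
have k2 : da fa (colb fb z l) i k = fn z (B (B (fe i) (fe k)) (feb l)).
  rewrite fBee Bsuml fn_sum /da /ev; apply: eq_bigr => r _.
  by rewrite mxE BZl fnZ db_fn; ring.
have k3 p q : (db fb (crowb fb z p) l q)^* = - fn z (B (fe p) (p01 (B (fe q) (feb l)))).
  rewrite fBeb01 Bsumr fn_sum /db /ev conj_sum -sumrN; apply: eq_bigr => r _.
  by rewrite conjM mxE conjCK db_fn BZr fnZ; ring.
rewrite /dbd /ddb !k1 k2 !k3 fjac fnD fnN.
have sp p q : fn z (B (fe p) (B (fe q) (feb l))) =
   fn z (B (fe p) (p10 (B (fe q) (feb l)))) + fn z (B (fe p) (p01 (B (fe q) (feb l)))).
  by rewrite -fnD -BDr proj_id.
by rewrite !sp; ring.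
Qed.

(** Up to sign, [colb] is the coadjoint action of [conj(e_l)]; this is how nilpotency reaches the
    tables. *)
Lemma fn_colb z l v : fn (colb fb z l) v = fn z (B (feb l) v).
Proof.
have -> : fn z (B (feb l) v) = fn z (B (feb l) (p10 v)).
  rewrite -{1}[v]proj_id BDr fnD -(fn_p10 _ (B _ (p01 v))) -(p01_feb l) B01.
  by rewrite fn0 addr0.
rewrite p10_W Bsumr fn_sum fnE; apply: eq_bigr => k _.
by rewrite mxE db_fn BZr fnZ (Bskew (feb l)) fnN mulrC.
Qed.

(** If every form outside [U] had a coefficient outside [U], one could choose such coefficients
    forever. After N choices the form is [z0] composed with N nested brackets, hence 0, which is in
    [U]. *)
Lemma table_engel (U : 'rV[C]_4 -> Prop) : U 0 -> (exists z, ~ U z) ->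
  exists2 z, ~ U z & forall l, U (colb fb z l).
Proof.
move=> U0 [z0 nz0]; have [N hN] := Bnil.
apply: contrapT => h.
have step z : ~ U z -> exists l, ~ U (colb fb z l).
  move=> nz; apply: contrapT => /forallNP hl; apply: h; exists z => // l.
  exact: contrapT (hl l).
have iter k : exists s z, [/\ size s = k, ~ U z & forall v, fn z v = fn z0 (foldr B v s)].
  elim: k => [|k [s [z [ss nz hz]]]]; first by exists [::], z0.
  have [l nl] := step z nz; exists (rcons s (feb l)), (colb fb z l).
  by split=> //; [rewrite size_rcons ss|move=> v; rewrite fn_colb hz foldr_rcons].
have [s [z [ss nz hz]]] := iter N; apply: nz.
suff -> : z = 0 by [].
by apply/rowP=> k; rewrite -fn_fe hz hN // fn0 mxE.
Qed.

Lemma foldr_nseq N u (x : V) : foldr B x (nseq N u) = iter N (B u) x.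
Proof. by elim: N => //= N ->. Qed.

(** The bracket with [e_i] preserves the (1,0)-vectors and is nilpotent on them. *)
Lemma table_a_tr i : \sum_k fa k i k = 0.
Proof.
have [N hN] := Bnil; pose M : 'M[C]_4 := \matrix_(j < 4) (B (fe i) (fe j) *m W).
have ME x : (x *m M) *m E = B (fe i) (x *m E).
  rewrite (mulmx_sum_row x E) Bsumr (mulmx_sum_row x M) mulmx_suml.
  apply: eq_bigr => k _; rewrite BZr rowK -scalemxAl -mulmxA WE -p10E.
  by rewrite -/(fe k) -(p10_fe i) -(p10_fe k) B10.
have MN : M ^+ N = 0.
  apply/row_matrixP=> r; rewrite row0 -[RHS](mul0mx _ W).
  have key q x : (x *m M ^+ q) *m E = iter q (B (fe i)) (x *m E).
    elim: q x => [|q IH] x; first by rewrite expr0 mulmx1.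
    by rewrite exprSr mulmxA ME IH.
  have : (row r 1%:M *m M ^+ N) *m E = 0.
    by rewrite key -foldr_nseq hN // size_nseq.
  by rewrite -row_mul mul1mx => <-; rewrite -mulmxA EW mulmx1.
apply/eqP; rewrite -oppr_eq0 -sumrN -[X in _ == X](nilpotent_trace MN); apply/eqP.
by apply: eq_bigr => k _; rewrite !mxE /fa opprK mxE.
Qed.

(** The bracket with [conj(e_j)] preserves the (0,1)-vectors, so it acts nilpotently on the quotient
    by them, represented here by the (1,0)-vectors followed by [p10]. *)
Lemma table_b_tr j : \sum_k fb k k j = 0.
Proof.
have [N hN] := Bnil; pose M : 'M[C]_4 := \matrix_(i < 4) (B (feb j) (fe i) *m W).
have key10 v : p10 (B (feb j) (p10 v)) = p10 (B (feb j) v).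
  by rewrite -{2}[v]proj_id BDr proj10D -(p01_feb j) B01 addr0.
have ME x : (x *m M) *m E = p10 (B (feb j) (x *m E)).
  rewrite (mulmx_sum_row x E) Bsumr (mulmx_sum_row x M) mulmx_suml p10E mulmx_suml.
  apply: eq_bigr => k _; rewrite BZr rowK -!scalemxAl -mulmxA WE //.
have MN : M ^+ N = 0.
  apply/row_matrixP=> r; rewrite row0 -[RHS](mul0mx _ W).
  have key q x : (x *m M ^+ q) *m E = p10 (iter q (B (feb j)) (x *m E)).
    elim: q x => [|q IH] x.
      by rewrite expr0 mulmx1 /= p10E -WE mulmxA -(mulmxA x) EW mulmx1.
    by rewrite exprSr mulmxA ME IH key10.
  have : (row r 1%:M *m M ^+ N) *m E = 0.
    by rewrite key -foldr_nseq hN ?size_nseq // p10E mul0mx.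
  by rewrite -row_mul mul1mx => <-; rewrite -mulmxA EW mulmx1.
rewrite -[RHS](nilpotent_trace MN).
by apply: eq_bigr => k _; rewrite !mxE /fb Bskew mulNmx mxE opprK mxE.
Qed.

Lemma table_int_by_parts (d d' : 'I_4) :
  2 * ((-1) ^+ (d + d') * tEc fa (fun k i j => (fa k i j)^*) fb (fun k i j => (fb k i j)^*) d d') =
  - tQ fa (fun k i j => (fa k i j)^*) fb (fun k i j => (fb k i j)^*) d d'.
Proof.
have dg k i : fa k i i = 0 by rewrite /fa Ba mul0mx mxE oppr0.
apply: integration_by_parts => //.
- exact: fa_skew.
- by move=> k i j; rewrite fa_skew rmorphN.
- by move=> k i; rewrite dg rmorph0.
- exact: table_a_tr.
- by move=> i; rewrite -conj_sum table_a_tr rmorph0.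
- exact: table_b_tr.
- by move=> j; rewrite -conj_sum table_b_tr rmorph0.
Qed.

Lemma closed_fn z : dclosed fa fb z <-> forall u v, fn z (B u v) = 0.
Proof.
split=> [[h1 h2] u v|h]; last by split=> i j; rewrite ?da_fn ?db_fn h oppr0.
have e10 x y : fn z (B (p10 x) (p10 y)) = 0.
  rewrite !p10_W Bsuml fn_sum big1 // => i _; rewrite BZl fnZ Bsumr fn_sum big1 ?mulr0 // => j _.
  by rewrite BZr fnZ -[fn _ _]opprK -da_fn h1 oppr0 mulr0.
have e11 x y : fn z (B (p10 x) (p01 y)) = 0.
  rewrite p10_W p01_W Bsuml fn_sum big1 // => i _; rewrite BZl fnZ Bsumr fn_sum big1 ?mulr0 // => j _.
  by rewrite BZr fnZ -[fn _ _]opprK -db_fn h2 oppr0 mulr0.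
rewrite -[u]proj_id -[v]proj_id BDl !BDr !fnD e10 e11 (Bskew (p01 u)) fnN e11.
by rewrite -(fn_p10 _ (B (p01 u) _)) B01 fn0 oppr0 !addr0.
Qed.

Lemma dw_expand k u v : - (B u v *m W) 0 k =
  2^-1 * \sum_i \sum_j fa k i j * ((u *m W) 0 i * (v *m W) 0 j - (v *m W) 0 i * (u *m W) 0 j) +
  \sum_i \sum_j fb k i j * ((u *m W) 0 i * ((cj v *m W) 0 j)^* -
                            (v *m W) 0 i * ((cj u *m W) 0 j)^*).
Proof.
pose z : 'rV[C]_4 := delta_mx 0 k.
have fz x : fn z x = (x *m W) 0 k by rewrite /fn trmx_delta -colE mxE.
have e10 x y : fn z (B (p10 x) (p10 y)) =
    - \sum_i \sum_j fa k i j * ((x *m W) 0 i * (y *m W) 0 j).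
  rewrite !p10_W Bsuml fn_sum -sumrN; apply: eq_bigr => i _.
  rewrite BZl fnZ Bsumr fn_sum -sumrN mulr_sumr; apply: eq_bigr => j _.
  by rewrite BZr fnZ fz /fa; ring.
have e11 x y : fn z (B (p10 x) (p01 y)) =
    - \sum_i \sum_j fb k i j * ((x *m W) 0 i * ((cj y *m W) 0 j)^*).
  rewrite p10_W p01_W Bsuml fn_sum -sumrN; apply: eq_bigr => i _.
  rewrite BZl fnZ Bsumr fn_sum -sumrN mulr_sumr; apply: eq_bigr => j _.
  by rewrite BZr fnZ fz /fb; ring.
rewrite -fz -[u in LHS]proj_id -[v in LHS]proj_id BDl !BDr !fnD.
rewrite (Bskew (p01 u) (p10 v)) fnN !e11.
rewrite -(fn_p10 _ (B (p01 u) (p01 v))) B01 fn0 addr0.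
have -> : fn z (B (p10 u) (p10 v)) =
    2^-1 * (fn z (B (p10 u) (p10 v)) - fn z (B (p10 v) (p10 u))).
  by rewrite (Bskew (p10 v)) fnN; field.
rewrite !e10.
have sp (A X Y : 'I_4 -> 'I_4 -> C) : \sum_i \sum_j A i j * (X i j - Y i j) =
    \sum_i \sum_j A i j * X i j - \sum_i \sum_j A i j * Y i j.
  rewrite -sumrB; apply: eq_bigr => i _; rewrite -sumrB; apply: eq_bigr => j _.
  by rewrite mulrBr.
by rewrite !sp; ring.
Qed.

End OneFrame.
End Complexified.

(** * The Hermitian form [Q] and its values on basis forms *)

Section QForm.
Variable C : numClosedFieldType.
Variables a b : 'I_4 -> 'I_4 -> 'I_4 -> C.
Local Notation ac := (fun k i j => (a k i j)^*).
Local Notation bc := (fun k i j => (b k i j)^*).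
Hypothesis J2 : forall z l i k, dbd a b z l i k = - ddb a b z l i k.

Lemma QP x z z' y : Q a b (x *: z + z') y = x * Q a b z y + Q a b z' y.
Proof.
rewrite /Q.
have S (F G H : 'I_4 -> 'I_4 -> C) : (forall i j, F i j = x * G i j + H i j) ->
    \sum_i \sum_j F i j = x * \sum_i \sum_j G i j + \sum_i \sum_j H i j.
  move=> h; rewrite mulr_sumr -big_split; apply: eq_bigr => i _ /=.
  by rewrite mulr_sumr -big_split; apply: eq_bigr => j _ /=.
have S1 (F G H : 'I_4 -> C) : (forall i, F i = x * G i + H i) ->
    \sum_i F i = x * \sum_i G i + \sum_i H i.
  by move=> h; rewrite mulr_sumr -big_split; apply: eq_bigr => i _ /=.
have e1 : \sum_i \sum_j da a (x *: z + z') i j * (da a y i j)^* =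
    x * \sum_i \sum_j da a z i j * (da a y i j)^* + \sum_i \sum_j da a z' i j * (da a y i j)^*.
  by apply: S => i j; rewrite /da evP; ring.
have e2 : \sum_i \sum_j db b (x *: z + z') i j * (db b y i j)^* =
    x * \sum_i \sum_j db b z i j * (db b y i j)^* + \sum_i \sum_j db b z' i j * (db b y i j)^*.
  by apply: S => i j; rewrite /db evP; ring.
have cP m : contr a b (x *: z + z') m = x * contr a b z m + contr a b z' m.
  by apply: S1 => l; rewrite dbdP.
have e3 : \sum_m contr a b (x *: z + z') m * (y 0 m)^* =
    x * \sum_m contr a b z m * (y 0 m)^* + \sum_m contr a b z' m * (y 0 m)^*.
  by apply: S1 => m; rewrite cP; ring.
have e4 : (\sum_m contr a b y m * ((x *: z + z') 0 m)^*)^* =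
    x * (\sum_m contr a b y m * (z 0 m)^*)^* + (\sum_m contr a b y m * (z' 0 m)^*)^*.
  by rewrite !conj_sum; apply: S1 => m; rewrite !conjM !conjCK !mxE; ring.
have e5 : trb b (x *: z + z') = x * trb b z + trb b z' by rewrite /trb evP.
by rewrite e1 e2 e3 e4 e5; ring.
Qed.

Lemma Q_herm z y : Q a b z y = (Q a b y z)^*.
Proof.
rewrite /Q !conjD rmorphN /= !conjM conjV conjC_nat !conjCK.
have S (F : 'I_4 -> 'I_4 -> 'rV[C]_4 -> C) :
    (\sum_i \sum_j F i j y * (F i j z)^*)^* = \sum_i \sum_j F i j z * (F i j y)^*.
  rewrite conj_sum; apply: eq_bigr => i _; rewrite conj_sum; apply: eq_bigr => j _.
  by rewrite conjM conjCK mulrC.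
rewrite (S (fun i j z => da a z i j)) (S (fun i j z => db b z i j)).
by rewrite [(trb b y)^* * _]mulrC addrAC.
Qed.

(** [dbd_ddb] turns the conjugated contraction of [delbar del] into the [del delbar] form that it
    has in [tQ]. *)
Lemma Q_delta d d' : 2 * Q a b (delta_mx 0 d) (delta_mx 0 d') = tQ a ac b bc d d'.
Proof.
have dad k i j : da a (delta_mx 0 k) i j = a k i j by rewrite /da ev_delta.
have dbd' k i j : db b (delta_mx 0 k) i j = b k i j by rewrite /db ev_delta.
have pick (F : 'I_4 -> C) k : \sum_m F m * ((delta_mx 0 k : 'rV[C]_4) 0 m)^* = F k.
  rewrite (bigD1 k) //= big1 => [|m mk]; rewrite mxE ?eqxx ?rmorph1 ?mulr1 ?addr0 //=.
  by rewrite (negbTE mk) rmorph0 mulr0.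
rewrite /Q !pick /trb !ev_delta.
have c1 : contr a b (delta_mx 0 d) d' =
    \sum_l \sum_j (a d d' j * b j l l - a d l j * b j d' l).
  apply: eq_bigr => l _; rewrite /dbd /db /ev -sumrB; apply: eq_bigr => j _.
  by rewrite !mxE !dad.
have c2 : (contr a b (delta_mx 0 d') d)^* = -
    \sum_l \sum_j (bc d' j l * ac j l d + bc d' l j * b j l d - bc d' d j * b j l l).
  rewrite /contr conj_sum -sumrN; apply: eq_bigr => l _.
  rewrite J2 /ddb rmorphN /= conjB conjD !conjCK; congr (- _).
  rewrite /da /db /ev conj_sum -big_split -sumrB; apply: eq_bigr => j _ /=.
  by rewrite !mxE !dbd' conjM.
rewrite c1 c2 /tQ -conj_sum.
have -> : \sum_i \sum_j da a (delta_mx 0 d) i j * (da a (delta_mx 0 d') i j)^* =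
   \sum_i \sum_j a d i j * ac d' i j.
  by apply: eq_bigr => i _; apply: eq_bigr => j _; rewrite !dad.
have -> : \sum_i \sum_j db b (delta_mx 0 d) i j * (db b (delta_mx 0 d') i j)^* =
   \sum_i \sum_j b d i j * bc d' i j.
  by apply: eq_bigr => i _; apply: eq_bigr => j _; rewrite !dbd'.
by field.
Qed.

Lemma Q_eq0_delta : (forall d d', tQ a ac b bc d d' = 0) -> forall z y, Q a b z y = 0.
Proof.
move=> h.
have h0 d d' : Q a b (delta_mx 0 d) (delta_mx 0 d') = 0.
  have /eqP := Q_delta d d'; rewrite h mulf_eq0 pnatr_eq0 /= => /eqP //.
have Q0 y : Q a b 0 y = 0.
  by have := QP (-1) 0 0 y; rewrite scaler0 addr0 mulN1r addNr.
have QD y u v : Q a b (u + v) y = Q a b u y + Q a b v y.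
  by have := QP 1 u v y; rewrite scale1r mul1r.
have QZ y x u : Q a b (x *: u) y = x * Q a b u y.
  by have := QP x u 0 y; rewrite addr0 Q0 addr0.
have lin y : (forall d, Q a b (delta_mx 0 d) y = 0) -> forall z, Q a b z y = 0.
  move=> hy z; rewrite (row_sum_delta z).
  rewrite (big_morph (fun u => Q a b u y) (QD y) (Q0 y)) big1 // => j _.
  by rewrite QZ hy mulr0.
move=> z y; apply: (lin y) => d; rewrite Q_herm lin ?rmorph0 //.
Qed.

End QForm.

Lemma idem_factor (F : fieldType) r n (P : 'M[F]_n) (M : 'M[F]_(n, r)) (N : 'M[F]_(r, n)) :
  M *m N = P -> P *m P = P -> row_full M -> row_free N -> N *m M = 1%:M.
Proof.
move=> MN PP fM fN; apply: (row_free_inj fN); apply: (row_full_inj fM).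
by rewrite mul1mx -mulmxA MN mulmxA MN.
Qed.

(** * Hermitian metrics, unitary frames and the two implications *)

Section Main.
Variable C : numClosedFieldType.
Variables (I : C) (J : 'M[C]_8).
Local Notation V := 'rV[C]_8.
Hypotheses (i2 : I * I = -1) (IJ : I^* = - I) (JJ : J *m J = - 1%:M) (Jr : cj J = J).
Variable B : V -> V -> V.
Hypotheses (Bb : bilin B) (Ba : forall u, B u u = 0).
Hypothesis Bjac : forall x y z, B x (B y z) + B y (B z x) + B z (B x y) = 0.
Hypothesis Bcj : forall u v, B (cj u) (cj v) = cj (B u v).
Local Notation p10 := (p10 I J).
Local Notation p01 := (p01 I J).
Hypothesis Bint : forall u v, p01 (B (p10 u) (p10 v)) = 0.
Hypothesis Bnil : exists N, forall s x, size s = N -> foldr B x s = 0.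
Local Notation Pi := (Pi I J).
Local Notation fa := (fa B).
Local Notation fb := (fb B).

Let two0 : 2 != 0 :> C. Proof. by rewrite pnatr_eq0. Qed.

(* The rows of [E] are a basis of the (1,0)-vectors, and the columns of [W] the
   dual basis of (1,0)-forms. *)
Definition is_frame (E : 'M[C]_(4, 8)) (W : 'M[C]_(8, 4)) :=
  W *m E = Pi /\ E *m W = 1%:M.

Definition hform (h : 'M[C]_8) (u v : V) : C := (u *m J *m h *m v^T) 0 0.

Record is_hermitian (h : 'M[C]_8) : Prop := IsHermitian {
  herm_sym : h^T = h;
  herm_real : cj h = h;
  herm_J : J *m h *m J^T = h;
  herm_pos : forall u, p10 u = u -> u != 0 -> 0 < (u *m h *m (cj u)^T) 0 0 }.

Definition unitary (h : 'M[C]_8) (E : 'M[C]_(4, 8)) := E *m h *m (cj E)^T = 1%:M.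

Section Metric.
Variable h : 'M[C]_8.
Hypothesis hh : is_hermitian h.

Lemma hform_lin a u v w : hform h (a *: u + v) w = a * hform h u w + hform h v w.
Proof. by rewrite /hform !mulmxDl -!scalemxAl !mxE. Qed.

Lemma herm_hJ : h *m J^T = - (J *m h).
Proof. by rewrite -{2}(herm_J hh) !mulmxA JJ mulNmx mul1mx mulNmx opprK. Qed.

Lemma hform_skew u v : hform h u v = - hform h v u.
Proof.
have -> : hform h u v = ((u *m J *m h *m v^T)^T) 0 0 by rewrite [RHS]mxE.
rewrite !trmx_mul trmxK (herm_sym hh) /hform (mulmxA h) herm_hJ.
by rewrite mulNmx mulmxN !mulmxA mxE.
Qed.

Lemma hform_J u v : hform h (u *m J) (v *m J) = hform h u v.
Proof.
rewrite /hform trmx_mul -(mulmxA u J J) JJ mulmxN mulmx1 !mulNmx -(mulmxA u h).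
by rewrite (mulmxA h) herm_hJ mulNmx mulmxN opprK !mulmxA.
Qed.

Let half0 (x : C) : x = - x -> x = 0.
Proof.
move=> e; apply/eqP; have : x + x = 0 by rewrite {1}e addNr.
by rewrite -mulr2n -mulr_natl => /eqP; rewrite mulf_eq0 (negbTE two0).
Qed.

Let hformZ a b u v : hform h (a *: u) (b *: v) = a * b * hform h u v.
Proof. by rewrite /hform linearZ /= -!scalemxAl -scalemxAr !mxE mulrA. Qed.

(** Invariance under [J], which multiplies both arguments by [I], gives [F = I^2 F = - F]. *)
Lemma hform10 u v : hform h (p10 u) (p10 v) = 0.
Proof.
by apply: half0; rewrite -{1}hform_J !(projJ10 i2 JJ) hformZ i2 mulN1r.
Qed.

Lemma hform01 u v : hform h (p01 u) (p01 v) = 0.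
Proof.
by apply: half0; rewrite -{1}hform_J !(projJ01 i2 JJ) hformZ mulrNN i2 mulN1r.
Qed.

Section UnitaryFrame.
Variables (E : 'M[C]_(4, 8)) (W : 'M[C]_(8, 4)).
Hypotheses (EWf : is_frame E W) (Eu : unitary h E).
Local Notation a := (fa E W).
Local Notation b := (fb E W).
Local Notation ac := (fun k i j => (a k i j)^*).
Local Notation bc := (fun k i j => (b k i j)^*).

Lemma hform_frame i j : hform h (fe E i) (feb E j) = I * (i == j)%:R.
Proof.
have [WE EW] := EWf; rewrite /hform -(p10_fe WE EW) (projJ10 i2 JJ) (p10_fe WE EW).
rewrite -!scalemxAl mxE; congr (_ * _).
have := congr1 (fun M : 'M[C]_4 => M i j) Eu; rewrite [RHS]mxE => <-.
rewrite /fe /feb -!row_mul cj_row !mxE; apply: eq_bigr => k _.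
by rewrite !mxE.
Qed.

Lemma ddbar_iff : (forall X, fdel I J B (fdelbar I J B (sqform (hform h))) X = 0) <->
  (forall d d', tQ a ac b bc d d' = 0).
Proof.
have [WE EW] := EWf.
have I0 : I != 0.
  by apply/eqP=> I0; move/eqP: i2; rewrite I0 mul0r eq_sym oppr_eq0 oner_eq0.
have key := @ddbar_frame C 8 I J i2 JJ B Bb Ba (hform h) hform_lin hform_skew
  hform10 hform01 (fe E) (feb E) a b I I0 (p10_fe WE EW) (p01_feb IJ Jr WE EW)
  (fun z => ex_intro _ _ (p10_W WE z)) (fun z => ex_intro _ _ (p01_W IJ Jr WE z))
  hform_frame (fBee Bint WE EW) (fBbb Bcj Bint WE EW) (fBeb IJ Jr Bb Ba Bcj WE).
have ibp := table_int_by_parts IJ Jr Bb Ba Bcj Bint Bnil WE EW.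
rewrite key; split=> H d d'.
  by have := ibp d d'; rewrite H !mulr0 => /eqP; rewrite eq_sym oppr_eq0 => /eqP.
have := ibp d d'; rewrite H oppr0 => /eqP; rewrite !mulf_eq0 (negbTE two0) /=.
by rewrite expf_eq0 oppr_eq0 oner_eq0 andbF /= => /eqP.
Qed.

Lemma unitary_tableP :
  (forall X, fdel I J B (fdelbar I J B (sqform (hform h))) X = 0) -> tableP a b.
Proof.
have [WE EW] := EWf; rewrite ddbar_iff => H.
have J2 := table_dbd_ddb IJ Jr Bb Ba Bjac Bcj Bint WE EW.
split.
- exact: fa_skew.
- exact: (table_dbar2 IJ Jr Bb Ba Bjac Bcj Bint WE EW).
- exact: J2.
- exact: (table_engel IJ Jr Bb Ba Bcj Bint Bnil WE EW).
- exact: Q_eq0_delta.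
Qed.

End UnitaryFrame.
End Metric.

Lemma cj_Pi : cj Pi = 1%:M - Pi.
Proof.
apply/row_matrixP=> i; rewrite -cj_row !rowE mulmxBr mulmx1 -p10E.
rewrite -(p01_cj IJ Jr) /cj map_delta_mx -/(cj _).
by rewrite -[X in _ = X - _](proj_sum I J two0) addrAC subrr add0r.
Qed.

(** Conjugation exchanges the complementary idempotents [Pi] and [1 - Pi], so both have half of the
    rank 8. *)
Lemma rank_Pi : \rank Pi = 4%N.
Proof.
have r1 : \rank (1%:M - Pi) = \rank Pi by rewrite -cj_Pi mxrank_map.
have le8 : (\rank Pi + \rank (1%:M - Pi)%R <= 8)%N.
  by apply: mulmx0_rank_max; rewrite mulmxBr mulmx1 (Pi_idem i2 JJ) subrr.
have ge8 : (8 <= \rank Pi + \rank (1%:M - Pi)%R)%N.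
  have := mxrank_add Pi (1%:M - Pi).
  by rewrite addrC subrK mxrank1.
move: le8 ge8; rewrite r1; lia.
Qed.

Lemma frame_exists : exists E W, is_frame E W.
Proof.
have : exists (E : 'M[C]_(\rank Pi, 8)) (W : 'M[C]_(8, \rank Pi)), W *m E = Pi /\ E *m W = 1%:M.
  exists (row_base Pi), (col_base Pi); split; first exact: mulmx_base.
  apply: (idem_factor (mulmx_base Pi) (Pi_idem i2 JJ) (col_base_full Pi) (row_base_free Pi)).
by rewrite rank_Pi.
Qed.

Lemma frame_row_p10 E W (x : 'rV[C]_4) : is_frame E W -> p10 (x *m E) = x *m E.
Proof. by move=> [WE EW]; rewrite p10E -WE mulmxA -(mulmxA x) EW mulmx1. Qed.

Lemma unitary_frame_exists h : is_hermitian h -> exists E W, is_frame E W /\ unitary h E.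
Proof.
move=> hh; have [E [W EWf]] := frame_exists; have [WE EW] := EWf.
have [||P Pu PG] := @unitary_diag C (E *m h *m (cj E)^T).
- by rewrite !cjM cj_tr cjK (herm_real hh) !trmx_mul trmxK (herm_sym hh) mulmxA.
- move=> x x0; have := herm_pos hh (frame_row_p10 x EWf).
  rewrite cjM trmx_mul !mulmxA; apply.
  by apply: contra_neq x0 => e; rewrite -[x]mulmx1 -EW mulmxA e mul0mx.
exists (P *m E), (W *m invmx P); split; last first.
  by rewrite /unitary -[RHS]PG cjM trmx_mul !mulmxA.
split; first by rewrite mulmxA mulmxKV.
by rewrite mulmxA -(mulmxA P) EW mulmx1 mulmxV.
Qed.

(** The coframe is transformed by [U], so the dual frame by the inverse transpose, which is
    [cj U]. *)
Lemma unitary_change h E W U : is_frame E W -> unitary h E -> U *m (cj U)^T = 1%:M ->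
  is_frame (cj U *m E) (W *m U^T) /\ unitary h (cj U *m E).
Proof.
move=> [WE EW] Eu UU.
have UU1 : cj U *m U^T = 1%:M by rewrite -(cj1 C 4) -UU cjM cj_tr cjK.
have UU2 : U^T *m cj U = 1%:M by rewrite (mulmx1C UU1).
split; first split.
- by rewrite mulmxA -(mulmxA W) UU2 mulmx1.
- by rewrite mulmxA -(mulmxA (cj U)) EW mulmx1.
- by rewrite /unitary cjM cjK trmx_mul !mulmxA -(mulmxA (cj U)) -(mulmxA (cj U)) Eu mulmx1.
Qed.

(** [unitary_kernel] is applied to the vector of traces: three forms of the new coframe have zero
    trace, hence are closed because L is everything. The tables are then rebuilt in that coframe. *)
Theorem astheno_structure h : is_hermitian h ->
  (forall X, fdel I J B (fdelbar I J B (sqform (hform h))) X = 0) ->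
  exists E W, [/\ is_frame E W, forall k, k != ord_max -> forall u v, (B u v *m W) 0 k = 0,
    [/\ forall i, fb E W ord_max i ord_max = 0, forall j, fb E W ord_max ord_max j = 0
      & forall i, fa E W ord_max i ord_max = 0] &
    2^-1 * \sum_i \sum_j fa E W ord_max i j * (fa E W ord_max i j)^*
    + \sum_i \sum_j fb E W ord_max i j * (fb E W ord_max i j)^*
    = (\sum_i fb E W ord_max i i) * (\sum_i fb E W ord_max i i)^*].
Proof.
move=> hh H; have [E [W [EWf Eu]]] := unitary_frame_exists hh.
have TP := unitary_tableP hh EWf Eu H.
have [U UU Uk] := unitary_kernel (\col_k \sum_i fb E W k i i).
have [EWf' Eu'] := unitary_change EWf Eu UU.
have TP' := unitary_tableP hh EWf' Eu' H.
set E' := cj U *m E in EWf' Eu' TP' *; set W' := W *m U^T in EWf' TP' *.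
have [WE EW] := EWf; have [WE' EW'] := EWf'.
have fnU k v : fn W' (delta_mx 0 k) v = fn W (row k U) v.
  by rewrite /fn /W' rowE trmx_mul !mulmxA.
have cl k : k != ord_max -> dclosed (fa E' W') (fb E' W') (delta_mx 0 k).
  move=> nk; apply/(closed_fn IJ Jr Bb Ba Bcj Bint WE' EW') => u v; rewrite fnU.
  move: u v; apply/(closed_fn IJ Jr Bb Ba Bcj Bint WE EW).
  apply: (L_trb0_closed TP); first exact: (all_Lform TP).
  have := congr1 (fun M : 'M[C]_1 => M 0 0) (Uk k nk); rewrite [RHS]mxE => <-.
  by rewrite mxE; apply: eq_bigr => j _; rewrite [(\col__ _) _ _]mxE.
exists E', W'; split=> //.
- move=> k nk u v; have := cl k nk.
  move/(closed_fn IJ Jr Bb Ba Bcj Bint WE' EW')/(_ u v).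
  by rewrite /fn trmx_delta -colE mxE.
- exact: (adapted_zero TP' cl).
- exact: (adapted_T TP' cl).
Qed.

Definition frame_metric (W : 'M[C]_(8, 4)) : 'M[C]_8 := W *m (cj W)^T + cj W *m W^T.

Lemma frame_metricP E W : is_frame E W ->
  is_hermitian (frame_metric W) /\ unitary (frame_metric W) E.
Proof.
move=> EWf; have [WE EW] := EWf.
have PW : Pi *m W = W by rewrite -WE -mulmxA EW mulmx1.
have JW : J *m W = I *: W.
  have JP : J *m Pi = I *: Pi.
    apply/row_matrixP=> i; rewrite row_mul rowE -mulmxA.
    have -> : row i (I *: Pi) = I *: (delta_mx 0 i *m Pi) by rewrite rowE -scalemxAr.
    rewrite -p10E -(projJ10 i2 JJ) p10E /Pi -!mulmxA; congr (_ *m _).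
    by rewrite -scalemxAr -scalemxAl mulmxBr mulmxBl mulmx1 mul1mx -scalemxAr -scalemxAl.
  by rewrite -{1}PW mulmxA JP -scalemxAl PW.
have JcW : J *m cj W = - I *: cj W by rewrite -{1}Jr -cjM JW cjZ IJ.
have uc u : p10 u = u -> u *m cj W = 0.
  move=> pu; rewrite -[u]cjK -cjM -pu -(p01_cj IJ Jr).
  by rewrite (W_p01 WE EW) cj0.
split; first split.
- by rewrite /frame_metric linearD /= !trmx_mul !trmxK addrC.
- by rewrite /frame_metric cjD !cjM !cj_tr !cjK addrC.
- rewrite /frame_metric mulmxDr !mulmxA JW JcW mulmxDl -!mulmxA -!trmx_mul JW JcW.
  have trZ (x : C) (M : 'M[C]_(8, 4)) : (x *: M)^T = x *: M^T.
    by apply/matrixP=> i j; rewrite !mxE.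
  by rewrite !trZ -!scalemxAl -!scalemxAr !scalerA mulrN mulNr i2 opprK !scale1r.
- move=> u pu u0; rewrite /frame_metric mulmxDr mulmxDl !mulmxA (uc _ pu) !mul0mx addr0.
  rewrite -mulmxA -trmx_mul -cjM mxE.
  have nz : u *m W != 0.
    by apply: contra_neq u0 => e; rewrite -pu p10E -WE mulmxA e mul0mx.
  have [k hk] : exists k, (u *m W) 0 k != 0.
    apply/existsP; apply: contraR nz; rewrite negb_exists => /forallP hk.
    by apply/eqP/rowP=> k; have := hk k; rewrite negbK => /eqP ->; rewrite mxE.
  rewrite (bigD1 k) //= ltr_wpDr //; first apply: sumr_ge0 => i _.
    by rewrite [(_^T) _ _]mxE cjE -normCK exprn_ge0.
  by rewrite [(_^T) _ _]mxE cjE -normCK exprn_gt0 // normr_gt0.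
- have Ec : E *m cj W = 0.
    apply/row_matrixP=> i; rewrite row_mul row0; apply: uc.
    exact: (p10_fe WE EW).
  by rewrite /unitary /frame_metric mulmxDr mulmxDl !mulmxA EW mul1mx Ec !mul0mx addr0
    -trmx_mul -cjM EW cj1 trmx1.
Qed.

Theorem structure_astheno E W : is_frame E W ->
  (forall k, k != ord_max -> forall i j, fa E W k i j = 0) ->
  (forall k, k != ord_max -> forall i j, fb E W k i j = 0) ->
  (forall i, fb E W ord_max i ord_max = 0) -> (forall j, fb E W ord_max ord_max j = 0) ->
  (forall i, fa E W ord_max i ord_max = 0) ->
  2^-1 * \sum_i \sum_j fa E W ord_max i j * (fa E W ord_max i j)^*
    + \sum_i \sum_j fb E W ord_max i j * (fb E W ord_max i j)^*
    = (\sum_i fb E W ord_max i i) * (\sum_i fb E W ord_max i i)^* ->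
  forall X, fdel I J B (fdelbar I J B (sqform (hform (frame_metric W)))) X = 0.
Proof.
move=> EWf a0 b0 b1 b2 a1 T; have [hh Eu] := frame_metricP EWf.
apply/(ddbar_iff hh EWf Eu) => d d'.
set a := fa E W in a0 a1 T *; set b := fb E W in b0 b1 b2 T *.
have a2 i : a ord_max ord_max i = 0 by rewrite /a fa_skew // -/a a1 oppr0.
have bl k i : b k i ord_max = 0 by have [->|nk] := eqVneq k ord_max; rewrite ?b1 ?b0.
have bm k j : b k ord_max j = 0 by have [->|nk] := eqVneq k ord_max; rewrite ?b2 ?b0.
have al k i : a k i ord_max = 0 by have [->|nk] := eqVneq k ord_max; rewrite ?a1 ?a0.
have am k j : a k ord_max j = 0 by have [->|nk] := eqVneq k ord_max; rewrite ?a2 ?a0.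
(* Each product in the contraction terms has an inner index [j]: if it is the last one, a factor of
   [d w^4] involving [w^4] or its conjugate is 0; otherwise a coefficient of the closed form [w^j]
   is. *)
have s4 : \sum_l \sum_j (a d d' j * b j l l - a d l j * b j d' l) = 0.
  rewrite big1 // => l _; rewrite big1 // => j _.
  have [->|nj] := eqVneq j ord_max; first by rewrite !al !mul0r subrr.
  by rewrite !b0 // !mulr0 subrr.
have s5 : \sum_l \sum_j ((b d' j l)^* * (a j l d)^* + (b d' l j)^* * b j l d -
    (b d' d j)^* * b j l l) = 0.
  rewrite big1 // => l _; rewrite big1 // => j _.
  have [->|nj] := eqVneq j ord_max; first by rewrite !bl bm rmorph0 !mul0r subr0 addr0.
  by rewrite !(b0 j) // a0 // rmorph0 !mulr0 subr0 addr0.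
rewrite /tQ s4 s5 !mulr0 subr0 addr0.
have z1 (F : 'I_4 -> 'I_4 -> C) : (forall i j, F i j = 0) -> \sum_i \sum_j F i j = 0.
  by move=> hF; rewrite big1 // => i _; rewrite big1.
have [ed|nd] := eqVneq d ord_max; last first.
  rewrite z1 => [|i j]; last by rewrite a0 // mul0r.
  rewrite z1 => [|i j]; last by rewrite b0 // mul0r.
  by rewrite [\sum_i b d i i]big1 => [|i _]; rewrite ?b0 // mul0r !mulr0 subr0 addr0.
have [ed'|nd] := eqVneq d' ord_max; last first.
  rewrite z1 => [|i j]; last by rewrite (a0 d') // rmorph0 mulr0.
  rewrite z1 => [|i j]; last by rewrite (b0 d') // rmorph0 mulr0.
  by rewrite [\sum_i (b d' i i)^*]big1 => [|i _]; rewrite ?b0 ?rmorph0 // !mulr0 subr0 addr0.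
by rewrite ed ed' -conj_sum -T; field.
Qed.

End Main.

(** * From tables in four indices to 3x3 coefficient matrices *)

Section Coefficients.
Variable C : numClosedFieldType.

Local Notation up := (lift (ord_max : 'I_4)).

Lemma sum_up (F : 'I_4 -> C) : \sum_i F i = \sum_(j < 3) F (up j) + F ord_max.
Proof.
rewrite big_ord_recr /=; congr (_ + _); apply: eq_bigr => j _; congr F.
by apply: val_inj; rewrite /= /bump leqNgt ltn_ord.
Qed.

Lemma sum3 (F : 'I_3 -> C) : \sum_j F j = F t0 + F t1 + F t2.
Proof.
rewrite !big_ord_recl big_ord0 /= addr0 !addrA.
by congr (F _ + F _ + F _); apply: val_inj.
Qed.

Lemma sum_lt3 (F : 'I_3 -> 'I_3 -> C) :
  \sum_(j < 3) \sum_(k < 3 | (j < k)%N) F j k = F t0 t1 + F t0 t2 + F t1 t2.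
Proof.
under eq_bigr => j _ do rewrite big_mkcond.
by rewrite !sum3 /=; ring.
Qed.

(** Passes from the full skew sums of the tables, with their factor 1/2, to the sums over [j < k] of
    the structure equations. *)
Lemma skew_half_sum (a x : 'I_4 -> 'I_4 -> C) :
  (forall i j, a i j = - a j i) -> (forall i j, x i j = - x j i) ->
  (forall i, a i ord_max = 0) ->
  2^-1 * \sum_i \sum_j a i j * x i j =
  \sum_(j < 3) \sum_(k < 3 | (j < k)%N) a (up j) (up k) * x (up j) (up k).
Proof.
move=> sa sx am.
have az i : a i i = 0.
  have /eqP := sa i i; rewrite -addr_eq0 -mulr2n -mulr_natl mulf_eq0 pnatr_eq0 /=.
  by move/eqP.
have am' i : a ord_max i = 0 by rewrite sa am oppr0.
under eq_bigr => i _ do rewrite sum_up am mul0r addr0.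
rewrite sum_up; under [X in _ + X]eq_bigr => j _ do rewrite am' mul0r.
rewrite [X in _ + X]big1 // addr0 sum_lt3 !sum3 !az.
rewrite (sa (up t1) (up t0)) (sa (up t2) (up t0)) (sa (up t2) (up t1)).
rewrite (sx (up t1) (up t0)) (sx (up t2) (up t0)) (sx (up t2) (up t1)).
by field.
Qed.

Lemma sum_up2 (b : 'I_4 -> 'I_4 -> C) : (forall i, b i ord_max = 0) ->
  (forall j, b ord_max j = 0) ->
  \sum_i \sum_j b i j = \sum_(j < 3) \sum_(k < 3) b (up j) (up k).
Proof.
move=> b1 b2; rewrite sum_up [X in _ + X]big1 // addr0; apply: eq_bigr => j _.
by rewrite sum_up b1 addr0.
Qed.

Definition torsion (A B : 'M[C]_3) : C :=
  \sum_(j < 3) \sum_(k < 3 | (j < k)%N) `|A j k| ^+ 2 +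
  \sum_(j < 3) \sum_(k < 3) `|B j k| ^+ 2 - `|\sum_(j < 3) B j j| ^+ 2.

Lemma torsion_table (a b : 'I_4 -> 'I_4 -> C) (A B : 'M[C]_3) :
  (forall i j, a i j = - a j i) -> (forall i, a i ord_max = 0) ->
  (forall i, b i ord_max = 0) -> (forall j, b ord_max j = 0) ->
  (forall j k : 'I_3, (j < k)%N -> A j k = a (up j) (up k)) ->
  (forall j k, B j k = b (up j) (up k)) ->
  torsion A B = 2^-1 * \sum_i \sum_j a i j * (a i j)^* + \sum_i \sum_j b i j * (b i j)^*
   - (\sum_i b i i) * (\sum_i b i i)^*.
Proof.
move=> sa am b1 b2 eA eB; rewrite /torsion; congr (_ + _ - _).
- rewrite (@skew_half_sum _ (fun i j => (a i j)^*)) //.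
    by apply: eq_bigr => j _; apply: eq_bigr => k jk; rewrite normCK eA.
  by move=> i j; rewrite sa rmorphN.
- rewrite (@sum_up2 (fun i j => b i j * (b i j)^*)).
  + by apply: eq_bigr => j _; apply: eq_bigr => k _; rewrite normCK eB.
  + by move=> i; rewrite b1 mul0r.
  + by move=> j; rewrite b2 mul0r.
- rewrite normCK [\sum_i b i i]sum_up b1 addr0.
  by have -> : \sum_(j < 3) B j j = \sum_(j < 3) b (up j) (up j) by apply: eq_bigr.
Qed.

End Coefficients.

Section Structure.
Variable C : numClosedFieldType.
Variables (I : C) (J : 'M[C]_8).
Local Notation V := 'rV[C]_8.
Hypotheses (i2 : I * I = -1) (IJ : I^* = - I) (JJ : J *m J = - 1%:M) (Jr : cj J = J).
Variable B : V -> V -> V.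
Hypotheses (Bb : bilin B) (Ba : forall u, B u u = 0).
Hypothesis Bjac : forall x y z, B x (B y z) + B y (B z x) + B z (B x y) = 0.
Hypothesis Bcj : forall u v, B (cj u) (cj v) = cj (B u v).
Hypothesis Bint : forall u v, p01 I J (B (p10 I J u) (p10 I J v)) = 0.
Hypothesis Bnil : exists N, forall s x, size s = N -> foldr B x s = 0.
Local Notation up := (lift (ord_max : 'I_4)).

(* The values at [u] of the [k]-th form of the coframe and of its conjugate. *)
Definition cw (W : 'M[C]_(8, 4)) (u : V) k : C := (u *m W) 0 k.
Definition cwb (W : 'M[C]_(8, 4)) (u : V) k : C := ((cj u *m W) 0 k)^*.

Definition structure_eq (W : 'M[C]_(8, 4)) (A D : 'M[C]_3) := forall u v,
  - cw W (B u v) ord_max =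
  \sum_(j < 3) \sum_(k < 3 | (j < k)%N)
    A j k * (cw W u (up j) * cw W v (up k) - cw W v (up j) * cw W u (up k)) +
  \sum_(j < 3) \sum_(k < 3)
    D j k * (cw W u (up j) * cwb W v (up k) - cw W v (up j) * cwb W u (up k)).

Theorem astheno_coframe h : is_hermitian I J h ->
  (forall X, fdel I J B (fdelbar I J B (sqform (hform J h))) X = 0) ->
  exists E W A D, [/\ is_frame I J E W, forall j u v, cw W (B u v) (up j) = 0,
    structure_eq W A D & torsion A D = 0].
Proof.
move=> hh H.
have [E [W [EWf cl [b1 b2 a1] T]]] := astheno_structure i2 IJ JJ Jr Bb Ba Bjac Bcj Bint Bnil hh H.
have [WE EW] := EWf.
have sa k i j := fa_skew Bb Ba E W k i j.
exists E, W, (\matrix_(j, k) fa B E W ord_max (up j) (up k)),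
  (\matrix_(j, k) fb B E W ord_max (up j) (up k)); split=> //.
- by move=> j u v; apply: cl; rewrite eq_sym neq_lift.
- move=> u v; rewrite /cw (dw_expand IJ Jr Bb Ba Bcj Bint WE EW).
  rewrite (@skew_half_sum _ _ (fun i j => (u *m W) 0 i * (v *m W) 0 j - (v *m W) 0 i * (u *m W) 0 j)) //; last first.
    by move=> i j; ring.
  rewrite (@sum_up2 _ (fun i j => fb B E W ord_max i j * _)).
  + congr (_ + _); apply: eq_bigr => j _; apply: eq_bigr => k _; rewrite [(\matrix_(_, _) _) j k]mxE //.
  + by move=> i; rewrite b1 mul0r.
  + by move=> j; rewrite b2 mul0r.
- rewrite (@torsion_table _ (fa B E W ord_max) (fb B E W ord_max)) // => [|j k _|j k].
  + by rewrite T subrr.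
  + by rewrite mxE.
  + by rewrite mxE.
Qed.

Theorem coframe_astheno E W A D : is_frame I J E W ->
  (forall j u v, cw W (B u v) (up j) = 0) -> structure_eq W A D -> torsion A D = 0 ->
  forall X, fdel I J B (fdelbar I J B (sqform (hform J (frame_metric W)))) X = 0.
Proof.
move=> EWf cl st T; have [WE EW] := EWf.
have upP k : k != ord_max -> exists j, k = up j.
  by case: (unliftP (ord_max : 'I_4) k) => [j ->|->]; [exists j|rewrite eqxx].
have cwe i k : cw W (fe E i) k = (i == k)%:R.
  by rewrite /cw /fe -row_mul EW !mxE.
have cwbe i k : cwb W (fe E i) k = 0.
  rewrite /cwb; have -> : cj (fe E i) *m W = 0; last by rewrite mxE rmorph0.
  by rewrite -/(feb E i) -(p01_feb IJ Jr WE EW) (W_p01 WE EW).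
have cweb i k : cw W (feb E i) k = 0.
  by rewrite /cw -(p01_feb IJ Jr WE EW) (W_p01 WE EW) mxE.
have cwbeb i k : cwb W (feb E i) k = (i == k)%:R.
  by rewrite /cwb /feb cjK -/(cw W (fe E i) k) cwe rmorph_nat.
have um j : (ord_max == up j :> 'I_4) = false by rewrite (negbTE (neq_lift _ _)).
have uu (j k : 'I_3) : (up j == up k) = (j == k) by exact: (inj_eq lift_inj).
(* The structure equation is evaluated on pairs of frame vectors, which returns the tables [fa] and
   [fb] in terms of [A] and [D]. *)
have faE i j : fa B E W ord_max i j = \sum_(p < 3) \sum_(q < 3 | (p < q)%N)
    A p q * ((i == up p)%:R * (j == up q)%:R - (j == up p)%:R * (i == up q)%:R).
  rewrite /fa -/(cw _ _ _) st [X in _ + X]big1 ?addr0.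
    by apply: eq_bigr => p _; apply: eq_bigr => q _; rewrite !cwe.
  by move=> p _; rewrite big1 // => q _; rewrite !cwbe !mulr0 subrr mulr0.
have fbE i j : fb B E W ord_max i j = \sum_(p < 3) \sum_(q < 3)
    D p q * ((i == up p)%:R * (j == up q)%:R).
  rewrite /fb -/(cw _ _ _) st [X in X + _]big1 ?add0r.
    apply: eq_bigr => p _; apply: eq_bigr => q _.
    by rewrite !cwe !cwbeb !cweb mul0r subr0.
  by move=> p _; rewrite big1 // => q _; rewrite !cweb !mul0r mulr0 subrr mulr0.
have b1 i : fb B E W ord_max i ord_max = 0.
  by rewrite fbE big1 // => p _; rewrite big1 // => q _; rewrite um !mulr0.
have b2 j : fb B E W ord_max ord_max j = 0.
  by rewrite fbE big1 // => p _; rewrite big1 // => q _; rewrite um mul0r mulr0.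
have a1 i : fa B E W ord_max i ord_max = 0.
  by rewrite faE big1 // => p _; rewrite big1 // => q _; rewrite !um mul0r mulr0 subrr mulr0.
apply: (structure_astheno i2 IJ JJ Jr Bb Ba Bcj Bint Bnil EWf) => //.
- by move=> k /upP[p ->] i j; rewrite /fa -/(cw _ _ _) cl oppr0.
- by move=> k /upP[p ->] i j; rewrite /fb -/(cw _ _ _) cl oppr0.
have := @torsion_table _ (fa B E W ord_max) (fb B E W ord_max) A D.
rewrite T => H; apply/eqP; rewrite -subr_eq0 -H //.
- exact: fa_skew.
- move=> j k jk; rewrite faE; move: j k jk.
  have E3 (j : 'I_3) : [\/ j = t0, j = t1 | j = t2].
    by case: j => [[|[|[|//]]] ltj]; [constructor 1|constructor 2|constructor 3]; apply: val_inj.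
  move=> j k; rewrite sum_lt3 !uu.
  by case: (E3 j) => ->; case: (E3 k) => -> //= _; ring.
- move=> j k; rewrite fbE (bigD1 j) //= (bigD1 k) //= !uu !eqxx mulr1 mulr1.
  rewrite big1 => [|q nq]; last by rewrite uu eq_sym (negbTE nq) !mulr0.
  rewrite addr0 big1 ?addr0 // => p np; rewrite big1 // => q _.
  by rewrite uu eq_sym (negbTE np) mul0r mulr0.
Qed.

End Structure.

(** * Wedge products *)

Section PermSum.
Variable C : numFieldType.

(** A permutation is determined by the image of 0 and the permutation induced on the rest; iterating
    this enumerates ['S_2] and ['S_4] explicitly. *)
Lemma sum_perm_lift n (phi : 'S_n.+1 -> C) :
  \sum_s phi s = \sum_i \sum_(t : 'S_n) phi (lift_perm ord0 i t).
Proof.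
rewrite pair_big /= (reindex (fun p : 'I_n.+1 * 'S_n => lift_perm ord0 p.1 p.2)) //=.
apply: onW_bij; apply: inj_card_bij => [[i s] [j t] /= e|].
  have ij : i = j by rewrite -(lift_perm_id ord0 i s) e lift_perm_id.
  rewrite -ij in e *; congr pair; apply/permP=> k; apply: (@lift_inj _ i).
  by rewrite -!(lift_perm_lift ord0) e.
by rewrite card_prod card_ord !card_Sn factS.
Qed.

Lemma sum_perm0 (phi : 'S_0 -> C) : \sum_s phi s = phi 1%g.
Proof. by rewrite (bigD1 1%g) //= big1 ?addr0 // => s /eqP []; apply/permP=> -[]. Qed.

Lemma sign_lift n i (t : 'S_n) : (-1) ^+ (lift_perm ord0 i t) = (-1) ^+ i * (-1) ^+ t :> C.
Proof. by rewrite odd_lift_perm /= signr_addb signr_odd. Qed.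

Lemma sum_perm2 (phi : 'I_2 -> 'I_2 -> C) :
  \sum_(s : 'S_2) (-1) ^+ s * phi (s ord0) (s (lift ord0 ord0)) =
  phi ord0 (lift ord0 ord0) - phi (lift ord0 ord0) ord0.
Proof.
rewrite sum_perm_lift; under eq_bigr => i _.
  rewrite sum_perm_lift; under eq_bigr => j _.
    rewrite sum_perm0 !sign_lift odd_perm1 expr0 mulr1 lift_perm_lift !lift_perm_id.
    over.
  over.
rewrite !big_ord_recl !big_ord0 /= !addr0 expr0 !mul1r expr1 mulr1 mulN1r.
by congr (phi _ _ - phi _ _); apply: val_inj.
Qed.

Lemma sum_perm4 (phi : 'I_4 -> 'I_4 -> 'I_4 -> 'I_4 -> C) :
  \sum_(s : 'S_4) (-1) ^+ s *
    phi (s ord0) (s (lift ord0 ord0)) (s (lift ord0 (lift ord0 ord0)))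
      (s (lift ord0 (lift ord0 (lift ord0 ord0)))) =
  \sum_(i < 4) \sum_(j < 3) \sum_(k < 2) (-1) ^+ (i + j + k) *
    phi i (lift i j) (lift i (lift j k)) (lift i (lift j (lift k ord0))).
Proof.
rewrite sum_perm_lift; apply: eq_bigr => i _.
rewrite sum_perm_lift; apply: eq_bigr => j _.
rewrite sum_perm_lift; apply: eq_bigr => k _.
rewrite sum_perm_lift big_ord1 sum_perm0 !sign_lift odd_perm1 !lift_perm_lift !lift_perm_id.
by rewrite !expr0 !mulr1 mulrA -!exprD.
Qed.

Variable m : nat.
Local Notation V := 'rV[C]_m.

Definition fwedge p q (f : mform C m p) (g : mform C m q) : mform C m (p + q) :=
  fun X => ((p`! * q`!)%N%:R)^-1 *
    \sum_(s : 'S_(p + q)) (-1) ^+ s *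
      (f (fun j => X (s (lshift q j))) * g (fun j => X (s (rshift p j)))).

Lemma fwedge11 (f g : V -> C) X :
  fwedge (fun Y : 'I_1 -> V => f (Y 0)) (fun Y : 'I_1 -> V => g (Y 0)) X =
  f (X 0) * g (X 1) - f (X 1) * g (X 0).
Proof.
rewrite /fwedge invr1 mul1r.
have -> : lshift 1 (0 : 'I_1) = ord0 by apply: val_inj.
have -> : rshift 1 (0 : 'I_1) = lift ord0 ord0 by apply: val_inj.
rewrite (sum_perm2 (fun i j => f (X i) * g (X j))).
have -> : lift (ord0 : 'I_2) ord0 = 1 by apply: val_inj.
by [].
Qed.

Variable F : V -> V -> C.
Hypothesis Fs : forall u v, F u v = - F v u.

Lemma fwedge_pow1 X : fwedge (form2 F) (fun _ : 'I_0 -> V => 1) X = form2 F X.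
Proof.
rewrite /fwedge /form2; under eq_bigr => s _ do rewrite mulr1.
have -> : lshift 0 (0 : 'I_2) = ord0 by apply: val_inj.
have -> : lshift 0 (1 : 'I_2) = lift ord0 ord0 by apply: val_inj.
rewrite (sum_perm2 (fun i j => F (X i) (X j))).
have -> : lift (ord0 : 'I_2) ord0 = 1 by apply: val_inj.
rewrite (Fs (X 1)) opprK (_ : (2`! * 0`!)%:R = 2) //.
by rewrite (_ : ord0 = 0 :> 'I_2) //; field.
Qed.

(** Each of the three pairings of four arguments arises from 8 of the 24 permutations, and division
    by [2! 2!] leaves the factor 2 of [sqform]. *)
Lemma fwedge_square g X : (forall Y, g Y = form2 F Y) -> fwedge (form2 F) g X = sqform F X.
Proof.
move=> gE; rewrite /fwedge /form2; under eq_bigr => s _ do rewrite gE /form2.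
pose G (i j : nat) := F (X (inord i)) (X (inord j)).
have -> : lshift 2 (0 : 'I_2) = ord0 by apply: val_inj.
have -> : lshift 2 (1 : 'I_2) = lift ord0 ord0 by apply: val_inj.
have -> : rshift 2 (0 : 'I_2) = lift ord0 (lift ord0 ord0) by apply: val_inj.
have -> : rshift 2 (1 : 'I_2) = lift ord0 (lift ord0 (lift ord0 ord0)) by apply: val_inj.
have GE (i j : 'I_4) : F (X i) (X j) = G i j by rewrite /G !inord_val.
rewrite (sum_perm4 (fun i j k l => F (X i) (X j) * F (X k) (X l))).
under eq_bigr => i _ do under eq_bigr => j _ do under eq_bigr => k _ do rewrite !GE.
rewrite /sqform -!/(G _ _).
have Gs i j : G i j = - G j i by apply: Fs.
rewrite !big_ord_recl !big_ord0 /= /bump /=.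
rewrite (_ : (2`! * 2`!)%:R = 4) // !(add0n, addn0, add1n, addSn).
rewrite (Gs 1 0)%N (Gs 2 0)%N (Gs 3 0)%N (Gs 2 1)%N (Gs 3 1)%N (Gs 3 2)%N.
by field.
Qed.

End PermSum.

(** * Complexification *)

Section Complexification.
Variables (R : realType) (C : numClosedFieldType) (inj : {rmorphism R -> C}).
Variables (re im : C -> R) (I : C).
Hypothesis cE : forall z, z = inj (re z) + I * inj (im z).
Hypothesis reE : forall a b, re (inj a + I * inj b) = a.
Hypothesis imE : forall a b, im (inj a + I * inj b) = b.
Hypotheses (i2 : I * I = -1) (IJ : I^* = - I) (injJ : forall a, (inj a)^* = inj a).

Let two0 : 2 != 0 :> C. Proof. by rewrite pnatr_eq0. Qed.

Lemma re_imD z w : re (z + w) = re z + re w /\ im (z + w) = im z + im w.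
Proof.
have -> : z + w = inj (re z + re w) + I * inj (im z + im w).
  by rewrite {1}(cE z) {1}(cE w) !rmorphD; ring.
by rewrite reE imE.
Qed.

Lemma re_imM z w :
  re (z * w) = re z * re w - im z * im w /\ im (z * w) = re z * im w + im z * re w.
Proof.
have -> : z * w = inj (re z * re w - im z * im w) + I * inj (re z * im w + im z * re w).
  rewrite {1}(cE z) {1}(cE w) rmorphB rmorphD !rmorphM /=.
  set a := inj _; set b := inj _; set c := inj _; set d := inj _.
  transitivity (a * c + I * I * (b * d) + I * (a * d + b * c)); first by ring.
  by rewrite i2; ring.
by rewrite reE imE.
Qed.

Lemma re_imJ z : re z^* = re z /\ im z^* = - im z.
Proof.
have -> : z^* = inj (re z) + I * inj (- im z).
  by rewrite {1}(cE z) conjD conjM !injJ IJ rmorphN mulrN mulNr.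
by rewrite reE imE.
Qed.

Section Rows.
Variables (p q : nat).
Implicit Types (x y : 'M[R]_(p, q)) (z w : 'M[C]_(p, q)).

Definition cx p q (x : 'M[R]_(p, q)) : 'M[C]_(p, q) := map_mx inj x.
Definition rx z : 'M[R]_(p, q) := map_mx re z.
Definition ix z : 'M[R]_(p, q) := map_mx im z.

Lemma cxE z : z = cx (rx z) + I *: cx (ix z).
Proof. by apply/matrixP=> i j; rewrite !mxE -cE. Qed.

Lemma rx_cx x y : rx (cx x + I *: cx y) = x.
Proof. by apply/matrixP=> i j; rewrite !mxE reE. Qed.
Lemma ix_cx x y : ix (cx x + I *: cx y) = y.
Proof. by apply/matrixP=> i j; rewrite !mxE imE. Qed.

Lemma cxD x y : cx (x + y) = cx x + cx y. Proof. exact: map_mxD. Qed.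
Lemma cxN x : cx (- x) = - cx x. Proof. exact: map_mxN. Qed.
Lemma cx0 : cx 0 = 0 :> 'M[C]_(p, q). Proof. exact: map_mx0. Qed.
Lemma cxr x : rx (cx x) = x.
Proof. by have := rx_cx x 0; rewrite cx0 scaler0 addr0. Qed.
Lemma cxi x : ix (cx x) = 0.
Proof. by have := ix_cx x 0; rewrite cx0 scaler0 addr0. Qed.
Lemma cx_inj x y : cx x = cx y -> x = y.
Proof. by move=> /(congr1 rx); rewrite !cxr. Qed.

Lemma rxP a z w : rx (a *: z + w) = re a *: rx z - im a *: ix z + rx w.
Proof.
apply/matrixP=> i j; rewrite !mxE.
have [-> _] := re_imD (a * z i j) (w i j); have [-> _] := re_imM a (z i j).
by [].
Qed.

Lemma ixP a z w : ix (a *: z + w) = re a *: ix z + im a *: rx z + ix w.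
Proof.
apply/matrixP=> i j; rewrite !mxE.
have [_ ->] := re_imD (a * z i j) (w i j); have [_ ->] := re_imM a (z i j).
by [].
Qed.

Lemma rx0 : rx (0 : 'M[C]_(p, q)) = 0. Proof. by rewrite -cx0 cxr. Qed.
Lemma ix0 : ix (0 : 'M[C]_(p, q)) = 0. Proof. by rewrite -cx0 cxi. Qed.

Lemma cx_scale a x y : a *: (cx x + I *: cx y) =
  cx (re a *: x - im a *: y) + I *: cx (re a *: y + im a *: x).
Proof.
apply: etrans (cxE _) _; congr (cx _ + I *: cx _).
  have := rxP a (cx x + I *: cx y) 0; rewrite addr0 => ->.
  by rewrite rx_cx ix_cx rx0 addr0.
have := ixP a (cx x + I *: cx y) 0; rewrite addr0 => ->.
by rewrite rx_cx ix_cx ix0 addr0.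
Qed.

Lemma cx_add x y x' y' : (cx x + I *: cx y) + (cx x' + I *: cx y') =
  cx (x + x') + I *: cx (y + y').
Proof. by rewrite !cxD scalerDr addrACA. Qed.

Lemma cj_cx x : cj (cx x) = cx x.
Proof. by apply/matrixP=> i j; rewrite !mxE injJ. Qed.

Lemma rx_cj z : rx (cj z) = rx z.
Proof. by apply/matrixP=> i j; rewrite !mxE; have [-> _] := re_imJ (z i j). Qed.
Lemma ix_cj z : ix (cj z) = - ix z.
Proof. by apply/matrixP=> i j; rewrite !mxE; have [_ ->] := re_imJ (z i j). Qed.

End Rows.

Lemma cxM p q r (x : 'M[R]_(p, q)) (y : 'M[R]_(q, r)) : cx (x *m y) = cx x *m cx y.
Proof. exact: map_mxM. Qed.
Lemma cx_tr p q (x : 'M[R]_(p, q)) : cx x^T = (cx x)^T.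
Proof. by apply/matrixP=> i j; rewrite !mxE. Qed.

Section Bracket.
Variables (m : nat) (br : 'rV[R]_m -> 'rV[R]_m -> 'rV[R]_m).
Hypothesis lie : is_lie_bracket br.
Local Notation V := 'rV[C]_m.

Definition cbr (z w : V) : V :=
  cx (br (rx z) (rx w) - br (ix z) (ix w)) + I *: cx (br (rx z) (ix w) + br (ix z) (rx w)).

Let brl := lie_linearl lie.
Let brr := lie_linearr lie.
Let bra := lie_alternating lie.
Let br0l z : br 0 z = 0.
Proof. by have := brl (-1) 0 0 z; rewrite scaler0 addr0 scaleN1r addNr. Qed.
Let br0r z : br z 0 = 0.
Proof. by have := brr (-1) 0 0 z; rewrite scaler0 addr0 scaleN1r addNr. Qed.
Let brDl x y z : br (x + y) z = br x z + br y z.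
Proof. by have := brl 1 x y z; rewrite !scale1r. Qed.
Let brDr x y z : br z (x + y) = br z x + br z y.
Proof. by have := brr 1 x y z; rewrite !scale1r. Qed.
Let brZl a x z : br (a *: x) z = a *: br x z.
Proof. by have := brl a x 0 z; rewrite !addr0 br0l addr0. Qed.
Let brZr a x z : br z (a *: x) = a *: br z x.
Proof. by have := brr a x 0 z; rewrite !addr0 br0r addr0. Qed.
Let brN x z : br (- x) z = - br x z.
Proof. by rewrite -scaleN1r brZl scaleN1r. Qed.
Let brNr x z : br z (- x) = - br z x.
Proof. by rewrite -scaleN1r brZr scaleN1r. Qed.
Let brskew x y : br x y = - br y x.
Proof.
by have := bra (x + y); rewrite brDl !brDr !bra add0r addr0 => /eqP; rewrite addr_eq0 => /eqP.
Qed.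

Lemma cbr_cx x y : cbr (cx x) (cx y) = cx (br x y).
Proof. by rewrite /cbr !cxr !cxi !br0l br0r subr0 addr0 cx0 scaler0 addr0. Qed.

Lemma cbr_skew z w : cbr z w = - cbr w z.
Proof.
rewrite /cbr opprD -scalerN -!cxN; congr (cx _ + I *: cx _).
  by rewrite (brskew (rx z)) (brskew (ix z)) opprD.
by rewrite (brskew (rx z)) (brskew (ix z)) opprD addrC.
Qed.

Lemma cbr_alt z : cbr z z = 0.
Proof. by rewrite /cbr !bra subr0 (brskew (ix z)) subrr cx0 scaler0 addr0. Qed.

Let cbr_l a u v w : cbr (a *: u + v) w = a *: cbr u w + cbr v w.
Proof.
rewrite /cbr cx_scale cx_add; congr (cx _ + I *: cx _);
  rewrite rxP ixP !(brDl, brN, brZl); apply/rowP=> j; rewrite !mxE; ring.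
Qed.

Lemma cbr_bilin : bilin cbr.
Proof.
split=> a u v w; first exact: cbr_l.
by rewrite cbr_skew cbr_l (cbr_skew u) (cbr_skew v) scalerN -opprD opprK.
Qed.

Lemma cbr_cj u v : cbr (cj u) (cj v) = cj (cbr u v).
Proof.
rewrite /cbr !rx_cj !ix_cj cjD cjZ !cj_cx IJ !brN !brNr !opprK scaleNr -scalerN -cxN.
by rewrite opprD.
Qed.

(** Complex multilinear identities need checking on real vectors only; Jacobi and integrability are
    transferred this way, one argument at a time. *)
Lemma ext_real (g : V -> V) :
  (forall u v, g (u + v) = g u + g v) -> (forall a u, g (a *: u) = a *: g u) ->
  (forall x, g (cx x) = 0) -> forall z, g z = 0.
Proof. by move=> gD gZ g0 z; rewrite (cxE z) gD gZ !g0 scaler0 addr0. Qed.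

Let cD1 x y z : cbr (x + y) z = cbr x z + cbr y z.
Proof. by have := cbr_bilin.1 1 x y z; rewrite !scale1r. Qed.
Let cD2 x y z : cbr z (x + y) = cbr z x + cbr z y.
Proof. by have := cbr_bilin.2 1 x y z; rewrite !scale1r. Qed.
Let c01 z : cbr 0 z = 0.
Proof. by rewrite -(cx0 1 m) /cbr cxr cxi !br0l subr0 addr0 cx0 scaler0 addr0. Qed.
Let c02 z : cbr z 0 = 0. Proof. by rewrite cbr_skew c01 oppr0. Qed.
Let cZ1 a x z : cbr (a *: x) z = a *: cbr x z.
Proof. by have := cbr_bilin.1 a x 0 z; rewrite !addr0 c01 addr0. Qed.
Let cZ2 a x z : cbr z (a *: x) = a *: cbr z x.
Proof. by have := cbr_bilin.2 a x 0 z; rewrite !addr0 c02 addr0. Qed.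

Let add3 (x y z x' y' z' : V) : (x + x') + (y + y') + (z + z') = (x + y + z) + (x' + y' + z').
Proof. by rewrite (addrACA x x') (addrACA (x + y)). Qed.

Lemma cbr_jacobi x y z : cbr x (cbr y z) + cbr y (cbr z x) + cbr z (cbr x y) = 0.
Proof.
move: x; apply: ext_real => [u v|a u|x].
- by rewrite !(cD1, cD2) add3.
- by rewrite !(cZ1, cZ2) -!scalerDr.
move: y; apply: ext_real => [u v|a u|y].
- by rewrite !(cD1, cD2) add3.
- by rewrite !(cZ1, cZ2) -!scalerDr.
move: z; apply: ext_real => [u v|a u|z].
- by rewrite !(cD1, cD2) add3.
- by rewrite !(cZ1, cZ2) -!scalerDr.
by rewrite !cbr_cx -!cxD (lie_jacobi lie) cx0.
Qed.

(** On (1,0)-vectors the complexified Nijenhuis tensor is [2 (b + I b J)], that is four times the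
    (0,1)-part of the bracket [b]. *)
Lemma cbr_int (J : 'M[R]_m) : is_complex_structure br J ->
  forall u v, p01 I (cx J) (cbr (p10 I (cx J) u) (p10 I (cx J) v)) = 0.
Proof.
move=> [JJ nij].
have cJJ : cx J *m cx J = - 1%:M.
  rewrite -cxM JJ cxN; congr (- _); exact: map_mx1.
pose N z w : V := cbr z w + cbr (z *m cx J) w *m cx J + cbr z (w *m cx J) *m cx J -
  cbr (z *m cx J) (w *m cx J).
have add4 (x y z t x' y' z' t' : V) :
    (x + x') + (y + y') + (z + z') - (t + t') = (x + y + z - t) + (x' + y' + z' - t').
  by rewrite add3 opprD addrACA.
have N0 z w : N z w = 0.
  move: z; apply: ext_real => [u v|a u|x].
  - rewrite /N (mulmxDl u v) !cD1 (mulmxDl (cbr (u *m _) _)) (mulmxDl (cbr u _)).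
    exact: add4.
  - rewrite /N -(scalemxAl a u) !cZ1 -(scalemxAl a (cbr (u *m _) _)) -(scalemxAl a (cbr u _)).
    by rewrite -!scalerDr -scalerBr.
  move: w; apply: ext_real => [u v|a u|y].
  - rewrite /N (mulmxDl u v) !cD2 (mulmxDl (cbr _ u)) (mulmxDl (cbr _ (u *m _))).
    exact: add4.
  - rewrite /N -(scalemxAl a u) !cZ2 -(scalemxAl a (cbr _ u)) -(scalemxAl a (cbr _ (u *m _))).
    by rewrite -!scalerDr -scalerBr.
  rewrite /N -!cxM !cbr_cx -!cxM -!cxD -cxN -cxD.
  by have := nij x y; rewrite /nijenhuis => ->; rewrite cx0.
move=> u v; set z := p10 _ _ u; set w := p10 _ _ v.
have zJ : z *m cx J = I *: z := projJ10 i2 cJJ u.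
have wJ : w *m cx J = I *: w := projJ10 i2 cJJ v.
have := N0 z w; clearbody z w; rewrite /N zJ wJ !(cZ1, cZ2) scalerA i2 scaleN1r opprK -!scalemxAl.
set b := cbr z w => e; rewrite /p01; apply/eqP; rewrite scaler_eq0 invr_eq0 (negbTE two0) /=.
move: e; rewrite addrAC -addrA => e.
have : 2 *: (b + I *: (b *m cx J)) = 0.
  by rewrite scaler_nat mulr2n -[RHS]e addrACA addrA.
by move/eqP; rewrite scaler_eq0 (negbTE two0).
Qed.

Lemma lower_central_sub k x y : lower_central br k x -> lower_central br k y ->
  lower_central br k (x - y).
Proof.
case: k => [//|k] hx hy U hU; have := rpredB (hx U hU) (hy U hU).
by [].
Qed.

Lemma lower_central_br k x y : lower_central br k y -> lower_central br k.+1 (br x y).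
Proof. by move=> hy U hU; rewrite brskew rpredN hU. Qed.

Lemma lower_central_opp k x : lower_central br k x -> lower_central br k (- x).
Proof. by case: k => [//|k] hx U hU; rewrite rpredN hx. Qed.

Lemma cbr_nil : is_nilpotent br -> exists N, forall s x, size s = N -> foldr cbr x s = 0.
Proof.
move=> [N hN]; exists N => s x ss.
(* Real and imaginary parts are followed separately, each staying in the real lower central
   series. *)
have key : forall s x, lower_central br (size s) (rx (foldr cbr x s)) /\
    lower_central br (size s) (ix (foldr cbr x s)).
  elim=> [//|z s' IH] y; have [h1 h2] := IH y.
  rewrite [foldr _ _ _]/= [size _]/=; set w := foldr _ _ _ in h1 h2 *.
  rewrite /cbr rx_cx ix_cx; split.
    by apply: lower_central_sub; apply: lower_central_br.
  rewrite -[X in _ + X]opprK; apply: lower_central_sub; first exact: lower_central_br.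
  exact/lower_central_opp/lower_central_br.
have [h1 h2] := key s x; rewrite ss in h1 h2.
by rewrite (cxE (foldr _ _ _)) (hN _ h1) (hN _ h2) cx0 scaler0 addr0.
Qed.

End Bracket.

Section Metric.
Variable J : 'M[R]_8.
Hypothesis JJ : J *m J = - 1%:M.

Lemma cx_JJ : cx J *m cx J = - 1%:M.
Proof. by rewrite -cxM JJ cxN; congr (- _); exact: map_mx1. Qed.

(** Only the algebraic properties of [inj] are given, so positivity comes from writing the image of
    [x] as the squared norm of the image of its square root. *)
Lemma inj_ge0 x : (0 <= x) -> 0 <= inj x.
Proof.
move=> x0; rewrite -(sqr_sqrtr x0) expr2 rmorphM /= -{2}injJ -normCK.
exact: exprn_ge0.
Qed.

Lemma inj_gt0 x : (0 < inj x) = (0 < x).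
Proof.
have inj0 y : (inj y == 0) = (y == 0) by rewrite fmorph_eq0.
have gt y : 0 < y -> 0 < inj y by move=> y0; rewrite lt0r inj0 gt_eqF // inj_ge0 // ltW.
apply/idP/idP; last exact: gt.
case: (ltgtP x 0) => // [x0|->]; last by rewrite rmorph0 ltxx.
have := gt (- x); rewrite oppr_gt0 rmorphN => /(_ x0) h1 h2.
by have := addr_gt0 h1 h2; rewrite addNr ltxx.
Qed.

Lemma metric_hermitian h : is_hermitian_metric J h -> is_hermitian I (cx J) (cx h).
Proof.
move=> [hs hp hJ]; split.
- by rewrite -cx_tr hs.
- exact: cj_cx.
- rewrite -cx_tr -!cxM; congr cx; apply/matrixP=> i j.
  have := hJ (delta_mx 0 i) (delta_mx 0 j); rewrite trmx_mul !mulmxA.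
  have e (M : 'M[R]_8) : ((delta_mx 0 i : 'rV[R]_8) *m M *m (delta_mx 0 j : 'rV[R]_8)^T) 0 0 = M i j.
    by rewrite -rowE trmx_delta -colE !mxE.
  by rewrite -e !mulmxA => ->; rewrite e.
- move=> u _ u0; set x := rx u; set y := ix u.
  have uE : u = cx x + I *: cx y := cxE u.
  have cu : cj u = cx x - I *: cx y by rewrite uE cjD cjZ !cj_cx IJ scaleNr.
  (* Symmetry of [h] cancels the cross terms, leaving [h(x, x) + h(y, y)]. *)
  have yx : y *m h *m x^T = x *m h *m y^T.
    have -> : y *m h *m x^T = (x *m h *m y^T)^T.
      by rewrite !trmx_mul trmxK hs mulmxA.
    by apply/matrixP=> i j; rewrite mxE !ord1.
  have -> : u *m cx h *m (cj u)^T = cx (x *m h *m x^T + y *m h *m y^T).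
    rewrite cu uE; have -> : (cx x - I *: cx y)^T = cx x^T - I *: cx y^T.
      by apply/matrixP=> i j; rewrite !mxE.
    rewrite mulmxDl mulmxBr !mulmxDl -!scalemxAl -!scalemxAr -?scalemxAl -!cxM yx.
    rewrite scalerA i2 scaleN1r opprD opprK cxD.
    by rewrite addrA addrK.
  rewrite mxE inj_gt0 mxE.
  have ge (v : 'rV[R]_8) : 0 <= (v *m h *m v^T) 0 0.
    by have [->|v0] := eqVneq v 0; [rewrite !mul0mx mxE|rewrite ltW // hp].
  have [x0|x0] := eqVneq x 0; last by rewrite ltr_pwDl // hp.
  rewrite ltr_wpDl // hp //; apply: contra_neq u0 => y0.
  by rewrite uE x0 y0 !cx0 scaler0 addr0.
Qed.

(** [frame_metric W] is invariant under conjugation, so its imaginary part is 0 and it comes from a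
    real Gram matrix. *)
Lemma frame_real_metric E W : is_frame I (cx J) E W ->
  exists2 h, is_hermitian_metric J h & cx h = frame_metric W.
Proof.
move=> EWf; have [WE EW] := EWf.
have [hh _] := frame_metricP i2 IJ cx_JJ (cj_cx J) EWf.
have ch : cx (rx (frame_metric W)) = frame_metric W.
  have := cxE (frame_metric W).
  have -> : ix (frame_metric W) = 0; last by rewrite cx0 scaler0 addr0 => <-.
  have /(congr1 (@ix _ _)) := herm_real hh; rewrite ix_cj => /eqP.
  rewrite eq_sym -addr_eq0 -mulr2n -scaler_nat scaler_eq0 pnatr_eq0 /=.
  by move/eqP.
exists (rx (frame_metric W)); last exact: ch.
split.
- by apply: cx_inj; rewrite cx_tr ch (herm_sym hh).
- move=> x x0; rewrite -inj_gt0.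
  have -> : inj ((x *m rx (frame_metric W) *m x^T) 0 0) =
      (cx x *m frame_metric W *m (cx x)^T) 0 0.
    by rewrite -[in RHS]ch -cx_tr -!cxM [RHS]mxE.
  have -> : cx x *m frame_metric W *m (cx x)^T =
     (cx x *m W) *m (cj (cx x *m W))^T + cj (cx x *m W) *m (cx x *m W)^T.
    by rewrite /frame_metric mulmxDr mulmxDl cjM cj_cx !trmx_mul !mulmxA.
  have nz : cx x *m W != 0.
    apply: contra_neq x0 => e; apply: cx_inj; rewrite cx0.
    have p0 : p10 I (cx J) (cx x) = 0 by rewrite p10E -WE mulmxA e mul0mx.
    rewrite -(proj_sum I (cx J) two0 (cx x)) p0 add0r -{1}(cj_cx x).
    by rewrite (p01_cj IJ (cj_cx J)) p0 cj0.
  have [k hk] : exists k, (cx x *m W) 0 k != 0.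
    apply/existsP; apply: contraR nz; rewrite negb_exists => /forallP hk.
    by apply/eqP/rowP=> k; have := hk k; rewrite negbK => /eqP ->; rewrite mxE.
  set f := cx x *m W in hk *.
  have pos : 0 < (f *m (cj f)^T) 0 0.
    rewrite mxE (bigD1 k) //= ltr_wpDr //; first apply: sumr_ge0 => i _.
      by rewrite [(_^T) _ _]mxE cjE -normCK exprn_ge0.
    by rewrite [(_^T) _ _]mxE cjE -normCK exprn_gt0 // normr_gt0.
  rewrite mxE; have -> : (cj f *m f^T) 0 0 = (f *m (cj f)^T) 0 0.
    by rewrite !mxE; apply: eq_bigr => i _; rewrite !mxE mulrC.
  exact: addr_gt0.
- move=> x y; have e : J *m rx (frame_metric W) *m J^T = rx (frame_metric W).
    by apply: cx_inj; rewrite !cxM cx_tr ch (herm_J hh).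
  by rewrite trmx_mul !mulmxA -[in RHS]e !mulmxA.
Qed.

End Metric.
End Complexification.

(** * Coframes *)

Section OneForms.
Variables (C : numClosedFieldType) (m : nat) (I : C) (J : 'M[C]_m).
Hypotheses (i2 : I * I = -1) (JJ : J *m J = - 1%:M).
Local Notation V := 'rV[C]_m.
Implicit Type f : mform C m 1.

Let arg1 (X : 'I_1 -> V) : X = fun=> X 0.
Proof. by apply/funext => l; rewrite ord1. Qed.

Lemma extd_1form B f X : extd B f X = - f (fun=> B (X 0) (X 1)).
Proof.
rewrite /extd !big_ord_recl !big_ord0 /= !addr0 big_mkcond /= !big_ord_recl !big_ord0 /=.
rewrite big_mkcond /= !big_ord_recl !big_ord0 /= !(addr0, add0r) expr1 mulN1r.
congr (- f _); apply/funext => l.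
have -> : lift (lift ord0 ord0 : 'I_2) l = ord0 by rewrite (ord1 l); apply: val_inj.
by rewrite upd_eq (_ : lift ord0 ord0 = 1); [|apply: val_inj].
Qed.

Lemma bidegree_1form f X : bidegree I J 1 f X = f (fun=> p10 I J (X 0)).
Proof.
rewrite /bidegree (big_pred1 [set: 'I_1]%SET) => [|S].
  by congr f; apply/funext => l; rewrite finset.in_setT ord1.
rewrite /= eqEcard finset.subsetT cardsT card_ord /= eqn_leq.
by have := max_card (mem S); rewrite card_ord => ->.
Qed.

Definition form10 f := (mlin f /\ alt f) /\ forall X, bidegree I J 1 f X = f X.

Definition coframe10 n (w : 'I_n -> mform C m 1) :=
  (forall k, form10 (w k)) /\
  (forall f, form10 f -> exists! c : 'rV[C]_n, forall X, f X = \sum_(k < n) c 0 k * w k X).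

Definition cjform k (f : mform C m k) : mform C m k := fun X => (f (fun j => cj (X j)))^*.

Definition colform n (W : 'M[C]_(m, n)) (k : 'I_n) : mform C m 1 := fun X => (X 0 *m W) 0 k.

Lemma mlin_1form f : mlin f <->
  forall a u v, f (fun=> a *: u + v) = a * f (fun=> u) + f (fun=> v).
Proof.
have updE (X : 'I_1 -> V) j v : upd X j v = fun=> v.
  by apply/funext => l; rewrite /upd !ord1 eqxx.
split=> [fl a u v|h X j a u v]; last by rewrite !updE.
by have := fl (fun=> 0) 0 a u v; rewrite !updE.
Qed.

Lemma form10P f : form10 f <->
  (forall a u v, f (fun=> a *: u + v) = a * f (fun=> u) + f (fun=> v)) /\
  (forall u, f (fun=> p10 I J u) = f (fun=> u)).
Proof.
split=> [[[/mlin_1form fl fa] fb]|[/mlin_1form fl fb]].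
  by split=> // u; rewrite -[RHS]fb bidegree_1form.
split; [split=> //|].
  by move=> X j l; rewrite !ord1 eqxx.
by move=> X; rewrite bidegree_1form fb [X in RHS]arg1.
Qed.

Lemma form1_mulmx f p (x : 'rV[C]_p) (M : 'M[C]_(p, m)) :
  (forall a u v, f (fun=> a *: u + v) = a * f (fun=> u) + f (fun=> v)) ->
  f (fun=> x *m M) = \sum_k x 0 k * f (fun=> row k M).
Proof.
move=> fl; pose g u := f (fun=> u).
have gD : {morph g : u v / u + v} by move=> u v; have := fl 1 u v; rewrite scale1r mul1r.
have g0 : g 0 = 0 by have := gD 0 0; rewrite addr0 -{1}[g 0]addr0 => /addrI/esym.
rewrite mulmx_sum_row -/(g _) (big_morph g gD g0); apply: eq_bigr => k _.
by have := fl (x 0 k) (row k M) 0; rewrite addr0 -!/(g _) g0 addr0.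
Qed.

Lemma form10_col n (M : 'M[C]_(m, n)) k : Pi I J *m M = M -> form10 (colform M k).
Proof.
move=> PM; apply/form10P; rewrite /colform; split=> [a u v|u].
  by rewrite mulmxDl -scalemxAl !mxE.
by rewrite p10E -mulmxA PM.
Qed.

Lemma coframe_of_frame n (E : 'M[C]_(n, m)) (W : 'M[C]_(m, n)) :
  W *m E = Pi I J -> E *m W = 1%:M -> coframe10 (colform W).
Proof.
move=> WE EW; split=> [k|f /form10P[fl fp]].
  by apply: form10_col; rewrite -WE -mulmxA EW mulmx1.
exists (\row_k f (fun=> row k E)); split=> [X|c cE].
  rewrite [X in f X]arg1 -fp p10E -WE mulmxA form1_mulmx //.
  by apply: eq_bigr => k _; rewrite [(\row__ _) 0 k]mxE mulrC.
apply/rowP=> k; rewrite mxE cE (bigD1 k) //= big1 => [|l lk].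
  by rewrite /colform -row_mul EW addr0 !mxE eqxx mulr1.
by rewrite /colform -row_mul EW !mxE eq_sym (negbTE lk) mulr0.
Qed.

(** The columns of [Pi] are (1,0)-forms; their coordinates in the coframe are the entries of the
    dual frame [E]. *)
Lemma frame_of_coframe n (w : 'I_n -> mform C m 1) : coframe10 w ->
  exists (E : 'M[C]_(n, m)) (W : 'M[C]_(m, n)),
    [/\ W *m E = Pi I J, E *m W = 1%:M & w = colform W].
Proof.
move=> [wf wb]; pose W := \matrix_(v, k) w k (fun=> delta_mx 0 v).
have wE : w = colform W.
  apply/funext => k; apply/funext => X; have /form10P[fl _] := wf k.
  rewrite [X in w k X]arg1 -[X 0]mulmx1 form1_mulmx // /colform mxE.
  by apply: eq_bigr => v _; rewrite mxE row1.
have PP : Pi I J *m Pi I J = Pi I J by exact: (Pi_idem i2 JJ).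
have /choice[c cE] : forall v, exists c : 'rV[C]_n,
    forall X, colform (Pi I J) v X = \sum_k c 0 k * w k X.
  by move=> v; have [c [cE _]] := wb _ (form10_col v PP); exists c.
pose E := \matrix_(k, v) c v 0 k.
have WE : W *m E = Pi I J.
  apply/row_matrixP=> i; apply/rowP=> v; rewrite row_mul.
  have := cE v (fun=> delta_mx 0 i); rewrite wE /colform -!rowE => ->.
  by rewrite mxE; apply: eq_bigr => k' _; rewrite [_ k' v]mxE mulrC.
exists E, W; split=> //; apply/matrixP=> k l.
(* [w l] has two expansions in the coframe, the obvious one and the one through [W E = Pi];
   uniqueness turns their equality into [E W = 1]. *)
have [d [_ dU]] := wb _ (wf l).
have h1 : d = \row_k (E *m W) k l.
  apply: dU => X; have /form10P[_ fp] := wf l.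
  rewrite [X in w l X]arg1 -fp p10E -WE {1}wE /colform -mulmxA -mulmxA mulmxA mxE.
  by apply: eq_bigr => k' _; rewrite wE [(\row__ _) 0 k']mxE mulrC.
have h2 : d = delta_mx 0 l.
  apply: dU => X; rewrite (bigD1 l) //= big1 => [|k' kl]; rewrite !mxE.
    by rewrite !eqxx mul1r addr0.
  by rewrite (negbTE kl) andbF mul0r.
have := congr1 (fun r : 'rV_n => r 0 k) h1; rewrite h2 !mxE eqxx /= => <-.
by [].
Qed.

End OneForms.

Section StructureForms.
Variables (C : numClosedFieldType) (B : 'rV[C]_8 -> 'rV[C]_8 -> 'rV[C]_8) (W : 'M[C]_(8, 4)).
Local Notation up := (lift (ord_max : 'I_4)).
Local Notation w := (colform W).

Lemma closed_forms : (forall j X, extd B (w (up j)) X = 0) <->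
  (forall j u v, cw W (B u v) (up j) = 0).
Proof.
split=> [h j u v|h j X]; last by rewrite extd_1form /colform -/(cw W _ _) h oppr0.
have := h j (vecs [:: u; v]); rewrite extd_1form /colform => /eqP.
by rewrite oppr_eq0 => /eqP.
Qed.

Lemma structure_forms (A D : 'M[C]_3) :
  (forall X, extd B (w ord_max) X =
     \sum_(j < 3) \sum_(k < 3 | (j < k)%N) A j k * fwedge (w (up j)) (w (up k)) X +
     \sum_(j < 3) \sum_(k < 3) D j k * fwedge (w (up j)) (cjform (w (up k))) X) <->
  structure_eq B W A D.
Proof.
have e1 j k X : fwedge (w j) (w k) X =
    cw W (X 0) j * cw W (X 1) k - cw W (X 1) j * cw W (X 0) k.
  exact: (fwedge11 (cw W ^~ j) (cw W ^~ k)).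
have e2 j k X : fwedge (w j) (cjform (w k)) X =
    cw W (X 0) j * cwb W (X 1) k - cw W (X 1) j * cwb W (X 0) k.
  exact: (fwedge11 (cw W ^~ j) (cwb W ^~ k)).
split=> [h u v|h X].
  have := h (vecs [:: u; v]); rewrite extd_1form => e; apply: etrans e _.
  by congr (_ + _); apply: eq_bigr => j _; apply: eq_bigr => k _; rewrite ?e1 ?e2.
rewrite extd_1form; apply: etrans (h (X 0) (X 1)) _.
by congr (_ + _); apply: eq_bigr => j _; apply: eq_bigr => k _; rewrite ?e1 ?e2.
Qed.

End StructureForms.

(** * The equivalence over an abstract copy of the complex numbers *)

Section Abstract.
Variables (R : realType) (C : numClosedFieldType) (inj : {rmorphism R -> C}).
Variables (re im : C -> R) (I : C).
Hypothesis cE : forall z, z = inj (re z) + I * inj (im z).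
Hypothesis reE : forall a b, re (inj a + I * inj b) = a.
Hypothesis imE : forall a b, im (inj a + I * inj b) = b.
Hypotheses (i2 : I * I = -1) (IJ : I^* = - I) (injJ : forall a, (inj a)^* = inj a).
Variable br : 'rV[R]_8 -> 'rV[R]_8 -> 'rV[R]_8.
Hypotheses (br_lie : is_lie_bracket br) (br_nil : is_nilpotent br).
Variable J : 'M[R]_8.
Hypothesis J_cplx : is_complex_structure br J.
Local Notation B := (cbr inj re im I br).
Local Notation cx := (cx inj).
Local Notation up := (lift (ord_max : 'I_4)).

Theorem astheno_iff_coframe :
  (exists h : 'M[R]_8, is_hermitian_metric J h /\ forall X,
     let F := form2 (hform (cx J) (cx h)) in
     fdel I (cx J) B (fdelbar I (cx J) B (fwedge F (fwedge F (fun _ : 'I_0 -> 'rV_8 => 1)))) X = 0) <->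
  (exists w : 'I_4 -> mform C 8 1, coframe10 I (cx J) w /\
   exists A D : 'M[C]_3,
   [/\ forall j X, extd B (w (up j)) X = 0,
       forall X, extd B (w ord_max) X =
         \sum_(j < 3) \sum_(k < 3 | (j < k)%N) A j k * fwedge (w (up j)) (w (up k)) X +
         \sum_(j < 3) \sum_(k < 3) D j k * fwedge (w (up j)) (cjform (w (up k))) X
     & torsion A D = 0]).
Proof.
have JJ := cx_JJ inj J_cplx.1.
have Jr := cj_cx injJ J.
have Bb := cbr_bilin cE reE imE i2 br_lie.
have Ba := cbr_alt inj re im I br_lie.
have Bjac := cbr_jacobi cE reE imE i2 br_lie.
have Bcj := cbr_cj cE reE imE IJ injJ br_lie.
have Bint := cbr_int cE reE imE i2 br_lie J_cplx.
have Bnil := cbr_nil cE reE imE br_lie br_nil.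
have sq h : is_hermitian_metric J h ->
    fwedge (form2 (hform (cx J) (cx h)))
      (fwedge (form2 (hform (cx J) (cx h))) (fun _ : 'I_0 -> 'rV_8 => 1)) =
    sqform (hform (cx J) (cx h)).
  move=> hh; have hH := metric_hermitian cE i2 IJ injJ hh.
  have sk u v := hform_skew JJ hH u v.
  by apply/funext => X; apply: fwedge_square => // Y; apply: fwedge_pow1.
split=> [[h [hh hX]]|[w [wc [A [D [w1 w2 T]]]]]].
  have hH := metric_hermitian cE i2 IJ injJ hh; rewrite /= sq // in hX.
  have [E [W [A [D [[WE EW] cl st T]]]]] :=
    astheno_coframe i2 IJ JJ Jr Bb Ba Bjac Bcj Bint Bnil hH hX.
  exists (colform W); split; first exact: coframe_of_frame WE EW.
  by exists A, D; split=> //; [exact/closed_forms|exact/structure_forms].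
have [E [W [WE EW wE]]] := frame_of_coframe i2 JJ wc; rewrite wE in w1 w2.
have EWf : is_frame I (cx J) E W by [].
have [h hh hE] := frame_real_metric cE reE imE i2 IJ injJ J_cplx.1 EWf.
exists h; split=> //=; rewrite sq // hE.
apply: (coframe_astheno i2 IJ JJ Jr Bb Ba Bcj Bint Bnil) EWf _ _ T.
  exact/closed_forms.
exact/structure_forms.
Qed.

End Abstract.

Local Open Scope classical_set_scope.
Local Open Scope ring_scope.
Local Open Scope complex_scope.

Lemma imag_sq (R : realType) : ('i : R[i]) * 'i = -1.
Proof. by rewrite -expr2 sqr_i. Qed.

Lemma conj_imag (R : realType) : Num.conj ('i : R[i]) = - 'i.
Proof. by rewrite /Num.conj /= /conjc; congr Complex; rewrite oppr0. Qed.

Lemma conj_real (R : realType) (a : R) : Num.conj (a%:C) = a%:C.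
Proof. by rewrite /Num.conj /= /conjc oppr0. Qed.

Lemma cplx_Re (R : realType) (a b : R) : complex.Re (a%:C + 'i * b%:C) = a.
Proof. by rewrite /= !mul0r !mulr0 ?mul1r !subr0 ?addr0 ?add0r. Qed.

Lemma cplx_Im (R : realType) (a b : R) : complex.Im (a%:C + 'i * b%:C) = b.
Proof. by rewrite /= !mul0r mul1r !add0r. Qed.

(** * The notions of the statement over [R[i]] agree with the abstract ones by conversion *)

Section Compare.
Variables (R : realType).
Local Notation C := (R[i] : numClosedFieldType).
Local Notation inj := (real_complex R : {rmorphism R -> C}).
Variable br : 'rV[R]_8 -> 'rV[R]_8 -> 'rV[R]_8.
Local Notation B := (cbr inj (@complex.Re R) (@complex.Im R) ('i : C) br).

Lemma cplx_mxE p q (x : 'M[R]_(p,q)) : cplx_mx x = cx inj x.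
Proof. by []. Qed.

Lemma cplx_bracketE : cplx_bracket br = B.
Proof. by []. Qed.

Lemma fundamental_formE J h : fundamental_form J h = form2 (hform (cx inj J) (cx inj h)).
Proof. by []. Qed.

Lemma wedgeE p q f g : @wedge R 8 p q f g = @fwedge C 8 p q f g.
Proof. by []. Qed.

Lemma form_pow2E F : form_pow F (8./2 - 2) = @wedge R 8 2 2 F (@wedge R 8 2 0 F (fun=> 1)).
Proof. by []. Qed.

Lemma delbarE k J (f : inv_form R 8 k) :
  Defs.delbar br J f = fdelbar ('i : C) (cplx_mx J) (cplx_bracket br) f.
Proof. by []. Qed.

Lemma delE k J (f : inv_form R 8 k) :
  Defs.del br J f = fdel ('i : C) (cplx_mx J) (cplx_bracket br) f.
Proof. by []. Qed.

Lemma ext_dE k (f : inv_form R 8 k) : ext_d br f = extd (cplx_bracket br : _ -> _ -> 'rV[C]_8) f.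
Proof. by []. Qed.

Lemma is_coframe10E J n (w : 'I_n -> inv_form R 8 1) : is_coframe10 J w = coframe10 ('i : C) (cplx_mx J) w.
Proof. by []. Qed.

Lemma ddbar_form_powE J h X :
  Defs.del br J (Defs.delbar br J (form_pow (fundamental_form J h) (8./2 - 2))) X =
  fdel ('i : C) (cx inj J) B (fdelbar ('i : C) (cx inj J) B
    (fwedge (form2 (hform (cx inj J) (cx inj h)))
      (fwedge (form2 (hform (cx inj J) (cx inj h))) (fun _ : 'I_0 -> 'rV_8 => 1)))) X.
Proof.
by rewrite form_pow2E 2!wedgeE fundamental_formE delE delbarE cplx_mxE cplx_bracketE.
Qed.

End Compare.

Theorem theorem5p11 (R : realType)
    (br : 'rV[R]_8 -> 'rV[R]_8 -> 'rV[R]_8)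
    (br_lie : is_lie_bracket br) (br_nil : is_nilpotent br)
    (Gamma : set 'rV[R]_8) (Gamma_lattice : is_lattice br Gamma)
    (J : 'M[R]_8) (J_cplx : is_complex_structure br J) :
  (exists h : 'M[R]_8, is_astheno_kahler br J h) <->
  (exists w : 'I_4 -> inv_form R 8 1, is_coframe10 J w /\
   exists A B : 'M[R[i]]_3,
    let w' := fun j : 'I_3 => w (lift ord_max j) in
    [/\ forall (j : 'I_3) X, ext_d br (w' j) X = 0,
        forall X, ext_d br (w ord_max) X =
          \sum_(j < 3) \sum_(k < 3 | (j < k)%N)
             A j k * wedge (w' j) (w' k) X +
          \sum_(j < 3) \sum_(k < 3)
             B j k * wedge (w' j) (conj_form (w' k)) X
      & \sum_(j < 3) \sum_(k < 3 | (j < k)%N) `|A j k| ^+ 2 +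
        \sum_(j < 3) \sum_(k < 3) `|B j k| ^+ 2 -
        `|\sum_(j < 3) B j j| ^+ 2 = 0]).
Proof.
have [H1 H2] := @astheno_iff_coframe R R[i] (real_complex R) (@complex.Re R) (@complex.Im R) 'i
  (@complexE R) (@cplx_Re R) (@cplx_Im R) (@imag_sq R) (@conj_imag R) (@conj_real R)
  br br_lie br_nil J J_cplx.
split=> [[h [hm hX]]|[w [wc [A [B [w1 w2 T]]]]]].
  have [|w [wc [A [D [w1 w2 T]]]]] := H1.
    exists h; split; first exact: hm.
    by move=> X F; rewrite -[RHS](hX X) ddbar_form_powE.
  exists w; split; first by rewrite is_coframe10E; exact: wc.
  exists A, D; split; last exact: T.
    by move=> j X; rewrite ext_dE; exact: (w1 j X).
  by move=> X; rewrite ext_dE; exact: (w2 X).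
have [|h [hm hX]] := H2.
  exists w; split; first by rewrite -is_coframe10E; exact: wc.
  exists A, B; split; last exact: T.
    by move=> j X; exact: (w1 j X).
  by move=> X; exact: (w2 X).
exists h; split; first exact: hm.
move=> X; rewrite ddbar_form_powE.
exact: hX.
Qed.
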